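(* Let $n\ge1$. The Heisenberg Radon transform $R_H$ is an automorphism of the space $\Phi(\mathbb{H}_n)$.
   Context: $\mathbb{H}_n=\mathbb{C}^n\times\mathbb{R}$ (Heisenberg group), identified with $\mathbb{R}^{2n+1}$ for purposes of function spaces; $S(\mathbb{H}_n)$ is the Schwartz space. The Heisenberg Radon transform is $$(R_H f)(z,t)=\int_{\mathbb{C}^n}f\big(\zeta,\,t-\tfrac12\operatorname{Im}(z\cdot\bar\zeta)\big)\,d\zeta,\qquad z\cdot\bar\zeta=\sum_j z_j\bar\zeta_j.$$ $$\Phi(\mathbb{H}_n)=\Big\{\phi\in S(\mathbb{H}_n):\ \int_{\mathbb{R}}\phi(\zeta,\tau)\,\tau^k\,d\tau=0\ \ \forall k\in\{0,1,2,\ldots\},\ \forall\zeta\in\mathbb{C}^n\Big\},$$ with the topology induced from the Schwartz space; automorphism means linear homeomorphic bijection of the space onto itself. *)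

(* Defs.v *)
From HB Require Import structures.
From mathcomp Require Import all_boot all_order all_algebra.
From mathcomp Require Import complex.
From mathcomp Require Import all_classical all_reals all_analysis.
From mathcomp Require Import measurable_realfun.
Set Implicit Arguments.
Unset Strict Implicit.
Unset Printing Implicit Defensive.
Import Order.TTheory GRing.Theory Num.Theory.
Import numFieldNormedType.Exports.
Local Open Scope classical_set_scope.
Local Open Scope ring_scope.
Local Open Scope complex_scope.

Section lebesgue_tupleS.
Context (R : realType) (n : nat).
Local Notation rT := (measurableTypeR R).

Definition tuple_cons (p : rT * n.-tuple rT) : n.+1.-tuple rT :=
  [tuple of p.1 :: p.2].

Definition tuple_split (t : n.+1.-tuple rT) : rT * n.-tuple rT :=
  (thead t, [tuple of behead t]).

Lemma measurable_tuple_cons :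
  measurable_fun [set: rT * n.-tuple rT] tuple_cons.
Proof. exact: measurable_cons. Qed.

HB.instance Definition _ :=
  isMeasurableFun.Build _ _ _ _ tuple_cons measurable_tuple_cons.

Lemma measurable_tuple_split :
  measurable_fun [set: n.+1.-tuple rT] tuple_split.
Proof.
apply/measurable_fun_pairP; split; first exact: measurable_tnth.
exact: measurable_behead.
Qed.

Lemma tuple_consK : cancel tuple_cons tuple_split.
Proof.
by case=> x t; rewrite /tuple_split theadE; congr pair; apply/val_inj.
Qed.

Context (mu : {sigma_finite_measure set (n.-tuple rT) -> \bar R}).

(* The product of the Lebesgue measure on R and of mu, carried from
   R * n.-tuple R to n.+1.-tuple R. *)
Definition lebesgue_tupleS : set (n.+1.-tuple rT) -> \bar R :=
  pushforward (@lebesgue_measure R \x mu)%E tuple_cons.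

Let tupleS0 : lebesgue_tupleS set0 = 0%E.
Proof. exact: measure0. Qed.

Let tupleS_ge0 A : (0 <= lebesgue_tupleS A)%E.
Proof. exact: measure_ge0. Qed.

Let tupleS_sigma_additive : semi_sigma_additive lebesgue_tupleS.
Proof. exact: measure_semi_sigma_additive. Qed.

HB.instance Definition _ := isMeasure.Build _ _ _ lebesgue_tupleS
  tupleS0 tupleS_ge0 tupleS_sigma_additive.

Let lebesgue_tupleS_sigma_finite : sigma_finite setT lebesgue_tupleS.
Proof.
have /sigma_finiteP[F [TF ndF mF]] := sigma_finiteT (@lebesgue_measure R).
have /sigma_finiteP[G [TG ndG mG]] := sigma_finiteT mu.
have FE k : tuple_cons @^-1` (tuple_split @^-1` (F k `*` G k)) = F k `*` G k.
  by apply/seteqP; split => p; rewrite /preimage /mkset tuple_consK.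
exists (fun k => tuple_split @^-1` (F k `*` G k)).
  rewrite -preimage_bigcup -[LHS](preimage_setT tuple_split); congr (_ @^-1` _).
  rewrite -setXTT TF TG; apply/seteqP; split => -[x y] /=.
    move=> [[i _ Fix] [j _ Gjy]]; exists (maxn i j) => //; split.
    - by move: x Fix; exact/subsetPset/ndF/leq_maxl.
    - by move: y Gjy; exact/subsetPset/ndG/leq_maxr.
  by move=> [i _ [/= ? ?]]; split; exists i.
move=> k; have [mFk Fkoo] := mF k; have [mGk Gkoo] := mG k; split.
  rewrite -[X in measurable X]setTI; apply: measurable_tuple_split => //.
  exact: measurableX.
rewrite /lebesgue_tupleS /pushforward FE product_measure1E//.
by rewrite lte_mul_pinfty// ge0_fin_numE.
Qed.

HB.instance Definition _ := Measure_isSigmaFinite.Build _ _ _ lebesgue_tupleS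
  lebesgue_tupleS_sigma_finite.

End lebesgue_tupleS.

(* The n-fold product of the Lebesgue measure on R, that is, the Lebesgue
   measure on R^n. *)
Fixpoint lebesgue_tuple (R : realType) (n : nat) :
    {sigma_finite_measure set (n.-tuple (measurableTypeR R)) -> \bar R} :=
  match n with
  | 0 => dirac [tuple]
  | n'.+1 => lebesgue_tupleS (lebesgue_tuple R n')
  end.

(* MathComp-Analysis integrates real-valued functions only, so the integral of
   a complex function is taken componentwise. *)
Section complex_integral.
Context d (T : measurableType d) (R : realType).

Definition Cintegral (mu : {measure set T -> \bar R}) (g : T -> R[i]) : R[i] :=
  (\int[mu]_x complex.Re (g x)) +i* (\int[mu]_x complex.Im (g x)).

End complex_integral.

Lemma continuous_comb (R : realType) (T : topologicalType) (a b : R)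
  (g h : T -> R) : continuous g -> continuous h -> continuous (a *: g + b *: h).
Proof.
move=> cg ch x; apply: (@cvgD _ R^o).
  by apply: (@cvgZl_tmp _ R^o); exact: cg.
by apply: (@cvgZl_tmp _ R^o); exact: ch.
Qed.

Section linear_combination.
Context (R : realType) (V : normedModType R) (a b : R) (g h : V -> R) (x v : V).
Hypotheses (dg : derivable g x v) (dh : derivable h x v).

Lemma derivable_comb : derivable (a *: g + b *: h) x v.
Proof. by apply: derivableD; exact: derivableZ. Qed.

Lemma derive_comb : 'D_v (a *: g + b *: h) x = a *: 'D_v g x + b *: 'D_v h x.
Proof.
rewrite deriveD; [|exact: derivableZ|exact: derivableZ].
by rewrite deriveZ// deriveZ.
Qed.

End linear_combination.

Section schwartz_functions.
Context (R : realType) (m : nat).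
Implicit Types (g : 'rV[R]_m -> R) (f : 'rV[R]_m -> R[i]).
Implicit Types (alpha : {ffun 'I_m -> nat}) (s : seq 'I_m).

(* The iterated partial derivative of g along the coordinates listed in s. When
   s ranges over all sequences, all multi-indices are covered; for smooth g the
   order in which the coordinates are listed is irrelevant. *)
Definition iter_partial s g : 'rV[R]_m -> R :=
  foldr (fun i h => 'D_(delta_mx 0 i) h) g s.

(* C^infinity: all the iterated partial derivatives exist and are continuous. *)
Definition smooth g := forall s,
  continuous (iter_partial s g) /\
  forall x i, derivable (iter_partial s g) x (delta_mx 0 i).

(* R[i] has no structure of normed module over R, so complex functions are
   differentiated componentwise. *)
Definition Citer_partial s f : 'rV[R]_m -> R[i] := fun x =>
  iter_partial s (@complex.Re R \o f) x +i* iter_partial s (@complex.Im R \o f) x.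

(* The function x |-> x^alpha (d^s f)(x), the sup norm of which is one of the
   defining seminorms of the Schwartz space. *)
Definition weighted_partial alpha s f : 'rV[R]_m -> R[i] := fun x =>
  (\prod_(i < m) x 0 i ^+ alpha i)%:C * Citer_partial s f x.

Definition schwartz f :=
  [/\ smooth (@complex.Re R \o f), smooth (@complex.Im R \o f) &
      forall alpha s, exists M : R,
        forall x, `|weighted_partial alpha s f x| <= M%:C].

Lemma iter_partial0 s : iter_partial s (fun=> 0) = fun=> 0.
Proof. by elim: s => [//|i s /= ->]; apply/funext => x; rewrite derive_cst. Qed.

Lemma iter_partial_comb (a b : R) g h s : smooth g -> smooth h ->
  iter_partial s (a *: g + b *: h) =
  a *: iter_partial s g + b *: iter_partial s h.
Proof.
move=> sg sh; elim: s => [//|i s /= ->]; apply/funext => x.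
exact: derive_comb ((sg s).2 x i) ((sh s).2 x i).
Qed.

Lemma smooth0 : smooth (fun=> 0).
Proof.
move=> s; rewrite iter_partial0; split; first exact: cst_continuous.
by move=> x i; exact: derivable_cst.
Qed.

Lemma smooth_comb (a b : R) g h : smooth g -> smooth h ->
  smooth (a *: g + b *: h).
Proof.
move=> sg sh s; rewrite (iter_partial_comb _ _ _ sg sh); split=> [|x i].
  exact: continuous_comb (sg s).1 (sh s).1.
exact: derivable_comb ((sg s).2 x i) ((sh s).2 x i).
Qed.

Lemma Re_comb (a : R[i]) f1 f2 : @complex.Re R \o (a *: f1 + f2) =
  complex.Re a *: (@complex.Re R \o f1) +
  1 *: ((- complex.Im a) *: (@complex.Im R \o f1) + 1 *: (@complex.Re R \o f2)).
Proof.
apply/funext => x; rewrite !scale1r /= !fctE.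
by case: a (f1 x) (f2 x) => [a b] [c d] [e f] /=; rewrite -mulNr -addrA.
Qed.

Lemma Im_comb (a : R[i]) f1 f2 : @complex.Im R \o (a *: f1 + f2) =
  complex.Re a *: (@complex.Im R \o f1) +
  1 *: (complex.Im a *: (@complex.Re R \o f1) + 1 *: (@complex.Im R \o f2)).
Proof.
apply/funext => x; rewrite !scale1r /= !fctE.
by case: a (f1 x) (f2 x) => [a b] [c d] [e f] /=; rewrite -addrA.
Qed.

Lemma Citer_partial_comb (a : R[i]) f1 f2 s : schwartz f1 -> schwartz f2 ->
  Citer_partial s (a *: f1 + f2) =
  a *: Citer_partial s f1 + Citer_partial s f2.
Proof.
move=> [r1 i1 _] [r2 i2 _]; apply/funext => x.
rewrite /Citer_partial Re_comb Im_comb.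
rewrite (iter_partial_comb _ _ _ r1 (smooth_comb _ _ i1 r2)).
rewrite (iter_partial_comb _ _ _ i1 (smooth_comb _ _ r1 i2)).
rewrite (iter_partial_comb _ _ _ i1 r2) (iter_partial_comb _ _ _ r1 i2).
rewrite !scale1r !fctE; case: a => a b.
by rewrite /GRing.scale/=; congr (_ +i* _); rewrite -?mulNr -addrA.
Qed.

Lemma schwartz0 : schwartz 0.
Proof.
have C0 : [/\ @complex.Re R \o (0 : 'rV[R]_m -> R[i]) = fun=> 0 &
              @complex.Im R \o (0 : 'rV[R]_m -> R[i]) = fun=> 0] by [].
split; [exact: smooth0|exact: smooth0|move=> alpha s; exists 0 => x].
rewrite /weighted_partial /Citer_partial C0.1 C0.2 iter_partial0.
by rewrite mulr0 normr0.
Qed.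

Lemma schwartz_comb (a : R[i]) f1 f2 : schwartz f1 -> schwartz f2 ->
  schwartz (a *: f1 + f2).
Proof.
move=> sf1 sf2; have [r1 i1 b1] := sf1; have [r2 i2 b2] := sf2; split.
- by rewrite Re_comb; exact: smooth_comb r1 (smooth_comb _ _ i1 r2).
- by rewrite Im_comb; exact: smooth_comb i1 (smooth_comb _ _ r1 i2).
move=> alpha s; have [M1 M1P] := b1 alpha s; have [M2 M2P] := b2 alpha s.
exists (Normc.normc a * M1 + M2) => x.
rewrite /weighted_partial (Citer_partial_comb _ _ sf1 sf2) mulrDr.
rewrite (le_trans (ler_normD _ _))// rmorphD rmorphM.
have := M1P x; have := M2P x; rewrite /weighted_partial => M2x M1x.
apply: lerD M2x; rewrite [X in `|X|]mulrCA normrM.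
by apply: ler_wpM2l M1x; exact: normr_ge0.
Qed.

End schwartz_functions.

Definition heisenberg (R : realType) (n : nat) : Type := ('rV[R[i]]_n * R)%type.

(* C^n = R^(2n), zeta_j = u_j + i u_(n+j). *)
Definition complex_coord (R : realType) (n : nat) (u : 'rV[R]_(n + n)) :
    'rV[R[i]]_n :=
  \row_j (u 0 (lshift n j) +i* u 0 (rshift n j)).

(* C^n * R = R^(2n+1), the real coordinate coming last. *)
Definition heisenberg_coord (R : realType) (n : nat) (u : 'rV[R]_(n + n + 1)) :
    heisenberg R n :=
  (complex_coord (lsubmx u), rsubmx u 0 0).

Section schwartz_space.
Context (R : realType) (n : nat).

Definition schwartz_pred : {pred heisenberg R n -> R[i]} :=
  fun f => `[< schwartz (f \o @heisenberg_coord R n) >].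

Lemma schwartz_submod_closed : submod_closed schwartz_pred.
Proof.
split; first exact/asboolP/schwartz0.
move=> a f g /asboolP sf /asboolP sg; apply/asboolP.
exact: schwartz_comb a _ _ sf sg.
Qed.

HB.instance Definition _ :=
  GRing.isSubmodClosed.Build R[i] (heisenberg R n -> R[i])
    schwartz_pred schwartz_submod_closed.

Record schwartz_heisenberg := SchwartzHeisenberg {
  schwartz_fun :> heisenberg R n -> R[i];
  schwartz_funP : schwartz_fun \in schwartz_pred }.

HB.instance Definition _ := [isSub for schwartz_fun].
HB.instance Definition _ := [Choice of schwartz_heisenberg by <:].
HB.instance Definition _ := [SubChoice_isSubLmodule of schwartz_heisenberg by <:].

(* The Schwartz topology is the coarsest one for which each map
   f |-> x^alpha d^s f is continuous for uniform convergence on R^(2n+1); as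
   these maps are linear, it is the locally convex topology generated by the
   seminorms sup_x |x^alpha (d^s f)(x)|. *)
Definition schwartz_embedding (f : schwartz_heisenberg) :
    prod_topology (fun _ : {ffun 'I_(n + n + 1) -> nat} * seq 'I_(n + n + 1) =>
      {uniform 'rV[R]_(n + n + 1) -> R[i]^o}) :=
  fun k => weighted_partial k.1 k.2 (f \o @heisenberg_coord R n).

HB.instance Definition _ := Topological.copy schwartz_heisenberg
  (initial_topology schwartz_embedding).

End schwartz_space.

Section fiber_integrability.
Context (R : realType) (n : nat).
Implicit Types (z : 'rV[R[i]]_n) (t : R) (f : schwartz_heisenberg R n).

Let last_coord : 'I_(n + n + 1) := rshift (n + n) ord0.

Definition real_coord z t : 'rV[R]_(n + n + 1) :=
  row_mx (row_mx (\row_j complex.Re (z 0 j)) (\row_j complex.Im (z 0 j)))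
    (const_mx t).

Lemma real_coordK z t : heisenberg_coord (real_coord z t) = (z, t).
Proof.
rewrite /heisenberg_coord row_mxKl row_mxKr mxE; congr pair.
by apply/rowP => j; rewrite mxE row_mxEl row_mxEr !mxE; case: (z 0 j).
Qed.

Lemma real_coordE z t :
  real_coord z t = real_coord z 0 + t *: delta_mx 0 last_coord.
Proof.
apply/rowP => i; rewrite !mxE; case: (fintype.splitP i) => j ij; rewrite !mxE.
  suff /negbTE -> : i != last_coord by rewrite andbF mulr0 addr0.
  by rewrite -val_eqE /= ij ltn_eqF// addn0 ltn_ord.
suff -> : i = last_coord by rewrite !eqxx mulr1 add0r.
by apply/val_inj; rewrite /= ij ord1.
Qed.

Lemma continuous_line (V : normedModType R) (x v : V) (g : V -> R) :
  continuous g -> continuous (fun t : R => g (x + t *: v)).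
Proof.
move=> cg t; apply: continuous_comp; last exact: cg.
by apply: cvgD; [exact: cvg_cst|apply: cvgZr_tmp; exact: cvg_id].
Qed.

Let wt (k : nat) : {ffun 'I_(n + n + 1) -> nat} :=
  [ffun i => if i == last_coord then k else 0%N].

Lemma fiber_bound f z k : exists M : R,
  forall t, `|f (z, t) * (t ^+ k)%:C| <= M%:C.
Proof.
have /asboolP[_ _ /(_ (wt k) [::])[M fM]] := schwartz_funP f.
exists M => t; have := fM (real_coord z t).
rewrite /weighted_partial /Citer_partial /= real_coordK mulrC.
rewrite (bigD1 last_coord)//= ffunE eqxx big1 ?mulr1; last first.
  by move=> i /negbTE il; rewrite ffunE il expr0.
by rewrite /real_coord row_mxEr mxE; case: (f (z, t)).
Qed.

Lemma integrable_oneDsqrV (c : R) : (@lebesgue_measure R).-integrable setT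
  (EFin \o (fun t : R => c * (oneDsqr t)^-1)).
Proof.
rewrite (_ : _ \o _ = fun t => c%:E * ((oneDsqr t)^-1)%:E)%E; last first.
  by apply/funext => t; rewrite /= EFinM.
apply: integrableZl => //; apply/integrableP; split.
  apply/measurable_EFinP; apply: continuous_measurable_fun.
  exact: continuous_oneDsqrV.
have oV0 t : 0 <= (oneDsqr t)^-1 :> R.
  by rewrite invr_ge0 (le_trans _ (oneDsqr_ge1 t)).
under eq_integral => t _ do rewrite abse_EFin ger0_norm ?oV0//.
rewrite ge0_symfun_integralT//=.
- rewrite (_ : [set x | _] = `[0, +oo[%classic); last first.
    by apply/seteqP; split => x /=; rewrite in_itv/= andbT.
  by rewrite integral0y_oneDsqr -EFinM ltry.
- exact: continuous_oneDsqrV.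
- by move=> x /=; rewrite /oneDsqr sqrrN.
Qed.

Lemma fiber_integrable f z k :
  (@lebesgue_measure R).-integrable setT
    (EFin \o (fun t => complex.Re (f (z, t) * (t ^+ k)%:C))) /\
  (@lebesgue_measure R).-integrable setT
    (EFin \o (fun t => complex.Im (f (z, t) * (t ^+ k)%:C))).
Proof.
have ReE t : complex.Re (f (z, t) * (t ^+ k)%:C) =
    complex.Re (f (z, t)) * t ^+ k.
  by case: (f (z, t)) => a b /=; rewrite mulr0 subr0.
have ImE t : complex.Im (f (z, t) * (t ^+ k)%:C) =
    complex.Im (f (z, t)) * t ^+ k.
  by case: (f (z, t)) => a b /=; rewrite mulr0 add0r.
have /asboolP[rf jf _] := schwartz_funP f.
have mf (g : 'rV[R]_(n + n + 1) -> R) : smooth g ->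
    measurable_fun setT (fun t : R => g (real_coord z t) * t ^+ k).
  move=> /(_ [::])[/= cg _]; apply: measurable_funM => //.
  under eq_fun do rewrite real_coordE.
  by apply: continuous_measurable_fun; exact: continuous_line.
have [M fM] := fiber_bound f z k; have [N fN] := fiber_bound f z k.+2.
have fMN t : `|f (z, t) * (t ^+ k)%:C| <= ((M + N) * (oneDsqr t)^-1)%:C.
  have o0 : 0 < oneDsqr t by rewrite (lt_le_trans _ (oneDsqr_ge1 t)).
  have o1 := ltW o0.
  rewrite rmorphM/= fmorphV/= ler_pdivlMr ?ltcR//.
  rewrite -[X in _ * X]ger0_norm ?lecR// -normrM.
  have -> : f (z, t) * (t ^+ k)%:C * (oneDsqr t)%:C =
      f (z, t) * (t ^+ k)%:C + f (z, t) * (t ^+ k.+2)%:C.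
    rewrite -mulrA -mulrDr -rmorphM -rmorphD; congr (_ * _%:C).
    by rewrite /oneDsqr mulrDr mulr1 -exprD addn2.
  apply: le_trans (ler_normD _ _) _.
  by rewrite rmorphD; apply: lerD; [exact: fM|exact: fN].
have Rele (w : R[i]) (c : R) : `|w| <= c%:C -> `|complex.Re w| <= `|c|.
  move=> wc; rewrite -lecR (le_trans (normc_ge_Re w))// (le_trans wc)// lecR.
  exact: ler_norm.
have Imle (w : R[i]) (c : R) : `|w| <= c%:C -> `|complex.Im w| <= `|c|.
  move=> wc; rewrite -normrN -ReiNIm Rele// normrM.
  suff -> : `|'i%C : R[i]| = 1 by rewrite mulr1.
  by apply/eqP; rewrite eq_complex /= expr0n expr1n add0r sqrtr1 !eqxx.
split; apply: (le_integrable _ _ _ (integrable_oneDsqrV (M + N))) => //.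
- apply/measurable_EFinP; under eq_fun do rewrite ReE.
  by under eq_fun do rewrite -real_coordK; exact: mf rf.
- by move=> t _; rewrite lee_fin Rele.
- apply/measurable_EFinP; under eq_fun do rewrite ImE.
  by under eq_fun do rewrite -real_coordK; exact: mf jf.
- by move=> t _; rewrite lee_fin Imle.
Qed.

End fiber_integrability.

Section Cintegral_linear.
Context d (T : measurableType d) (R : realType).
Variable mu : {measure set T -> \bar R}.

Lemma Rintegral_comb (a b : R) (g h : T -> R) :
  mu.-integrable setT (EFin \o g) -> mu.-integrable setT (EFin \o h) ->
  mu.-integrable setT (EFin \o (fun x => a * g x + b * h x)) /\
  \int[mu]_x (a * g x + b * h x) = a * \int[mu]_x g x + b * \int[mu]_x h x.
Proof.
have iZ c (u : T -> R) : mu.-integrable setT (EFin \o u) ->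
    mu.-integrable setT (EFin \o (fun x => c * u x)).
  move=> iu; rewrite (_ : _ \o _ = fun x => c%:E * (u x)%:E)%E.
    exact: integrableZl.
  by apply/funext => x; rewrite /= EFinM.
move=> ig ih; split; last by rewrite RintegralD ?RintegralZl//; exact: iZ.
rewrite (_ : _ \o _ = (EFin \o (fun x => a * g x)%R) \+
                      (EFin \o (fun x => b * h x)%R))%E.
  by apply: integrableD => //; exact: iZ.
by apply/funext => x; rewrite /= EFinD.
Qed.

Lemma Cintegral_comb (a : R[i]) (g h : T -> R[i]) :
  mu.-integrable setT (EFin \o (fun x => complex.Re (g x))) ->
  mu.-integrable setT (EFin \o (fun x => complex.Im (g x))) ->
  mu.-integrable setT (EFin \o (fun x => complex.Re (h x))) ->
  mu.-integrable setT (EFin \o (fun x => complex.Im (h x))) ->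
  Cintegral mu (fun x => a * g x + h x) =
  a * Cintegral mu g + Cintegral mu h.
Proof.
move=> rg jg rh jh; rewrite /Cintegral.
under [X in X +i* _]eq_Rintegral => x _.
  rewrite (_ : complex.Re _ = 1 * (complex.Re a * complex.Re (g x) +
    (- complex.Im a) * complex.Im (g x)) + 1 * complex.Re (h x)).
    over.
  by rewrite !mul1r; case: a (g x) (h x) => [? ?] [? ?] [? ?] /=; rewrite mulNr.
under [X in _ +i* X]eq_Rintegral => x _.
  rewrite (_ : complex.Im _ = 1 * (complex.Re a * complex.Im (g x) +
    complex.Im a * complex.Re (g x)) + 1 * complex.Im (h x)).
    over.
  by rewrite !mul1r; case: a (g x) (h x) => [? ?] [? ?] [? ?].
have [i1 E1] := Rintegral_comb (complex.Re a) (- complex.Im a) rg jg.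
have [i2 E2] := Rintegral_comb (complex.Re a) (complex.Im a) jg rg.
rewrite (Rintegral_comb 1 1 i1 rh).2 (Rintegral_comb 1 1 i2 jh).2 E1 E2 !mul1r.
by case: a {i1 i2 E1 E2} => ? ? /=; rewrite mulNr.
Qed.

End Cintegral_linear.

Section Phi_space.
Context (R : realType) (n : nat).

Definition Phi_pred : {pred schwartz_heisenberg R n} := fun phi =>
  `[< forall (k : nat) (zeta : 'rV[R[i]]_n),
        Cintegral (@lebesgue_measure R)
          (fun tau : R => phi (zeta, tau) * (tau ^+ k)%:C) = 0 >].

Lemma Phi_submod_closed : submod_closed Phi_pred.
Proof.
split; first apply/asboolP => k z.
  rewrite (_ : (fun _ => _) = fun=> 0).
    by rewrite /Cintegral /Rintegral /= integral0.
  by apply/funext => t; rewrite mul0r.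
move=> a f g /asboolP If /asboolP Ig; apply/asboolP => k z.
have [rf jf] := fiber_integrable f z k.
have [rg jg] := fiber_integrable g z k.
under [X in Cintegral _ X]eq_fun => t.
  rewrite (_ : _ * _ = a * (f (z, t) * (t ^+ k)%:C) + g (z, t) * (t ^+ k)%:C).
    over.
  by rewrite mulrDl mulrA.
by rewrite Cintegral_comb// If Ig mulr0 addr0.
Qed.

HB.instance Definition _ :=
  GRing.isSubmodClosed.Build R[i] (schwartz_heisenberg R n)
    Phi_pred Phi_submod_closed.

Record Phi := MkPhi {
  Phi_val :> schwartz_heisenberg R n;
  Phi_valP : Phi_val \in Phi_pred }.

HB.instance Definition _ := [isSub for Phi_val].
HB.instance Definition _ := [Choice of Phi by <:].
HB.instance Definition _ := [SubChoice_isSubLmodule of Phi by <:].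

(* The topology induced by that of the Schwartz space. *)
HB.instance Definition _ := Topological.copy Phi (initial_topology Phi_val).

End Phi_space.

(* At p = (z, t), the integral over zeta in C^n = R^(2n), for the Lebesgue
   measure, of f (zeta, t - Im (z . conj zeta) / 2). *)
Definition heisenberg_radon (R : realType) (n : nat)
    (f : heisenberg R n -> R[i]) : heisenberg R n -> R[i] :=
  fun p => Cintegral (lebesgue_tuple R (n + n))
    (fun v => let zeta := complex_coord (\row_i tnth v i : 'rV[R]_(n + n)) in
       f (zeta, p.2 - 2^-1 * complex.Im (\sum_(j < n) p.1 0 j * (zeta 0 j)^*))).

Definition is_automorphism (K : numDomainType) (V : preTopologicalLmodType K)
    (T : {linear V -> V}) : Prop :=
  continuous T /\
  exists2 S : V -> V, continuous S & cancel T S /\ cancel S T.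

(* Main.v *)
From HB Require Import structures.
Require Import Defs.
From mathcomp Require Import all_boot all_order all_algebra.
From mathcomp Require Import complex.
From mathcomp Require Import all_classical all_reals all_analysis.
From mathcomp Require Import measurable_realfun.
From mathcomp Require Import ring lra.
Set Implicit Arguments.
Unset Strict Implicit.
Unset Printing Implicit Defensive.
Import Order.TTheory GRing.Theory Num.Theory.
Import numFieldNormedType.Exports.
Local Open Scope classical_set_scope.
Local Open Scope ring_scope.

(* The moment condition says exactly that a function of Phi has antiderivatives of all orders in the
   central variable t that are again in Phi, so d/dt is invertible on Phi. Up to the rotation
   (x, y, t) |-> (y, -x, t) of R^(2n+1), the transform R_H is, by Fubini, a composition of 2n
   one-dimensional transforms
     (P_c g)(x) = int g(x with x_k replaced by y and t replaced by t + c x_k y) dy,   c = -1/2,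
   one for each coordinate k, so that it suffices to show that every P_c is an automorphism.
   Differentiation and multiplication by a coordinate can be moved through P_c at the cost of
   operators built from coordinates, derivatives and the inverse of d/dt; hence P_c preserves Phi
   and is continuous. Finally P_(-c) P_c d/dt = |c|^-1 H, where H is the (unnormalized) Hilbert
   transform in t, and H^2 is a nonzero scalar, which inverts P_c. *)

(** Fourier transforms in t explain the construction. With lambda dual to t, P_c acts as the Fourier
    transform in x_k rescaled by c lambda, so P_(-c) P_c is multiplication by 2 pi / |c lambda|. The
    singularity at lambda = 0 is what the vanishing moments absorb, and one derivative in t turns
    the multiplier into (2 pi i / |c|) sgn lambda, that of a Hilbert transform. The Fourier
    transform is only a guide: all computations are made in real variables. The obstacle is that the
    double integral for P_(-c) P_c d/dt does not converge absolutely, so Fubini is applied on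
    bounded windows and a limit is taken. The scalar H^2 is -4 pi^2; the argument uses only that it
    is finite and nonzero, which follows from elementary bounds on a positive kernel. For the
    Schwartz estimates the delicate operation is multiplication by x_k: P_c trades it for a
    derivative in x_k and an antiderivative in t. The analysis is done for real functions and
    applied to real and imaginary parts. *)

Definition affine_map (R : realType) (a b x : R) : measurableTypeR R := a * x + b.

Lemma measurable_affine_map (R : realType) (a b : R) :
  measurable_fun [set: measurableTypeR R] (affine_map a b).
Proof. by apply: measurable_funD => //; exact: measurable_funM. Qed.

(** * Integration on the line *)

Section affine_substitution.
Context {R : realType}.
Local Notation mu := (@lebesgue_measure R).
Variables (a b : R).
Hypothesis a0 : 0 < a.

Let phi := affine_map a b.
Let mphi : measurable_fun setT phi := measurable_affine_map a b.

Let pm : {measure set (measurableTypeR R) -> \bar R} :=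
  measure_function_pushforward__canonical__measure_function_Measure mu mphi.

Let a0' : 0 <= a := ltW a0.

(** Lebesgue measure is determined by its values on half-open intervals, where the rescaled
    pushforward [m] agrees with it. *)
Lemma lebesgue_measure_affine (A : set R) : measurable A ->
  (a%:E * mu (phi @^-1` A))%E = mu A.
Proof.
move=> mA.
pose m := mscale (NngNum a0') pm.
suff -> : mu A = m A by [].
apply: lebesgue_measure_unique => //= _ [[p q]] _ <-.
rewrite -[RHS]/(a%:E * mu (phi @^-1` `]p, q]%classic))%E.
have -> : phi @^-1` `]p, q]%classic = `](p - b) / a, (q - b) / a]%classic.
  apply/seteqP; split => x; rewrite /phi /affine_map /= !in_itv /=.
    rewrite ltr_pdivrMr// ler_pdivlMr// mulrC.
    by move=> /andP[h1 h2]; apply/andP; split; lra.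
  rewrite ltr_pdivrMr// ler_pdivlMr// mulrC.
  by move=> /andP[h1 h2]; apply/andP; split; lra.
rewrite !lebesgue_measure_itv/= !lte_fin ltr_pM2r ?invr_gt0// ltrD2r.
case: ifPn => _; last by rewrite mule0.
by rewrite -EFinD -EFinM; congr _%:E; field; rewrite gt_eqF.
Qed.

Lemma ge0_integral_affine (f : R -> \bar R) :
  measurable_fun setT f -> (forall x, 0 <= f x)%E ->
  (\int[mu]_x f x = a%:E * \int[mu]_x f (a * x + b)%R)%E.
Proof.
move=> mf f0.
rewrite (eq_measure_integral (mscale (NngNum a0') pm))/=; last first.
  by move=> A mA _; rewrite -(lebesgue_measure_affine mA).
rewrite ge0_integral_mscale//=.
by rewrite ge0_integral_pushforward.
Qed.

Lemma integrable_affine (f : R -> R) :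
  mu.-integrable setT (EFin \o f) ->
  mu.-integrable setT (EFin \o (fun x => f (a * x + b))).
Proof.
move=> /integrableP[mf fi]; apply/integrableP; split.
  by apply: (measurableT_comp mf mphi).
rewrite (ge0_integral_affine (f := fun x => `|(f x)%:E|%E))// in fi; last first.
  exact: measurableT_comp.
move: fi; rewrite /= => fi.
rewrite -(@lte_pmul2l _ a%:E) ?lte_fin//.
by rewrite gt0_muley ?lte_fin.
Qed.

Lemma Rintegral_affine (f : R -> R) :
  mu.-integrable setT (EFin \o f) ->
  \int[mu]_x f x = a * \int[mu]_x f (a * x + b).
Proof.
move=> fi; have fi' := integrable_affine fi.
have /integrableP[mf _] := fi.
rewrite /Rintegral integralE [in RHS]integralE.
rewrite (ge0_integral_affine (f := (EFin \o f)^\+%E))//; last first.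
  exact: measurable_funepos.
rewrite (ge0_integral_affine (f := (EFin \o f)^\-%E))//; last first.
  exact: measurable_funeneg.
have Ep : (EFin \o (fun x => f (a * x + b)%R))^\+%E =
    (fun x => (EFin \o f)^\+%E (a * x + b)%R).
  exact: (funepos_comp (EFin \o f) phi).
have En : (EFin \o (fun x => f (a * x + b)%R))^\-%E =
    (fun x => (EFin \o f)^\-%E (a * x + b)%R).
  exact: (funeneg_comp (EFin \o f) phi).
have := integrable_fin_num measurableT (integrable_funepos measurableT fi').
have := integrable_fin_num measurableT (integrable_funeneg measurableT fi').
have -> : (fun x => (f (a * x + b))%:E) = EFin \o (fun x => f (a * x + b)) by [].
rewrite Ep En => h2 h1.
have aux (p q : \bar R) : p \is a fin_num -> q \is a fin_num ->
    fine (a%:E * p - a%:E * q)%E = a * fine (p - q)%E.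
  by case: p => // p; case: q => // q _ _; rewrite /= mulrBr.
exact: aux.
Qed.

End affine_substitution.

Section line_integrals.
Context {R : realType}.
Local Notation mu := (@lebesgue_measure R).
Implicit Types (f F : R -> R) (C : R).

Lemma oneDsqrV_ge0 (x : R) : 0 <= (oneDsqr x)^-1.
Proof. by rewrite invr_ge0 (le_trans _ (oneDsqr_ge1 x)). Qed.

(** The standard majorant on the line: a Schwartz bound with two powers of the integration variable
    provides it. *)
Lemma integrable_le_oneDsqrV f C (D : set R) : measurable D ->
  measurable_fun D f -> (forall x, D x -> `|f x| <= C * (oneDsqr x)^-1) ->
  mu.-integrable D (EFin \o f).
Proof.
move=> mD mf fC; apply: (le_integrable _ _ _ (integrableS _ _ _ (integrable_oneDsqrV C))) => //.
- exact/measurable_EFinP.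
- by move=> x Dx; rewrite lee_fin (le_trans (fC x Dx))// ler_norm.
Qed.

Lemma normr_Rintegral_le f C (D : set R) : measurable D ->
  measurable_fun D f -> (forall x, D x -> `|f x| <= C * (oneDsqr x)^-1) ->
  0 <= C ->
  `|\int[mu]_(x in D) f x| <= C * \int[mu]_x (oneDsqr x)^-1.
Proof.
move=> mD mf fC C0; have fi := integrable_le_oneDsqrV mD mf fC.
rewrite (le_trans (le_normr_Rintegral _ fi))//.
have i1 := integrable_oneDsqrV (1 : R).
have i1' : mu.-integrable setT (EFin \o (fun x : R => (oneDsqr x)^-1)).
  by move: i1; congr (mu.-integrable _ (EFin \o _)); apply/funext => x; rewrite mul1r.
rewrite -RintegralZl// [leRHS](_ : _ = \int[mu]_(x in setT) (C * (oneDsqr x)^-1))//.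
rewrite Rintegral_mkcond [leRHS]Rintegral_mkcond.
apply: le_Rintegral => //.
- rewrite -restrict_EFin; apply/integrable_restrict => //=; rewrite setTI.
  exact: (integrable_abse fi).
- rewrite -restrict_EFin; apply/integrable_restrict => //=; rewrite setTI.
  exact: (integrable_oneDsqrV C).
move=> x _; rewrite !patchE in_setT.
by case: ifPn => [/set_mem/fC//|_]; rewrite mulr_ge0// oneDsqrV_ge0.
Qed.

End line_integrals.

Lemma cvg_Rintegral_dominated d (T : measurableType d) (R : realType)
    (mu : {measure set T -> \bar R}) (D : set T) (f_ : nat -> T -> R)
    (f g : T -> R) : measurable D ->
  (forall n, measurable_fun D (f_ n)) ->
  (forall x, D x -> f_ ^~ x @ \oo --> f x) ->
  mu.-integrable D (EFin \o g) ->
  (forall n x, D x -> `|f_ n x| <= g x) ->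
  (\int[mu]_(x in D) f_ n x) @[n --> \oo] --> \int[mu]_(x in D) f x.
Proof.
move=> mD mf ff ig fg; apply: fine_cvg.
have mfn n : measurable_fun D (EFin \o f_ n) by exact/measurable_EFinP.
have cf x : D x -> (EFin \o f_ ^~ x) @ \oo --> (EFin \o f) x.
  by move=> Dx; apply: cvg_EFin; [exact: nearW|exact: ff].
(* A pointwise limit of functions bounded by [g] is bounded by [g], so the limit integral is
   finite. *)
rewrite fineK; last first.
  have mf' : measurable_fun D (EFin \o f) by exact: (emeasurable_fun_cvg _ _ mfn cf).
  apply: integrable_fin_num => //; apply: (le_integrable _ _ _ ig) => //.
  move=> x Dx; rewrite lee_fin [leRHS]ger0_norm; last by rewrite (le_trans _ (fg 0%N x Dx)).
  have cn : `|f_ n x| @[n --> \oo] --> `|f x| by apply: cvg_norm; exact: ff.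
  rewrite -(cvg_lim _ cn)//; apply: limr_le; first by apply/cvg_ex; exists `|f x|.
  by apply: nearW => n; exact: fg.
exact: (@dominated_cvg _ _ _ mu D mD (fun n => EFin \o f_ n) _ (EFin \o g)).
Qed.

Section ftc_line.
Context {R : realType}.
Local Notation mu := (@lebesgue_measure R).
Implicit Types (f F : R -> R) (C : R).

Lemma is_derive1_continuous F (x d : R) : is_derive x 1 F d -> {for x, continuous F}.
Proof. by move=> [dF _]; apply/differentiable_continuous/derivable1_diffP. Qed.

Lemma Rintegral_FTC2 F f (a b : R) : a <= b -> continuous f ->
  (forall x : R, is_derive x 1 F (f x)) ->
  \int[mu]_(x in `[a, b]) f x = F b - F a.
Proof.
move=> ab cf dF; move: ab; rewrite le_eqVlt => /predU1P[->|ab].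
  by rewrite set_itv1 Rintegral_set1 subrr.
have cF x : {for x, continuous F} by exact: (is_derive1_continuous (dF x)).
rewrite /Rintegral (continuous_FTC2 ab (F := F))//.
- exact: continuous_subspaceT.
- split=> [x _||]; first exact: (ex_derive (is_derive := dF x)).
  + apply: cvg_at_right_filter; exact: cF.
  + apply: cvg_at_left_filter; exact: cF.
- by move=> x _; rewrite derive1E; exact: (derive_val (is_derive := dF x)).
Qed.

(** Dominated convergence of the truncations to [-n, n]. It carries the fundamental theorem of
    calculus from segments to the line and to half-lines, and later gives the limit over growing
    windows. *)
Lemma cvg_Rintegral_itvNnn f (D : set R) : measurable D ->
  mu.-integrable D (EFin \o f) ->
  \int[mu]_(x in D `&` `[- n%:R, n%:R]) f x @[n --> \oo] --> \int[mu]_(x in D) f x.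
Proof.
move=> mD fi.
rewrite [X in X @ _ --> _](_ : _ = fun n : nat =>
  \int[mu]_(x in D) (f \_ `[- n%:R, n%:R]) x); last first.
  by apply/funext => n; rewrite Rintegral_mkcondr.
apply: (@cvg_Rintegral_dominated _ _ R mu D
  (fun n : nat => f \_ `[- n%:R, n%:R]) f (fun x => `|f x|) mD) => //.
- move=> n; apply/(measurable_restrict f (measurable_itv _) mD).
  apply: (measurable_funS mD (@subIsetl _ _ _)).
  by apply/measurable_EFinP; exact: (measurable_int mu fi).
- move=> x _; apply: cvg_near_cst; exists (Num.bound x) => // n /= xn.
  rewrite patchE mem_set//= in_itv/= -ler_norml.
  by rewrite (le_trans (ltW (unstable.ltr_norm_bound x)))// ler_nat.
- exact: (integrable_norm fi).
- by move=> n x _; rewrite patchE; case: ifP => // _; rewrite normr0.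
Qed.

Lemma cvg_oneDsqrV_nat : (oneDsqr (n%:R : R))^-1 @[n --> \oo] --> 0.
Proof.
apply: (@squeeze_cvgr _ _ _ _ (cst 0) (@harmonic R)); last exact: cvg_harmonic.
- apply: nearW => n; rewrite oneDsqrV_ge0/= /harmonic/=.
  have o0 : 0 < oneDsqr (n%:R : R) by rewrite (lt_le_trans ltr01)// oneDsqr_ge1.
  rewrite lef_pV2 ?posrE// /oneDsqr -natrX -natr1 addrC lerD2l ler_nat.
  by case: n {o0} => // n; rewrite expnS leq_pmulr// expn_gt0.
- exact: cvg_cst.
Qed.

(** The sign [s] lets one statement serve both ends of the line. *)
Lemma cvg_le_oneDsqrV F C (s : R) : `|s| = 1 ->
  (forall x, `|F x| <= C * (oneDsqr x)^-1) -> F (s * n%:R) @[n --> \oo] --> 0.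
Proof.
move=> s1 FC; apply: norm_cvg0.
apply: (@squeeze_cvgr _ _ _ _ (cst 0) (fun n => C * (oneDsqr (n%:R : R))^-1)).
- apply: nearW => n; rewrite /= normr_ge0/= (le_trans (FC _))//.
  suff -> : oneDsqr (s * n%:R) = oneDsqr n%:R by [].
  by rewrite /oneDsqr exprMn -(real_normK (num_real s)) s1 expr1n mul1r.
- exact: cvg_cst.
- by rewrite -[X in _ --> X](mulr0 C); apply: cvgMr => //; exact: cvg_oneDsqrV_nat.
Qed.

Lemma Rintegral_FTC_T F f C : continuous f ->
  (forall x : R, is_derive x 1 F (f x)) ->
  (forall x, `|f x| <= C * (oneDsqr x)^-1) ->
  (forall x, `|F x| <= C * (oneDsqr x)^-1) ->
  \int[mu]_x f x = 0.
Proof.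
move=> cf dF fC FC.
have mf : measurable_fun setT f by exact: continuous_measurable_fun.
have fi : mu.-integrable setT (EFin \o f).
  by apply: (integrable_le_oneDsqrV (C := C)) => // x _; exact: fC.
have := cvg_Rintegral_itvNnn measurableT fi.
have nn n : - n%:R <= n%:R :> R by rewrite (le_trans (y := 0))// oppr_le0.
under eq_fun do rewrite setTI (Rintegral_FTC2 (nn _) cf dF).
move/cvg_lim => <- //; apply/cvg_lim => //; rewrite -[X in _ --> X](subrr 0).
apply: cvgB.
- by under eq_fun do rewrite -[_%:R]mul1r; apply: cvg_le_oneDsqrV FC; rewrite normr1.
- by under eq_fun do rewrite -mulN1r; apply: cvg_le_oneDsqrV FC; rewrite normrN normr1.
Qed.

Lemma Rintegral_FTC_Ny F f C (a : R) : continuous f ->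
  (forall x : R, is_derive x 1 F (f x)) ->
  (forall x, `|f x| <= C * (oneDsqr x)^-1) ->
  (forall x, `|F x| <= C * (oneDsqr x)^-1) ->
  \int[mu]_(x in `]-oo, a]) f x = F a.
Proof.
move=> cf dF fC FC.
have mf : measurable_fun setT f by exact: continuous_measurable_fun.
have fi : mu.-integrable `]-oo, a] (EFin \o f).
  apply: (integrable_le_oneDsqrV (C := C)) => //; exact: measurable_funTS.
have := @cvg_Rintegral_itvNnn f `]-oo, a]%classic (measurable_itv _) fi.
move/cvg_lim => <- //; apply/cvg_lim => //.
have : F a - F (- 1 * n%:R) @[n --> \oo] --> F a.
  rewrite -[X in _ --> X]subr0; apply: cvgB; first exact: cvg_cst.
  by apply: cvg_le_oneDsqrV FC; rewrite normrN normr1.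
apply: cvg_trans; apply: near_eq_cvg.
exists (Num.bound a) => // n /= an.
have an' : `|a| <= n%:R by rewrite (le_trans (ltW (unstable.ltr_norm_bound a)))// ler_nat.
have -> : `]-oo, a]%classic `&` `[- n%:R, n%:R]%classic = `[- n%:R, a]%classic.
  apply/seteqP; split => x /=; rewrite !in_itv/=; first by move=> [-> /andP[->]].
  move=> /andP[-> xa]; split => //=; move: an'; rewrite ler_norml => /andP[_].
  exact: le_trans.
rewrite mulN1r (Rintegral_FTC2 _ cf dF)//.
by move: an'; rewrite ler_norml => /andP[].
Qed.

End ftc_line.

(** * Joint measurability and differentiation under the integral sign *)

Section caratheodory.
Context {R : realType} d (T : measurableType d).
Variable F : R -> T -> R.
Hypothesis cF : forall t, continuous (F ^~ t).
Hypothesis mF : forall x, measurable_fun setT (F x).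

Let dy (n : nat) (x : R) : R := (Num.floor (n.+1%:R * x))%:~R / n.+1%:R.

Let cvg_dy x : dy ^~ x @ \oo --> x.
Proof.
apply/cvgrPdist_le => e e0.
have := @cvg_harmonic R => /cvgrPdist_le/(_ e e0); apply: filterS => n /=.
rewrite sub0r normrN /harmonic /= => ne.
apply: le_trans ne.
have n0 : 0 < n.+1%:R :> R by rewrite ltr0n.
rewrite [leRHS]ger0_norm ?invr_ge0 ?ltW// /dy.
have /andP[h1 h2] := floor_itv (n.+1%:R * x).
have -> : x - (Num.floor (n.+1%:R * x))%:~R / n.+1%:R =
  (n.+1%:R * x - (Num.floor (n.+1%:R * x))%:~R) / n.+1%:R.
  by field; rewrite ?gt_eqF// -natr1.
rewrite normrM (ger0_norm (x := n.+1%:R^-1)) ?invr_ge0 ?ltW//.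
rewrite gtr_pMl ?invr_gt0// ger0_norm ?subr_ge0//.
by rewrite ltrBlDl (lt_le_trans h2)// intrD.
Qed.

(** Rounding the first argument down to the grid of mesh 1/(n+1) gives functions whose preimages are
    countable unions of rectangles; continuity in that argument makes them converge pointwise to
    [F]. *)
Lemma measurable_fun_caratheodory :
  measurable_fun [set: measurableTypeR R * T] (fun p => F p.1 p.2).
Proof.
apply: (@measurable_fun_cvg _ _ R setT (fun n p => F (dy n p.1) p.2)); last first.
  move=> [x t] _ /=; have cx := @cvg_dy x; have cFx := @cF t x.
  exact: (@cvg_comp _ _ _ (dy ^~ x) (F ^~ t) _ _ _ cx cFx).
move=> n _ Y mY; rewrite setTI.
have -> : (fun p : measurableTypeR R * T => F (dy n p.1) p.2) @^-1` Y =
  \bigcup_(z : int) ((fun x : R => n.+1%:R * x) @^-1` `[z%:~R, (z + 1)%:~R[%classic `*`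
     (F (z%:~R / n.+1%:R) @^-1` Y)).
  apply/seteqP; split => [[x t] /= Yxt|[x t] /= [z _ [/= xz Yz]]].
    exists (Num.floor (n.+1%:R * x)) => //; split => //=.
    by rewrite in_itv/= floor_itv.
  rewrite /dy; suff -> : Num.floor (n.+1%:R * x) = z by [].
  by apply: floor_def; move: xz; rewrite in_itv.
apply: countable_bigcupT_measurable; first exact: countableP.
move=> z; apply: measurableX; rewrite -[X in measurable X]setTI.
  by apply: measurable_funM.
exact: mF.
Qed.

End caratheodory.

Section derive_under.
Context {R : realType} d (T : measurableType d).
Variable mu : {measure set T -> \bar R}.
Variables (f f' : R -> T -> R) (D : set T) (G : T -> R).
Hypothesis mD : measurable D.
Hypothesis fi : forall h, mu.-integrable D (EFin \o f h).
Hypothesis df : forall (h : R) y, D y -> is_derive h 1 (f ^~ y) (f' h y).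
Hypothesis Gi : mu.-integrable D (EFin \o G).
Hypothesis f'G : forall (h : R) y, D y -> `|f' h y| <= G y.

Lemma is_derive_Rintegral (a : R) :
  is_derive a 1 (fun h => \int[mu]_(y in D) f h y) (\int[mu]_(y in D) f' a y).
Proof.
(* The majorant [G] is valid for every [h], so any open interval around [a] will do. *)
have aI : [set` `]a - 1, a + 1[] a by rewrite /= in_itv/= ltrBlDr ltrDl ltr01.
pose G' y := `|G y|.
have Gi' : mu.-integrable D (EFin \o G') := integrable_norm Gi.
have E h y : D y -> partial1of2 f h y = f' h y.
  by move=> Dy; rewrite partial1of2E; exact: (derive_val (is_derive := df h Dy)).
have dfa h y : [set` `]a - 1, a + 1[] h -> D y -> derivable (f ^~ y) h 1.
  by move=> _ Dy; exact: (ex_derive (is_derive := df h Dy)).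
have ub h y : [set` `]a - 1, a + 1[] h -> D y -> `|partial1of2 f h y| <= G' y.
  by move=> _ Dy; rewrite E// (le_trans (f'G _ _))// ler_norm.
have fi' x : [set` `]a - 1, a + 1[] x -> mu.-integrable D (EFin \o f x) by [].
have G0 y : 0 <= G' y by exact: normr_ge0.
split; first exact: (derivable_under_integral mD aI fi' dfa G0 Gi' ub).
rewrite -derive1E (differentiation_under_integral mD aI fi' dfa G0 Gi' ub).
by apply: eq_Rintegral => y /set_mem Dy; rewrite E.
Qed.

End derive_under.

(** * Real Schwartz functions *)

Section line_derivatives.
Context {R : realType} {V : normedModType R}.
Implicit Types (g : V -> R) (x v : V).

Lemma is_derive_line g x v (s d : R) :
  is_derive (x + s *: v) v g d <-> is_derive s 1 (fun r : R => g (x + r *: v)) d.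
Proof.
have E : (fun h : R => h^-1 *: ((g \o shift (x + s *: v)) (h *: v) - g (x + s *: v))) =
   (fun h : R => h^-1 *: (((fun r : R => g (x + r *: v)) \o shift s) (h *: (1 : R)) - g (x + s *: v))).
  apply/funext => h /=; congr (_ *: (g _ - _)).
  by rewrite scalerDl addrCA scaler1.
by split=> -[dg eg]; split; move: dg eg; rewrite /derivable /derive E.
Qed.

(** A quadratic remainder is the form in which [taylor_path] delivers directional derivatives. *)
Lemma is_derive_quadratic g x v (C d : R) :
  (forall h : R, `|g (x + h *: v) - g x - h * d| <= C * h ^+ 2) ->
  is_derive x v g d.
Proof.
move=> gC.
have cd : (fun h : R => h^-1 *: ((g \o shift x) (h *: v) - g x)) @ 0^' --> d.
  apply/cvgrPdist_le => e e0.
  have C0 : 0 < `|C| + 1 by rewrite ltr_pwDr.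
  near=> h.
  have h0 : h != 0 by near: h; exact: nbhs_dnbhs_neq.
  have he : `|h| <= e / (`|C| + 1).
    near: h; apply: dnbhs0_le; exact: divr_gt0.
  rewrite /= distrC.
  have -> : h^-1 *: (g (h *: v + x) - g x) - d = h^-1 * (g (x + h *: v) - g x - h * d).
    by rewrite addrC [h *: v + x]addrC /GRing.scale/=; field.
  rewrite normrM normfV ler_pdivrMl ?normr_gt0//.
  rewrite (le_trans (gC h))// expr2 -[h * h]ger0_norm -?expr2 ?sqr_ge0// normrX expr2 mulrCA.
  rewrite ler_wpM2l// (le_trans (y := (`|C| + 1) * `|h|))//.
    by rewrite ler_wpM2r// (le_trans (ler_norm _))// lerDl.
  by rewrite mulrC -ler_pdivlMr.
split; first by apply/cvg_ex; exists d.
exact/cvg_lim.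
Unshelve. all: by end_near. Qed.

Lemma line_mean_value g dg x v (r : R) :
  (forall y : V, is_derive y v g (dg y)) ->
  exists2 s : R, `|s| <= `|r| & g (x + r *: v) - g x = r * dg (x + s *: v).
Proof.
move=> gd; pose f (s : R) := g (x + s *: v).
have fd (s : R) : is_derive s 1 f (dg (x + s *: v)) by apply/is_derive_line.
have cf : continuous f by move=> s; exact: (is_derive1_continuous (fd s)).
have [r0|r0] := leP 0 r.
  have [s|s] := @MVT_segment R f (fun s => dg (x + s *: v)) 0 r r0 (fun s _ => fd s).
    exact: continuous_subspaceT.
  rewrite in_itv/= => /andP[s0 sr]; rewrite /f scale0r addr0 subr0 => E.
  by exists s; rewrite ?ger0_norm// E mulrC.
have [s|s] := @MVT_segment R f (fun s => dg (x + s *: v)) r 0 (ltW r0) (fun s _ => fd s).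
  exact: continuous_subspaceT.
rewrite in_itv/= => /andP[s0 sr]; rewrite /f scale0r addr0 sub0r => E.
exists s; first by rewrite !ler0_norm ?lerN2// ltW.
by rewrite -opprB E mulrC mulNr opprK.
Qed.

End line_derivatives.

Section coordinates.
Context {R : realType} {m : nat}.
Implicit Types (g : 'rV[R]_m -> R) (x v : 'rV[R]_m) (i j k : 'I_m).
Implicit Types (l s : seq 'I_m).
Local Notation e i := (delta_mx (0 : 'I_1) (i : 'I_m) : 'rV[R]_m).

Definition monomial l x : R := \prod_(i <- l) x 0 i.
Definition pd i g : 'rV[R]_m -> R := fun x => 'D_(e i) g x.
Definition mulX i g : 'rV[R]_m -> R := fun x => x 0 i * g x.

Lemma is_derive_pd g x i : derivable g x (e i) -> is_derive x (e i) g (pd i g x).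
Proof. by move=> dg; split. Qed.

Lemma pdE g x i (d : R) : is_derive x (e i) g d -> pd i g x = d.
Proof. by move=> [_ <-]. Qed.

(** For Schwartz functions the continuity demanded by [smooth] is recovered from the bounds on the
    next derivatives, through [bounded_pd_continuous]. *)
Definition diff_all g := forall s x i, derivable (iter_partial s g) x (e i).

Lemma iter_partial_pd s i g : iter_partial s (pd i g) = iter_partial (rcons s i) g.
Proof. by rewrite /iter_partial foldr_rcons. Qed.

Lemma diff_all_pd g i : diff_all g -> diff_all (pd i g).
Proof. by move=> dg s x j; rewrite iter_partial_pd; exact: dg. Qed.

Local Notation step p := (\sum_(q <- p) q.2 *: e q.1).
Local Notation len p := (\sum_(q <- p) `|q.2|).
Implicit Types p : seq ('I_m * R).

(* A path is a list of steps along the coordinate axes: [(i, a)] stands for [a *: e i]. *)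
Lemma lipschitz_path g (dg : 'I_m -> 'rV[R]_m -> R) (M : R) x p :
  (forall i y, is_derive y (e i) g (dg i y)) ->
  (forall i y, `|dg i y| <= M) ->
  `|g (x + step p) - g x| <= M * len p.
Proof.
move=> gd dM; elim: p => [|[k a] p IH].
  by rewrite !big_nil addr0 subrr normr0 mulr0.
rewrite !big_cons /=; set z := \sum_(j <- p) _ in IH *.
have -> : x + (a *: e k + z) = (x + z) + a *: e k by rewrite addrCA addrC.
have [s _ E] := line_mean_value (x + z) a (gd k).
rewrite -(subrK (g (x + z)) (g _)) -addrA (le_trans (ler_normD _ _))// E.
by rewrite mulrDr lerD// normrM mulrC ler_wpM2r.
Qed.

(** Each step is compared with [dg] at an intermediate point by the mean value theorem, and the
    Lipschitz bound on [dg] makes the error quadratic. That bound is assumed along all paths because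
    the intermediate point is itself the end of a path, namely of [(k, s) :: p]. *)
Lemma taylor_path g (dg : 'I_m -> 'rV[R]_m -> R) (M : R) x p :
  (forall i y, is_derive y (e i) g (dg i y)) -> 0 <= M ->
  (forall i p', `|dg i (x + step p') - dg i x| <= M * len p') ->
  `|g (x + step p) - g x - \sum_(q <- p) q.2 * dg q.1 x| <= M * (len p) ^+ 2.
Proof.
move=> gd M0 dM; elim: p => [|[k a] p IH].
  by rewrite !big_nil addr0 !subrr normr0 expr0n mulr0.
rewrite !big_cons /=; set z := \sum_(j <- p) _ in IH *; set S := \sum_(j <- p) `|j.2| in IH *.
have S0 : 0 <= S by apply: sumr_ge0.
have -> : x + (a *: e k + z) = (x + z) + a *: e k by rewrite addrCA addrC.
have [s sa E] := line_mean_value (x + z) a (gd k).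
have -> : g (x + z + a *: e k) - g x - (a * dg k x + \sum_(j <- p) j.2 * dg j.1 x) =
  (g (x + z) - g x - \sum_(j <- p) j.2 * dg j.1 x) + a * (dg k (x + z + s *: e k) - dg k x).
  by rewrite mulrBr -E; ring.
rewrite (le_trans (ler_normD _ _))//.
have := dM k ((k, s) :: p); rewrite !big_cons/= [s *: _ + _]addrC addrA => h.
rewrite (le_trans (lerD IH (_ : _ <= `|a| * (M * (`|s| + S)))))//.
  by rewrite normrM ler_wpM2l.
have a0 := normr_ge0 a.
have : `|a| * (M * (`|s| + S)) <= `|a| * (M * (`|a| + S)) by rewrite !ler_wpM2l// lerD2r.
move: (`|a|) (`|s|) a0 => A t a0 h1.
have : 0 <= M * (A * S) by rewrite !mulr_ge0.
nra.
Qed.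

Lemma step_enum v : \sum_(q <- [seq (i, v 0 i) | i <- enum 'I_m]) q.2 *: e q.1 = v.
Proof. by rewrite big_map big_enum/= [RHS]row_sum_delta. Qed.

(** The displacement from [x] to [y] is split into steps along the axes; the length of this path is
    at most [m] times the sup norm of [y - x]. *)
Lemma bounded_pd_continuous g (M : R) : (forall x i, derivable g x (e i)) ->
  (forall x i, `|pd i g x| <= M) -> continuous g.
Proof.
move=> dg gM x; apply/(@cvgrPdist_le _ _ _ _ (nbhs_filter x) g (g x)) => eps eps0.
have gd i y : is_derive y (e i) g (pd i g y) by exact: is_derive_pd.
pose c := `|M| * m%:R + 1.
have c0 : 0 < c by rewrite ltr_wpDl// mulr_ge0.
apply: (@filterS _ _ (nbhs_filter x) _ _ _ (nbhsx_ballx x _ (divr_gt0 eps0 c0))) => y xy.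
rewrite distrC -(subrK x y) [_ + x]addrC -(step_enum (y - x)).
apply: le_trans (lipschitz_path _ _ gd (fun i y => gM y i)) _.
rewrite big_map big_enum /=.
apply: (le_trans (y := `|M| * (\sum_(i < m) eps / c))).
  apply: le_trans (ler_wpM2r _ (ler_norm _)) _; first exact: sumr_ge0.
  rewrite ler_wpM2l//; apply: ler_sum => i _.
  by rewrite !mxE distrC ltW//; have [_ /(_ 0 i)] := xy; rewrite -ball_normE.
rewrite sumr_const card_ord -mulr_natl !mulrA ler_pdivrMr// mulrC.
by rewrite ler_wpM2l ?(ltW eps0)// /c lerDl.
Qed.

End coordinates.

Section schwartz_class.
Context {R : realType} {m : nat}.
Implicit Types (g h : 'rV[R]_m -> R) (x v : 'rV[R]_m) (i j k : 'I_m).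
Implicit Types (l s : seq 'I_m) (M : R).
Local Notation e i := (delta_mx (0 : 'I_1) (i : 'I_m) : 'rV[R]_m).

(** One index bounds both the number of weights and the number of derivatives, each given as a list
    of coordinates with repetitions. Working with bounds [M] avoids taking suprema. *)
Definition seminorm_le (N : nat) M g := forall l s,
  (size l <= N)%N -> (size s <= N)%N ->
  forall x, `|monomial l x * iter_partial s g x| <= M.

Definition Sch g := diff_all g /\ forall N, exists M, seminorm_le N M g.

Lemma seminorm_le_ge0 N M g : seminorm_le N M g -> 0 <= M.
Proof. by move=> /(_ [::] [::] isT isT 0); apply: le_trans. Qed.

Lemma seminorm_leW N N' M M' g : (N <= N')%N -> M' <= M ->
  seminorm_le N' M' g -> seminorm_le N M g.
Proof.
move=> NN MM gM l s lN sN x.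
by rewrite (le_trans _ MM)// gM// (leq_trans _ NN).
Qed.

Lemma monomial_cons i l x : monomial (i :: l) x = x 0 i * monomial l x.
Proof. by rewrite /monomial big_cons. Qed.

Lemma seminorm_le_norm N M g x : seminorm_le N M g -> `|g x| <= M.
Proof. by move=> /(_ [::] [::] isT isT x); rewrite /monomial big_nil mul1r. Qed.

Lemma seminorm_le_decay M g x k : seminorm_le 2 M g ->
  `|g x| <= (2 * M) * (oneDsqr (x 0 k))^-1.
Proof.
move=> gM; have gM1 := seminorm_le_norm x gM.
have := gM [:: k; k] [::] isT isT x.
rewrite !monomial_cons /monomial big_nil mulr1 /= normrM => gM2.
have o0 : 0 < oneDsqr (x 0 k) by rewrite (lt_le_trans ltr01)// oneDsqr_ge1.
rewrite ler_pdivlMr// /oneDsqr mulrDr mulr1 mulrDl mul1r lerD//.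
by rewrite mulrC -[X in X * _](ger0_norm (sqr_ge0 _)).
Qed.

Lemma seminorm_le_pd N M g i : seminorm_le N.+1 M g -> seminorm_le N M (pd i g).
Proof.
move=> gM l s lN sN x; rewrite iter_partial_pd.
by apply: gM; rewrite ?size_rcons// (leq_trans lN).
Qed.

Lemma Sch_pd g i : Sch g -> Sch (pd i g).
Proof.
move=> [dg bg]; split; first exact: diff_all_pd.
by move=> N; have [M gM] := bg N.+1; exists M; exact: seminorm_le_pd.
Qed.

Lemma Sch_bounded g : Sch g -> exists M, forall x, `|g x| <= M.
Proof. by move=> [_ /(_ 0%N)[M gM]]; exists M => x; exact: seminorm_le_norm gM. Qed.

Lemma Sch_is_derive g x i : Sch g -> is_derive x (e i) g (pd i g x).
Proof. by move=> [dg _]; apply: is_derive_pd; exact: (dg [::]). Qed.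

Lemma uniform_bound (I : finType) (P : I -> R -> Prop) :
  (forall a M M', M <= M' -> P a M -> P a M') ->
  (forall a, exists M, P a M) -> exists2 M, 0 <= M & forall a, P a M.
Proof.
move=> PW /choice[f fP]; exists (\sum_a `|f a|); first exact: sumr_ge0.
move=> a; apply: PW (fP a); rewrite (le_trans (ler_norm _))//.
by rewrite (bigD1 a)//= lerDl sumr_ge0.
Qed.

Lemma Sch_pd_bounded g : Sch g ->
  exists2 M, 0 <= M & forall i x, `|pd i g x| <= M.
Proof.
move=> sg; apply: (uniform_bound (P := fun i M => forall x, `|pd i g x| <= M)).
  by move=> i M M' MM h x; rewrite (le_trans (h x)).
by move=> i; exact/Sch_bounded/Sch_pd.
Qed.

Lemma Sch_continuous g : Sch g -> continuous g.
Proof.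
move=> sg; have [M _ gM] := Sch_pd_bounded sg.
apply: (bounded_pd_continuous (M := M)) => x i; first exact: (sg.1 [::]).
exact: gM.
Qed.

(** Bounded second derivatives make the first ones Lipschitz along axis-parallel paths, so
    [taylor_path] gives a quadratic remainder in every direction. *)
Lemma Sch_is_derive_dir g x v : Sch g ->
  is_derive x v g (\sum_i v 0 i * pd i g x).
Proof.
move=> sg.
have [M M0 gM] : exists2 M, 0 <= M & forall ij : 'I_m * 'I_m, forall x, `|pd ij.2 (pd ij.1 g) x| <= M.
  apply: (uniform_bound (P := fun (ij : 'I_m * 'I_m) M => forall x, `|pd ij.2 (pd ij.1 g) x| <= M)).
    by move=> ij M M' MM h y; rewrite (le_trans (h y)).
  by move=> ij; exact/Sch_bounded/Sch_pd/Sch_pd.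
have lip i p : `|pd i g (x + \sum_(q <- p) q.2 *: e q.1) - pd i g x| <= M * \sum_(q <- p) `|q.2|.
  apply: lipschitz_path => [j y|j y]; first exact/Sch_is_derive/Sch_pd.
  exact: (gM (i, j)).
apply: (is_derive_quadratic (C := M * (\sum_i `|v 0 i|) ^+ 2)) => h.
have := taylor_path [seq (i, h * v 0 i) | i <- enum 'I_m]
  (fun i y => Sch_is_derive y i sg) M0 lip.
have bE (T : nmodType) (F : 'I_m * R -> T) :
    \sum_(q <- [seq (i, h * v 0 i) | i <- enum 'I_m]) F q = \sum_i F (i, h * v 0 i).
  by rewrite big_map big_enum.
rewrite !bE /=.
have -> : \sum_(i : 'I_m) (h * v 0 i) *: e i = h *: v.
  rewrite [in RHS](row_sum_delta v) scaler_sumr.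
  by apply: eq_bigr => i _; rewrite scalerA.
have -> : \sum_(i : 'I_m) h * v 0 i * pd i g x = h * \sum_i v 0 i * pd i g x.
  by rewrite mulr_sumr; apply: eq_bigr => i _; rewrite mulrA.
have -> : \sum_i `|h * v 0 i| = `|h| * \sum_i `|v 0 i|.
  by rewrite mulr_sumr; apply: eq_bigr => i _; rewrite normrM.
by rewrite exprMn real_normK ?num_real// mulrA mulrAC.
Qed.

Lemma is_derive_coord x i j : is_derive x (e i) (fun y => y 0 j) ((i == j)%:R).
Proof.
apply: (is_derive_quadratic (C := 0)) => h.
rewrite !mxE eqxx/= [j == i]eq_sym.
have -> : x 0 j + h * (i == j)%:R - x 0 j - h * (i == j)%:R = 0 by ring.
by rewrite normr0 mul0r.
Qed.

Lemma is_derive_mulX g x i j (d : R) : is_derive x (e i) g d ->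
  is_derive x (e i) (mulX j g) (x 0 j * d + (i == j)%:R * g x).
Proof.
move=> dg; have dc := is_derive_coord x i j.
have := is_deriveM dc dg.
by rewrite /GRing.scale/= [g x * _]mulrC.
Qed.

(** Leibniz rule for a coordinate function: [L] collects the words obtained by deleting from [s] one
    occurrence of [j]. It does not depend on [g], and for the estimates only its length and the
    lengths of its members matter. *)
Lemma iter_partial_mulX j s : exists2 L : seq (seq 'I_m),
    (size L <= size s)%N /\ {in L, forall s', (size s' <= size s)%N} &
  forall g, diff_all g -> iter_partial s (mulX j g) =
    (fun x => x 0 j * iter_partial s g x + \sum_(s' <- L) iter_partial s' g x).
Proof.
elim: s => [|i s [L [sL LL] LE]].
  by exists [::] => // g dg; apply/funext => x; rewrite big_nil addr0.
exists ((if i == j then [:: s] else [::]) ++ map (cons i) L).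
  split; first by rewrite size_cat size_map /=; case: ifP => _ /=; [rewrite add1n ltnS|rewrite add0n leqW].
  move=> s'; rewrite mem_cat => /orP[|/mapP[t tL ->]]; last by rewrite /= ltnS LL.
  by case: ifP => //; rewrite inE => _ /eqP ->; rewrite /= leqW.
move=> g dg; apply/funext => x; rewrite /= (LE g dg).
have d1 : is_derive x (e i) (mulX j (iter_partial s g)) (x 0 j * iter_partial (i :: s) g x + (i == j)%:R * iter_partial s g x).
  by apply: is_derive_mulX; apply: is_derive_pd; exact: dg.
have d2 : is_derive x (e i) (fun x => \sum_(s' <- L) iter_partial s' g x)
    (\sum_(s' <- L) iter_partial (i :: s') g x).
  elim: (L) => [|t L' IH].
    by rewrite (_ : (fun _ => _) = cst 0) ?big_nil; [exact: is_derive_cst|apply/funext => y; rewrite big_nil].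
  rewrite (_ : (fun _ => _) = iter_partial t g + (fun x => \sum_(s' <- L') iter_partial s' g x)).
    rewrite big_cons; apply: is_deriveD.
    by apply: is_derive_pd; exact: dg.
  by apply/funext => y; rewrite big_cons.
have := @derive_val _ _ _ _ _ _ _ (is_deriveD d1 d2).
rewrite big_cat big_map /= => ->.
by case: eqP => _; rewrite ?big_seq1 ?big_nil ?mul1r ?mul0r -?addrA ?add0r.
Qed.

End schwartz_class.

Lemma is_derive_line0 (R : realType) (V : normedModType R) (g : V -> R)
    (x v : V) (d : R) :
  is_derive (0 : R) 1 (fun r : R => g (x + r *: v)) d -> is_derive x v g d.
Proof. by move/(is_derive_line g x v 0 d); rewrite scale0r addr0. Qed.

Section parameter_integrals.
Context {R : realType} {m : nat}.
Local Notation mu := (@lebesgue_measure R).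
Implicit Types (g : 'rV[R]_m -> R) (x v : 'rV[R]_m) (i j k : 'I_m).
Local Notation e i := (delta_mx (0 : 'I_1) (i : 'I_m) : 'rV[R]_m).

Lemma continuous_Sch_curve g (gamma : R -> 'rV[R]_m) :
  Sch g -> continuous gamma -> continuous (g \o gamma).
Proof.
by move=> sg cg y; apply: continuous_comp; [exact: cg|exact: Sch_continuous].
Qed.

(** Along such a curve the integration variable is itself a coordinate of the point, so the decay of
    [g] in that coordinate gives a majorant that does not depend on the curve. *)
Lemma integrable_Sch_curve g (D : set R) (gamma : R -> 'rV[R]_m) k :
  Sch g -> measurable D -> continuous gamma -> (forall y, gamma y 0 k = y) ->
  mu.-integrable D (EFin \o (g \o gamma)).
Proof.
move=> sg mD cg gk; have [M gM] := sg.2 2%N.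
apply: (integrable_le_oneDsqrV (C := 2 * M)) => //.
  by apply: measurable_funTS; apply: continuous_measurable_fun; exact: continuous_Sch_curve.
by move=> y _; have := seminorm_le_decay (gamma y) k gM; rewrite gk.
Qed.

Lemma normr_Rintegral_curve g M (D : set R) (gamma : R -> 'rV[R]_m) k :
  Sch g -> seminorm_le 2 M g -> measurable D -> continuous gamma ->
  (forall y, gamma y 0 k = y) ->
  `|\int[mu]_(y in D) g (gamma y)| <= (2 * \int[mu]_x (oneDsqr x)^-1) * M.
Proof.
move=> sg gM mD cg gk; rewrite -mulrA [X in 2 * X]mulrC mulrA.
apply: normr_Rintegral_le => //.
- by apply: measurable_funTS; apply: continuous_measurable_fun; exact: (continuous_Sch_curve sg).
- by move=> y _; have := seminorm_le_decay (gamma y) k gM; rewrite gk.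
- by rewrite mulr_ge0// (seminorm_le_ge0 gM).
Qed.

(** The parameter [h] displaces the curve by [h * b y] along [e j]. With [b = 1] this is a
    translation of the base point; with [b y = c * y] it is the effect on a shear of moving the
    coordinate that the shear overwrites. The factor [b y] is absorbed into the Schwartz function
    [g'], which supplies the majorant. *)
Lemma is_derive_Rintegral_curve g g' (D : set R) (gamma : R -> 'rV[R]_m)
    (b : R -> R) j k (a : R) :
  Sch g -> Sch g' -> measurable D -> continuous gamma -> continuous b ->
  (forall h y : R, (gamma y + (h * b y) *: e j) 0 k = y) ->
  (forall h y : R, b y * pd j g (gamma y + (h * b y) *: e j) = g' (gamma y + (h * b y) *: e j)) ->
  is_derive a 1 (fun h => \int[mu]_(y in D) g (gamma y + (h * b y) *: e j))
    (\int[mu]_(y in D) g' (gamma y + (a * b y) *: e j)).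
Proof.
move=> sg sg' mD cg cb gk gg'; have [M gM] := sg'.2 2%N.
have cgh (h : R) : continuous (fun y => gamma y + (h * b y) *: e j).
  move=> y; apply: cvgD; first exact: cg.
  by apply: cvgZr_tmp; apply: cvgMl_tmp; exact: cb.
apply: (@is_derive_Rintegral R _ _ mu (fun h y => g (gamma y + (h * b y) *: e j))
  (fun h y => g' (gamma y + (h * b y) *: e j)) D (fun y => (2 * M) * (oneDsqr y)^-1) mD).
- by move=> h; exact: (integrable_Sch_curve sg mD (cgh h) (gk h)).
- move=> h y _; rewrite -gg'.
  have E : (fun r : R => g (gamma y + (r * b y) *: e j)) = (fun r : R => g (gamma y + r *: (b y *: e j))).
    by apply/funext => r; rewrite scalerA.
  have D0 := Sch_is_derive_dir (gamma y + h *: (b y *: e j)) (b y *: e j) sg.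
  have D1 := (is_derive_line g (gamma y) (b y *: e j) h _).1 D0.
  rewrite -E in D1; move: D1; congr is_derive.
  rewrite (bigD1 j)//= big1 ?addr0; first by rewrite !mxE !eqxx mulr1 scalerA.
  by move=> i /negbTE ij; rewrite !mxE ij andbF mulr0 mul0r.
- by apply: (integrableS _ _ _ (integrable_oneDsqrV (2 * M))).
- by move=> h y _; have := seminorm_le_decay (gamma y + (h * b y) *: e j) k gM; rewrite gk.
Qed.

End parameter_integrals.

Section comb.
Context {R : realType} {m : nat}.
Implicit Types (g h : 'rV[R]_m -> R) (x v : 'rV[R]_m) (i j k : 'I_m).
Implicit Types (l s : seq 'I_m) (a b : R).
Local Notation e i := (delta_mx (0 : 'I_1) (i : 'I_m) : 'rV[R]_m).

(** A scalar multiple is written [lcomb a 0 g g], so that this is the only form in which linearity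
    is used. *)
Definition lcomb a b g h : 'rV[R]_m -> R := fun x => a * g x + b * h x.

Lemma lcombE a b g h : lcomb a b g h = a *: g + b *: h.
Proof. by []. Qed.

Lemma iter_partial_lcomb a b g h s : diff_all g -> diff_all h ->
  iter_partial s (lcomb a b g h) = lcomb a b (iter_partial s g) (iter_partial s h).
Proof.
move=> dg dh; elim: s => [//|i s IH]; rewrite /= IH; apply/funext => x.
by rewrite !lcombE derive_comb.
Qed.

Lemma diff_all_lcomb a b g h : diff_all g -> diff_all h -> diff_all (lcomb a b g h).
Proof.
move=> dg dh s x i; rewrite iter_partial_lcomb// lcombE.
by apply: derivable_comb; [exact: dg|exact: dh].
Qed.

Lemma seminorm_le_lcomb N a b M M' g h : diff_all g -> diff_all h ->
  seminorm_le N M g -> seminorm_le N M' h ->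
  seminorm_le N (`|a| * M + `|b| * M') (lcomb a b g h).
Proof.
move=> dg dh gM hM l s lN sN x; rewrite iter_partial_lcomb// /lcomb mulrDr.
rewrite (le_trans (ler_normD _ _))// lerD// mulrCA normrM ler_wpM2l//.
  exact: gM.
exact: hM.
Qed.

Lemma Sch_lcomb a b g h : Sch g -> Sch h -> Sch (lcomb a b g h).
Proof.
move=> [dg bg] [dh bh]; split; first exact: diff_all_lcomb.
move=> N; have [M gM] := bg N; have [M' hM] := bh N.
by exists (`|a| * M + `|b| * M'); exact: seminorm_le_lcomb.
Qed.

Lemma diff_all_mulX j g : diff_all g -> diff_all (mulX j g).
Proof.
move=> dg s x i; have [L _ LE] := @iter_partial_mulX R m j s; rewrite (LE g dg).
have d1 : derivable (fun x => x 0 j * iter_partial s g x) x (e i).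
  have := is_derive_mulX j (is_derive_pd (dg s x i)).
  by move=> [].
have d2 : derivable (fun x => \sum_(s' <- L) iter_partial s' g x) x (e i).
  elim: (L) => [|t L' IH].
    rewrite (_ : (fun _ => _) = cst 0); first exact: derivable_cst.
    by apply/funext => y; rewrite big_nil.
  rewrite (_ : (fun _ => _) = iter_partial t g + (fun x => \sum_(s' <- L') iter_partial s' g x)).
    by apply: derivableD; [exact: dg|exact: IH].
  by apply/funext => y; rewrite big_cons.
exact: derivableD.
Qed.

Lemma seminorm_le_mulX N M j g : diff_all g -> seminorm_le N.+1 M g ->
  seminorm_le N (N.+1%:R * M) (mulX j g).
Proof.
move=> dg gM l s lN sN x; have [L [sL LL] LE] := @iter_partial_mulX R m j s; rewrite (LE g dg).
have M0 := seminorm_le_ge0 gM.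
rewrite mulrDr mulr_sumr (le_trans (ler_normD _ _))// -natr1 mulrDl mul1r addrC.
apply: lerD.
  apply: (le_trans (ler_norm_sum _ _ _)).
  apply: (le_trans (y := \sum_(i <- L) M)).
    rewrite big_seq [leRHS]big_seq; apply: ler_sum => s' /LL s's.
    by apply: gM; rewrite ltnW// ltnS// (leq_trans s's).
  rewrite big_const_seq count_predT iter_addr_0 -(mulr_natl M) ler_wpM2r// ler_nat.
  exact: leq_trans sN.
rewrite mulrA [monomial l x * _]mulrC -monomial_cons.
by apply: gM => //; rewrite leqW.
Qed.

Lemma Sch_mulX j g : Sch g -> Sch (mulX j g).
Proof.
move=> [dg bg]; split; first exact: diff_all_mulX.
by move=> N; have [M gM] := bg N.+1; exists (N.+1%:R * M); exact: seminorm_le_mulX.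
Qed.

End comb.

Section vertical_lines.
Context {R : realType} {m : nat} (tau : 'I_m).
Local Notation mu := (@lebesgue_measure R).
Implicit Types (g : 'rV[R]_m -> R) (x v : 'rV[R]_m) (i j k : 'I_m) (s : R).
Local Notation e i := (delta_mx (0 : 'I_1) (i : 'I_m) : 'rV[R]_m).

(** Written as a displacement along [e tau], so that varying [s] is differentiation along that
    axis. *)
Definition setc x s : 'rV[R]_m := x + (s - x 0 tau) *: e tau.

Lemma setcE x s : setc x s = setc x 0 + s *: e tau.
Proof. by rewrite /setc -addrA -scalerDl; congr (_ + _ *: _); ring. Qed.

Lemma setc_tau x s : setc x s 0 tau = s.
Proof. by rewrite !mxE !eqxx mulr1 addrC subrK. Qed.

Lemma setc_neq x s i : i != tau -> setc x s 0 i = x 0 i.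
Proof. by move=> /negbTE it; rewrite !mxE it andbF mulr0 addr0. Qed.

Lemma setc_id x : setc x (x 0 tau) = x.
Proof. by rewrite /setc subrr scale0r addr0. Qed.

Lemma setc_shift x s h i : i != tau -> setc (x + h *: e i) s = setc x s + h *: e i.
Proof.
move=> /negbTE it; rewrite /setc addrAC; rewrite !mxE [tau == i]eq_sym it andbF mulr0.
by rewrite addr0.
Qed.

Lemma setc_shift_tau x s h : setc (x + h *: e tau) s = setc x s.
Proof.
by rewrite /setc !mxE !eqxx mulr1 -addrA -scalerDl; congr (_ + _ *: _); ring.
Qed.

Lemma continuous_setc x : continuous (setc x).
Proof.
move=> s; apply: cvgD; first exact: cvg_cst.
by apply: cvgZr_tmp; apply: cvgB; [exact: cvg_id|exact: cvg_cst].
Qed.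

Lemma is_derive_setc g x s : Sch g ->
  is_derive s 1 (g \o setc x) (pd tau g (setc x s)).
Proof.
move=> sg; have := Sch_is_derive (setc x s) tau sg.
rewrite {1}setcE => /is_derive_line; congr is_derive.
by apply/funext => r; rewrite /= [in RHS]setcE.
Qed.

Lemma integrable_setc g x (D : set R) : Sch g -> measurable D ->
  mu.-integrable D (EFin \o (g \o setc x)).
Proof.
move=> sg mD; apply: (integrable_Sch_curve (k := tau)) => //.
  exact: continuous_setc.
exact: setc_tau.
Qed.

Lemma iter_mulX_setc n g x s :
  iter n (mulX tau) g (setc x s) = g (setc x s) * s ^+ n.
Proof.
elim: n => [|n IH]; first by rewrite expr0 mulr1.
by rewrite iterS /mulX IH setc_tau exprS mulrCA.
Qed.

Lemma Sch_iter_mulX n g : Sch g -> Sch (iter n (mulX tau) g).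
Proof. by move=> sg; elim: n => //= n IH; exact: Sch_mulX. Qed.

Lemma integrable_setc_pow n g x (D : set R) : Sch g -> measurable D ->
  mu.-integrable D (EFin \o (fun s => g (setc x s) * s ^+ n)).
Proof.
move=> sg mD; have := integrable_setc x (Sch_iter_mulX n sg) mD.
by congr (mu.-integrable _ (EFin \o _)); apply/funext => s; rewrite /= iter_mulX_setc.
Qed.

(** Integration by parts: the derivative of g(s) s^n has integral zero. At n = 0 the value of [n.-1]
    is irrelevant, being multiplied by 0. *)
Lemma Rintegral_pd_tau n g x : Sch g ->
  \int[mu]_s (pd tau g (setc x s) * s ^+ n) =
  - (n%:R * \int[mu]_s (g (setc x s) * s ^+ n.-1)).
Proof.
move=> sg; have sg' := Sch_pd tau sg.
pose F s := g (setc x s) * s ^+ n.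
pose f s := pd tau g (setc x s) * s ^+ n + n%:R * (g (setc x s) * s ^+ n.-1).
have fE : f = lcomb 1 n%:R (iter n (mulX tau) (pd tau g)) (iter n.-1 (mulX tau) g) \o setc x.
  by apply/funext => s; rewrite /lcomb /= !iter_mulX_setc mul1r.
have FE : F = iter n (mulX tau) g \o setc x.
  by apply/funext => s; rewrite /= !iter_mulX_setc.
have sf : Sch (lcomb 1 n%:R (iter n (mulX tau) (pd tau g)) (iter n.-1 (mulX tau) g)).
  by apply: Sch_lcomb; exact: Sch_iter_mulX.
have sF : Sch (iter n (mulX tau) g) by exact: Sch_iter_mulX.
have [M1 fM] := sf.2 2%N; have [M2 FM] := sF.2 2%N.
have decay (h : 'rV[R]_m -> R) M s : M <= Num.max M1 M2 -> seminorm_le 2 M h ->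
    `|h (setc x s)| <= (2 * Num.max M1 M2) * (oneDsqr s)^-1.
  move=> MM hM; have := seminorm_le_decay (setc x s) tau hM; rewrite setc_tau => /le_trans; apply.
  by rewrite ler_wpM2r ?oneDsqrV_ge0// ler_wpM2l.
have fi : \int[mu]_s f s = 0.
  apply: (@Rintegral_FTC_T R F f (2 * Num.max M1 M2)).
  - by rewrite fE; apply: continuous_Sch_curve => //; exact: continuous_setc.
  - move=> s; have dg := is_derive_setc x s sg.
    have dX := is_deriveX n (is_derive_id s (1 : R)).
    have H := is_deriveM dg dX.
    have -> : F = (g \o setc x) * (id ^+ n) by apply/funext => r; rewrite /F /= !fctE.
    apply: (is_derive_eq H).
    rewrite /f /GRing.scale /= mulr1.
    have -> : (id ^+ n : R -> R) s = s ^+ n by rewrite !fctE.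
    by move: (s ^+ n.-1) (s ^+ n) => p q; ring.
  - by move=> s; rewrite fE; apply: decay fM; rewrite le_max lexx.
  - by move=> s; rewrite FE; apply: decay FM; rewrite le_max lexx orbT.
move: fi; rewrite /f RintegralD//; last 2 first.
- exact: integrable_setc_pow.
- have := integrable_setc_pow n.-1 x (sg) measurableT.
  move=> /(integrableZl measurableT n%:R).
  by congr (mu.-integrable _ _); apply/funext => s; rewrite /= EFinM.
rewrite RintegralZl//; last exact: integrable_setc_pow.
by move=> /eqP; rewrite addr_eq0 => /eqP.
Qed.

End vertical_lines.

(** * Functions with vanishing moments in the central variable *)

Section lizorkin_class.
Context {R : realType} {m : nat} (tau : 'I_m).
Local Notation mu := (@lebesgue_measure R).
Implicit Types (g h : 'rV[R]_m -> R) (x v : 'rV[R]_m) (i j k : 'I_m).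
Implicit Types (l : seq 'I_m) (a b : R).
Local Notation e i := (delta_mx (0 : 'I_1) (i : 'I_m) : 'rV[R]_m).
Local Notation setc := (setc tau).

Definition moments0 g := forall n x, \int[mu]_s (g (setc x s) * s ^+ n) = 0.

Definition RPhi g := Sch g /\ moments0 g.

Lemma RPhi_lcomb a b g h : RPhi g -> RPhi h -> RPhi (lcomb a b g h).
Proof.
move=> [sg mg] [sh mh]; split; first exact: Sch_lcomb.
move=> n x; have ig := integrable_setc_pow tau n x sg measurableT.
have ih := integrable_setc_pow tau n x sh measurableT.
under eq_Rintegral do rewrite /lcomb mulrDl -!mulrA.
by rewrite (Rintegral_comb a b ig ih).2 mg mh !mulr0 addr0.
Qed.

Lemma RPhi_mulX i g : RPhi g -> RPhi (mulX i g).
Proof.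
move=> [sg mg]; split; first exact: Sch_mulX.
move=> n x; have [->|it] := eqVneq i tau.
  under eq_Rintegral do rewrite /mulX setc_tau mulrAC -exprS mulrC.
  exact: mg.
under eq_Rintegral do rewrite /mulX setc_neq// -mulrA.
rewrite RintegralZl ?mg ?mulr0//; exact: integrable_setc_pow.
Qed.

Lemma is_derive_Rintegral_setc g x (D : set R) i : Sch g -> measurable D ->
  i != tau ->
  is_derive x (e i) (fun y => \int[mu]_(s in D) g (setc y s))
    (\int[mu]_(s in D) pd i g (setc x s)).
Proof.
move=> sg mD it; apply: is_derive_line0.
have := @is_derive_Rintegral_curve R m g (pd i g) D (setc x) (fun=> 1) i tau 0 sg (Sch_pd i sg) mD (@continuous_setc R m tau x).
have -> : (fun h : R => \int[mu]_(y in D) g (setc x y + (h * 1) *: e i)) =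
  (fun r : R => \int[mu]_(s in D) g (setc (x + r *: e i) s)).
  by apply/funext => h; apply: eq_Rintegral => y _; rewrite setc_shift// mulr1.
under eq_Rintegral do rewrite mul0r scale0r addr0.
apply.
- by move=> ?; exact: cvg_cst.
- by move=> h y; rewrite -setc_shift ?setc_tau.
- by move=> h y; rewrite mul1r.
Qed.

(** Along [tau], integration by parts lowers the order of the moment. In another direction the
    moment vanishes identically in the base point, hence so does its derivative, which is taken
    under the integral. *)
Lemma RPhi_pd i g : RPhi g -> RPhi (pd i g).
Proof.
move=> [sg mg]; split; first exact: Sch_pd.
move=> n x; have [->|it] := eqVneq i tau.
  by rewrite Rintegral_pd_tau// mg mulr0 oppr0.
have sG := Sch_iter_mulX tau n sg.
have pE y : pd i (iter n (mulX tau) g) y = iter n (mulX tau) (pd i g) y.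
  elim: n {x} y sG => // n IH y sG.
  apply: pdE; have := is_derive_mulX tau (Sch_is_derive y i (Sch_iter_mulX tau n sg)).
  rewrite (negbTE it) mul0r addr0 IH//; exact: Sch_iter_mulX.
have := is_derive_Rintegral_setc x sG measurableT it.
have -> : (fun y => \int[mu]_s iter n (mulX tau) g (setc y s)) = cst 0.
  by apply/funext => y; under eq_Rintegral do rewrite iter_mulX_setc; rewrite mg.
move=> /pdE H; have P0 : pd i (cst 0) x = 0 by rewrite /pd derive_cst.
rewrite H in P0; rewrite -[RHS]P0.
by apply: eq_Rintegral => s _; rewrite pE// iter_mulX_setc.
Qed.

Definition antid g : 'rV[R]_m -> R := fun x =>
  \int[mu]_(s in `]-oo, x 0 tau]) g (setc x s).

Lemma antid_pd_tau g x : Sch g -> antid (pd tau g) x = g x.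
Proof.
move=> sg; have sg' := Sch_pd tau sg.
have [M1 gM] := sg.2 2%N; have [M2 g'M] := sg'.2 2%N.
have decay (h : 'rV[R]_m -> R) M s : M <= Num.max M1 M2 -> seminorm_le 2 M h ->
    `|h (setc x s)| <= (2 * Num.max M1 M2) * (oneDsqr s)^-1.
  move=> MM hM; have := seminorm_le_decay (setc x s) tau hM; rewrite setc_tau => /le_trans; apply.
  by rewrite ler_wpM2r ?oneDsqrV_ge0// ler_wpM2l.
rewrite -[RHS]/(g x) -[in RHS](setc_id tau x).
apply: (@Rintegral_FTC_Ny R (g \o setc x) (pd tau g \o setc x) (2 * Num.max M1 M2)).
- by apply: continuous_Sch_curve => //; exact: continuous_setc.
- by move=> s; exact: is_derive_setc.
- by move=> s; apply: decay g'M; rewrite le_max lexx orbT.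
- by move=> s; apply: decay gM; rewrite le_max lexx.
Qed.

Lemma is_derive_antid_tau g x : Sch g -> is_derive x (e tau) (antid g) (g x).
Proof.
move=> sg; apply: is_derive_line0.
pose F (y : R) := \int[mu]_(s in [set` `]-oo, y]]) (g \o setc x) s.
have E : (fun r : R => antid g (x + r *: e tau)) = F \o (fun r => x 0 tau + r).
  apply/funext => r; rewrite /antid /F /= !mxE !eqxx mulr1.
  by apply: eq_Rintegral => s _; rewrite setc_shift_tau.
have lt1 : x 0 tau < x 0 tau + 1 by rewrite ltrDl.
have H1 : mu.-integrable [set` Interval -oo%O (BRight (x 0 tau + 1))]
    (EFin \o (g \o setc x)) by exact: integrable_setc.
have H2 : {for x 0 tau, continuous (g \o setc x)}.
  by apply: continuous_Sch_curve => //; exact: continuous_setc.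
have [|dF F'] := continuous_FTC1 lt1 H1 _ H2; first by rewrite ltNyr.
rewrite /= setc_id derive1E in F'.
have H : is_derive (x 0 tau + 0 *: (1 : R)) (1 : R) F (g x).
  by rewrite scale0r addr0; split.
move/is_derive_line : H; rewrite E; congr is_derive.
by apply/funext => r; rewrite /= /GRing.scale/= mulr1.
Qed.

Lemma is_derive_antid g x i : Sch g -> is_derive x (e i) (antid g) (antid (pd i g) x).
Proof.
move=> sg; have [->|it] := eqVneq i tau.
  by rewrite antid_pd_tau//; exact: is_derive_antid_tau.
have := @is_derive_Rintegral_setc g x `]-oo, x 0 tau]%classic i sg (measurable_itv _) it.
move=> H; apply: is_derive_line0.
have {}H : is_derive (x + 0 *: e i) (e i)
    (fun y => \int[mu]_(s in `]-oo, x 0 tau]) g (setc y s)) (antid (pd i g) x).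
  by rewrite scale0r addr0.
move/is_derive_line : H; congr is_derive; apply/funext => r.
by rewrite /antid !mxE [tau == i]eq_sym (negbTE it) andbF mulr0 addr0.
Qed.

Lemma iter_partial_antid s g : Sch g -> iter_partial s (antid g) = antid (iter_partial s g).
Proof.
move=> sg; have sgs t : Sch (iter_partial t g) by elim: t => //= i t IH; exact: Sch_pd.
elim: s => //= i s ->; apply/funext => x.
exact/pdE/is_derive_antid.
Qed.

End lizorkin_class.

Lemma Rintegral_lcomb d (T : measurableType d) (R : realType)
    (mu : {measure set T -> \bar R}) (D : set T) (a b : R) (f g : T -> R) :
  measurable D -> mu.-integrable D (EFin \o f) -> mu.-integrable D (EFin \o g) ->
  mu.-integrable D (EFin \o (fun x => a * f x + b * g x)) /\
  \int[mu]_(x in D) (a * f x + b * g x) =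
    a * \int[mu]_(x in D) f x + b * \int[mu]_(x in D) g x.
Proof.
move=> mD fi gi.
have iZ c (h : T -> R) : mu.-integrable D (EFin \o h) ->
    mu.-integrable D (EFin \o (fun x => c * h x)).
  by move=> /(integrableZl mD c).
split; last by rewrite RintegralD ?RintegralZl//; exact: iZ.
by have := integrableD mD (iZ a f fi) (iZ b g gi).
Qed.

Section antiderivative.
Context {R : realType} {m : nat} (tau : 'I_m).
Local Notation mu := (@lebesgue_measure R).
Implicit Types (g h : 'rV[R]_m -> R) (x v : 'rV[R]_m) (i j k : 'I_m).
Implicit Types (l : seq 'I_m) (a b : R).
Local Notation setc := (setc tau).
Local Notation K0 := (\int[@lebesgue_measure R]_x (oneDsqr x)^-1).

Lemma iter_partial_cat t l g :
  iter_partial t (iter_partial l g) = iter_partial (t ++ l) g.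
Proof. by rewrite /iter_partial foldr_cat. Qed.

Lemma RPhi_iter_partial l g : RPhi tau g -> RPhi tau (iter_partial l g).
Proof. by move=> sg; elim: l => //= i l IH; exact: RPhi_pd. Qed.

Lemma seminorm_le_iter_partial N l M g : seminorm_le (N + size l) M g ->
  seminorm_le N M (iter_partial l g).
Proof.
move=> gM l' t lN tN x; rewrite iter_partial_cat; apply: gM.
  by rewrite (leq_trans lN)// leq_addr.
by rewrite size_cat leq_add2r.
Qed.

Lemma monomial_setc_le l x s : `|x 0 tau| <= `|s| ->
  `|monomial l x| <= `|monomial l (setc x s)|.
Proof.
move=> xs; elim: l => [|i l IH]; first by rewrite /monomial !big_nil.
rewrite !monomial_cons !normrM ler_pM//.
by have [->|it] := eqVneq i tau; [rewrite setc_tau|rewrite setc_neq].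
Qed.

(** Where [s] dominates the central coordinate of [x] in absolute value, the weight at [x] is at
    most the weight at [setc x s] and may be moved under the integral. The two extra orders pay for
    integrability in [s]. *)
Lemma normr_antid_part l M (D : set R) g x : Sch g -> seminorm_le (size l).+2 M g ->
  measurable D -> (forall s, D s -> `|x 0 tau| <= `|s|) ->
  `|monomial l x * \int[mu]_(s in D) g (setc x s)| <= 2 * M * K0.
Proof.
move=> sg gM mD Dx; have ig := integrable_setc tau x sg mD.
rewrite -RintegralZl//; apply: normr_Rintegral_le => //.
- apply: measurable_funM => //; apply/measurable_EFinP.
  exact: measurable_int ig.
- move=> s Ds; rewrite normrM.
  have o0 : 0 < oneDsqr s by rewrite (lt_le_trans ltr01)// oneDsqr_ge1.
  have h1 := gM l [::] (leqW (leqnSn _)) isT (setc x s).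
  have h2 := gM (tau :: tau :: l) [::] (leqnn _) isT (setc x s).
  rewrite ler_pdivlMr// (le_trans (y := `|monomial l (setc x s)| * `|g (setc x s)| * oneDsqr s))//.
    by rewrite ler_wpM2r// ?(ltW o0)// ler_wpM2r// monomial_setc_le// Dx.
  rewrite -normrM /oneDsqr mulrDr mulr1 mulrDl mul1r lerD//.
  move: h2; rewrite !monomial_cons setc_tau /= -mulrA -mulrA !normrM mulrA -normrM -expr2.
  by rewrite (ger0_norm (sqr_ge0 s)) [in X in X -> _]mulrC.
- by rewrite mulr_ge0// (seminorm_le_ge0 gM).
Qed.

(** The zeroth moment vanishes, so integrating from the other end gives the same antiderivative. *)
Lemma antidE_right g x : RPhi tau g ->
  antid tau g x = - \int[mu]_(s in `]x 0 tau, +oo[) g (setc x s).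
Proof.
move=> [sg mg]; have := mg 0%N x; under eq_Rintegral do rewrite expr0 mulr1.
rewrite -(setUv `]-oo, x 0 tau]%classic) setCitvl Rintegral_setU//.
- by move=> /eqP; rewrite addr_eq0 => /eqP.
- by rewrite -setCitvl setUv; exact: integrable_setc.
- by rewrite -setCitvl; apply/disj_setPS; rewrite setICr.
Qed.

(** An antiderivative decays on both sides because it can be computed from either end: the half-line
    is chosen on the side of the central coordinate of [x], away from 0, as [normr_antid_part]
    requires. *)
Lemma normr_antid l M g x : RPhi tau g -> seminorm_le (size l).+2 M g ->
  `|monomial l x * antid tau g x| <= 2 * M * K0.
Proof.
move=> sg gM; have [x0|x0] := leP (x 0 tau) 0.
  apply: normr_antid_part => //; first exact: sg.1.
  move=> s; rewrite /= in_itv/= => sx.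
  by rewrite !ler0_norm ?lerN2// (le_trans sx).
rewrite antidE_right// mulrN normrN.
apply: normr_antid_part => //; first exact: sg.1.
move=> s; rewrite /= in_itv/= andbT => xs.
by rewrite !gtr0_norm ?ltW// (lt_trans x0).
Qed.

(** The order counts up to [N] weights, up to [N] derivatives, and two more weights for
    integrability. *)
Lemma seminorm_le_antid N M g : RPhi tau g -> seminorm_le (N + N).+2 M g ->
  seminorm_le N (2 * K0 * M) (antid tau g).
Proof.
move=> sg gM l s lN sN x; rewrite (iter_partial_antid tau s sg.1) mulrAC.
apply: normr_antid; first exact: RPhi_iter_partial.
apply: seminorm_le_iter_partial; apply: seminorm_leW gM => //.
by rewrite addSn addSn !ltnS leq_add.
Qed.

Lemma Sch_antid g : RPhi tau g -> Sch (antid tau g).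
Proof.
move=> sg; split.
  move=> s x i; rewrite (iter_partial_antid tau s sg.1).
  by have [] := is_derive_antid tau x i (RPhi_iter_partial s sg).1.
move=> N; have [M gM] := sg.1.2 (N + N).+2; exists (2 * K0 * M).
exact: seminorm_le_antid.
Qed.

Lemma pd_tau_antid g : Sch g -> pd tau (antid tau g) = g.
Proof. by move=> sg; apply/funext => x; exact/pdE/is_derive_antid_tau. Qed.

(** By parts, n+1 times the n-th moment of the antiderivative is minus the (n+1)-st moment of [g].
    This is where moments of all orders enter: the space is stable under antiderivatives. *)
Lemma RPhi_antid g : RPhi tau g -> RPhi tau (antid tau g).
Proof.
move=> sg; split; first exact: Sch_antid.
move=> n x; have := Rintegral_pd_tau tau n.+1 x (Sch_antid sg).
rewrite (pd_tau_antid sg.1) (sg.2 n.+1 x) => /esym/eqP.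
by rewrite oppr_eq0 mulf_eq0 pnatr_eq0/= => /eqP.
Qed.

Lemma antid_lcomb a b g h : Sch g -> Sch h ->
  antid tau (lcomb a b g h) = lcomb a b (antid tau g) (antid tau h).
Proof.
move=> sg sh; apply/funext => x.
exact: (Rintegral_lcomb a b _ (integrable_setc tau x sg _) (integrable_setc tau x sh _)).2.
Qed.

End antiderivative.

(** * Bounded operators on functions with vanishing moments *)

Section bounded_operators.
Context {R : realType} {m : nat} (tau : 'I_m).
Implicit Types (g h : 'rV[R]_m -> R) (x v : 'rV[R]_m) (i j k : 'I_m).
Implicit Types (A B : ('rV[R]_m -> R) -> ('rV[R]_m -> R)).
Implicit Types (l : seq 'I_m) (a b : R).
Local Notation RPhi := (RPhi tau).

Definition linop A := forall a b g h, RPhi g -> RPhi h ->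
  A (lcomb a b g h) = lcomb a b (A g) (A h).

(** Continuous linear operators, with continuity expressed by seminorms. A single natural number [K]
    is both the order and the constant, so that only one choice is made for each [N]. *)
Record bop A : Prop := Bop {
  bop_RPhi : forall g, RPhi g -> RPhi (A g) ;
  bop_lin : linop A ;
  bop_seminorm : forall N, exists K : nat, forall g M, RPhi g ->
    seminorm_le K M g -> seminorm_le N (K%:R * M) (A g) }.

Lemma seminorm_le_nat N (K K' : nat) M g : (K <= K')%N ->
  seminorm_le N (K%:R * M) g -> 0 <= M -> seminorm_le N (K'%:R * M) g.
Proof. by move=> KK gM M0; apply: seminorm_leW gM => //; rewrite ler_wpM2r// ler_nat. Qed.

Lemma bop_bound A (P : nat -> nat) (C : nat -> R) :
  (forall g, RPhi g -> RPhi (A g)) -> linop A ->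
  (forall N g M, RPhi g -> seminorm_le (P N) M g -> seminorm_le N (C N * M) (A g)) ->
  bop A.
Proof.
move=> AR Al AP; split=> // N; exists (maxn (P N) (Num.bound (C N))) => g M sg gM.
have M0 := seminorm_le_ge0 gM.
apply: (seminorm_leW (leqnn _) _ (AP N g M sg _)).
  rewrite ler_wpM2r//; apply: (le_trans (y := (Num.bound (C N))%:R)).
    by rewrite ltW// (le_lt_trans (ler_norm _))// unstable.ltr_norm_bound.
  by rewrite ler_nat leq_maxr.
by apply: seminorm_leW gM => //; rewrite leq_maxl.
Qed.

Lemma bop_id : bop id.
Proof.
apply: (bop_bound (P := id) (C := fun=> 1)) => //.
by move=> N g M _; rewrite mul1r.
Qed.

Lemma bop_comp A B : bop A -> bop B -> bop (fun g => A (B g)).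
Proof.
move=> [Ar Al As] [Br Bl Bs]; split.
- by move=> g sg; apply/Ar/Br.
- by move=> a b g h sg sh; rewrite Bl// Al//; exact: Br.
move=> N; have [K1 AK] := As N; have [K2 BK] := Bs K1.
exists (maxn K2 (K1 * K2)) => g M sg gM; have M0 := seminorm_le_ge0 gM.
apply: (@seminorm_le_nat N (K1 * K2)) => //; first exact: leq_maxr.
rewrite natrM -mulrA; apply: AK; first exact: Br.
by apply: BK => //; apply: seminorm_leW gM => //; exact: leq_maxl.
Qed.

Lemma bop_lcomb a b A B : bop A -> bop B -> bop (fun g => lcomb a b (A g) (B g)).
Proof.
move=> [Ar Al As] [Br Bl Bs].
have [PA PAP] := choice As; have [PB PBP] := choice Bs.
apply: (bop_bound (P := fun N => maxn (PA N) (PB N))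
  (C := fun N => `|a| * (PA N)%:R + `|b| * (PB N)%:R)).
- by move=> g sg; apply: RPhi_lcomb; [exact: Ar|exact: Br].
- move=> c d g h sg sh; rewrite Al// Bl//; apply/funext => x; rewrite /lcomb; ring.
- move=> N g M sg gM; rewrite mulrDl -!mulrA.
  apply: seminorm_le_lcomb; [exact: (Ar _ sg).1.1|exact: (Br _ sg).1.1| |].
    by apply: PAP => //; apply: seminorm_leW gM => //; exact: leq_maxl.
  by apply: PBP => //; apply: seminorm_leW gM => //; exact: leq_maxr.
Qed.

Lemma bop_mulX i : bop (mulX i).
Proof.
apply: (bop_bound (P := S) (C := fun N => N.+1%:R)).
- by move=> g; exact: RPhi_mulX.
- by move=> a b g h _ _; apply/funext => x; rewrite /mulX /lcomb; ring.
- by move=> N g M sg; apply: seminorm_le_mulX; exact: sg.1.1.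
Qed.

Lemma bop_pd i : bop (pd i).
Proof.
apply: (bop_bound (P := S) (C := fun N => 1)).
- by move=> g; exact: RPhi_pd.
- move=> a b g h sg sh.
  exact: (iter_partial_lcomb a b [:: i] sg.1.1 sh.1.1).
- by move=> N g M sg; rewrite mul1r; exact: seminorm_le_pd.
Qed.

Lemma bop_antid : bop (antid tau).
Proof.
apply: (bop_bound (P := fun N => (N + N).+2)).
- by move=> g; exact: RPhi_antid.
- by move=> a b g h sg sh; apply: antid_lcomb; [exact: sg.1|exact: sh.1].
- by move=> N g M; exact: seminorm_le_antid.
Qed.

End bounded_operators.

(** * Operators through which derivatives and coordinates can be moved *)

Section intertwining.
Context {R : realType} {m : nat} (tau : 'I_m).
Implicit Types (g h : 'rV[R]_m -> R) (x v : 'rV[R]_m) (i j k : 'I_m).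
Implicit Types (l s : seq 'I_m) (a b : R).
Local Notation e i := (delta_mx (0 : 'I_1) (i : 'I_m) : 'rV[R]_m).
Local Notation RPhi := (RPhi tau).
Local Notation bop := (bop tau).

Variables (B : ('rV[R]_m -> R) -> ('rV[R]_m -> R)).
Variables (D X : 'I_m -> ('rV[R]_m -> R) -> ('rV[R]_m -> R)).
Hypothesis bD : forall i, bop (D i).
Hypothesis bX : forall i, bop (X i).
Hypothesis Blin : linop tau B.
Hypothesis Bnorm : exists N (C : R), forall g M, RPhi g -> seminorm_le N M g ->
  forall x, `|B g x| <= C * M.
Hypothesis Bpd : forall g i x, RPhi g -> is_derive x (e i) (B g) (B (D i g) x).
Hypothesis BX : forall g i, RPhi g -> mulX i (B g) = B (X i g).
Hypothesis Dtau : forall g, RPhi g -> D tau g = pd tau g.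

Let iter_partial_B s : exists2 A, bop A &
  forall g, RPhi g -> iter_partial s (B g) = B (A g).
Proof.
elim: s => [|i s [A bA AE]]; first by exists id => //; exact: bop_id.
exists (fun g => D i (A g)); first by apply: (bop_comp (bD i) bA).
move=> g sg /=; rewrite AE//; apply/funext => x.
exact/pdE/Bpd/(bop_RPhi bA).
Qed.

Let monomial_B l : exists2 A, bop A &
  forall g x, RPhi g -> monomial l x * B g x = B (A g) x.
Proof.
elim: l => [|i l [A bA AE]].
  by exists id; [exact: bop_id|move=> g x _; rewrite /monomial big_nil mul1r].
exists (fun g => X i (A g)); first by apply: (bop_comp (bX i) bA).
move=> g x sg; rewrite monomial_cons -mulrA AE//.
by rewrite -BX//; exact: (bop_RPhi bA).
Qed.

(** Derivatives, then coordinates, are moved inside [B], where they become a bounded operator on the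
    argument; the sup bound [Bnorm] then suffices for every seminorm. *)
Let bound_B l s : exists K : nat, forall g M, RPhi g -> seminorm_le K M g ->
  forall x, `|monomial l x * iter_partial s (B g) x| <= K%:R * M.
Proof.
have [A1 bA1 A1E] := iter_partial_B s; have [A2 bA2 A2E] := monomial_B l.
have [N [C BN]] := Bnorm.
have [K AK] := bop_seminorm (bop_comp bA2 bA1) N.
exists (K + (Num.bound C) * K)%N => g M sg gM x.
have M0 := seminorm_le_ge0 gM.
rewrite A1E// A2E; last exact: (bop_RPhi bA1).
have gM' : seminorm_le N (K%:R * M) (A2 (A1 g)).
  by apply: AK => //; apply: seminorm_leW gM => //; exact: leq_addr.
rewrite (le_trans (BN _ _ _ gM' x))//.
  by apply: (bop_RPhi bA2); exact: (bop_RPhi bA1).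
rewrite mulrA ler_wpM2r// natrD natrM ler_wpDl//.
by rewrite ler_wpM2r// ltW// (le_lt_trans (ler_norm _))// unstable.ltr_norm_bound.
Qed.

Let seminorm_B N : exists K : nat, forall g M, RPhi g -> seminorm_le K M g ->
  seminorm_le N (K%:R * M) (B g).
Proof.
(* Only finitely many pairs of lists have length at most [N], so the separate constants can be
   summed into a uniform one. *)
have /choice[K KP] : forall p : N.-bseq 'I_m * N.-bseq 'I_m, exists K : nat,
    forall g M, RPhi g -> seminorm_le K M g ->
    forall x, `|monomial p.1 x * iter_partial p.2 (B g) x| <= K%:R * M.
  by move=> p; exact: bound_B.
pose Kmax := (\sum_p K p)%N.
have KK p : (K p <= Kmax)%N by rewrite /Kmax (bigD1 p)//= leq_addr.
exists Kmax => g M sg gM l s lN sN x; have M0 := seminorm_le_ge0 gM.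
apply: (le_trans (KP (Bseq lN, Bseq sN) g M sg _ x)).
  exact: (seminorm_leW (KK _) (lexx M) gM).
by rewrite ler_wpM2r// ler_nat.
Qed.

Let Sch_B g : RPhi g -> Sch (B g).
Proof.
move=> sg; split.
  move=> s x i; have [A bA ->//] := iter_partial_B s.
  by have [] := Bpd i x (bop_RPhi bA sg).
move=> N; have [K KP] := seminorm_B N; have [M gM] := sg.1.2 K.
by exists (K%:R * M); exact: KP.
Qed.

(* All moments of [B g] vanish because [B g] is the [tau]-derivative of [B (antid tau g)], which lowers
   the order of the moments. *)
Lemma bop_intertwiner : bop B.
Proof.
split; [|exact: Blin|move=> N; exact: (seminorm_B N)].
move=> g sg; split; first exact: Sch_B.
move=> n; elim: n g sg => [|n IH] g sg x.
  have sG := RPhi_antid sg.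
  have -> : B g = pd tau (B (antid tau g)).
    apply/funext => y; apply/esym/pdE; have := Bpd tau y sG.
    by rewrite Dtau// pd_tau_antid//; exact: sg.1.
  by rewrite Rintegral_pd_tau; [rewrite mul0r oppr0|exact: Sch_B].
have sG := RPhi_antid sg.
have -> : B g = pd tau (B (antid tau g)).
  apply/funext => y; apply/esym/pdE; have := Bpd tau y sG.
  by rewrite Dtau// pd_tau_antid//; exact: sg.1.
by rewrite Rintegral_pd_tau; [rewrite IH// mulr0 oppr0|exact: Sch_B].
Qed.

End intertwining.

(** * One-dimensional transforms *)

Section partial_radon.
Context {R : realType} {m : nat} (tau k : 'I_m) (ktau : k != tau).
Local Notation mu := (@lebesgue_measure R).
Implicit Types (g : 'rV[R]_m -> R) (x v : 'rV[R]_m) (i j : 'I_m).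
Implicit Types (c h y : R).
Local Notation e i := (delta_mx (0 : 'I_1) (i : 'I_m) : 'rV[R]_m).

Definition shear c x y : 'rV[R]_m :=
  x + (y - x 0 k) *: e k + (c * x 0 k * y) *: e tau.

Definition partial_radon c g : 'rV[R]_m -> R := fun x => \int[mu]_y g (shear c x y).

Let tauk : (tau == k) = false. Proof. by rewrite eq_sym; exact/negbTE. Qed.
Let ktau' : (k == tau) = false. Proof. exact/negbTE. Qed.

Lemma shear_k c x y : shear c x y 0 k = y.
Proof. by rewrite !mxE !eqxx ktau' andbF !mulr0 addr0 mulr1 addrC subrK. Qed.

Lemma shear_tau c x y : shear c x y 0 tau = x 0 tau + c * x 0 k * y.
Proof. by rewrite !mxE !eqxx tauk andbF mulr0 addr0 mulr1. Qed.

Lemma shear_neq c x y i : i != k -> i != tau -> shear c x y 0 i = x 0 i.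
Proof. by move=> /negbTE ik /negbTE it; rewrite !mxE ik it andbF !mulr0 !addr0. Qed.

Lemma shear_shift c x y h i : i != k ->
  shear c (x + h *: e i) y = shear c x y + h *: e i.
Proof.
move=> ik; rewrite /shear !mxE [k == i]eq_sym (negbTE ik) andbF mulr0 addr0.
by rewrite -!addrA; congr (_ + _); rewrite addrC -!addrA.
Qed.

(** Slot [k] is overwritten by [y], so a move of [x] along [e k] is felt only in the central
    variable. *)
Lemma shear_shift_k c x y h :
  shear c (x + h *: e k) y = shear c x y + (h * (c * y)) *: e tau.
Proof.
rewrite /shear !mxE !eqxx mulr1 /= -!addrA; congr (_ + _).
rewrite [in LHS]addrA -!scalerDl; congr (_ *: _ + _ *: _); ring.
Qed.

Lemma continuous_shear c x : continuous (shear c x).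
Proof.
move=> y; apply: cvgD; first apply: cvgD; first exact: cvg_cst.
  by apply: cvgZr_tmp; apply: cvgB; [exact: cvg_id|exact: cvg_cst].
by apply: cvgZr_tmp; apply: cvgMl_tmp; exact: cvg_id.
Qed.

Lemma integrable_shear c g x : Sch g ->
  mu.-integrable setT (EFin \o (fun y => g (shear c x y))).
Proof.
move=> sg; apply: (integrable_Sch_curve (k := k) sg measurableT).
  exact: continuous_shear.
exact: shear_k.
Qed.

Lemma partial_radon_lcomb c a b g g' : Sch g -> Sch g' ->
  partial_radon c (lcomb a b g g') = lcomb a b (partial_radon c g) (partial_radon c g').
Proof.
move=> sg sg'; apply/funext => x.
exact: (Rintegral_lcomb a b measurableT (integrable_shear c x sg) (integrable_shear c x sg')).2.
Qed.

Lemma is_derive_shear g c x y : Sch g ->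
  is_derive y 1 (fun y => g (shear c x y))
    (pd k g (shear c x y) + (c * x 0 k) * pd tau g (shear c x y)).
Proof.
move=> sg; pose v := e k + (c * x 0 k) *: e tau.
have E r : shear c x r = shear c x 0 + r *: v.
  rewrite /shear /v scalerDr scalerA -!addrA; congr (_ + _).
  rewrite mulr0 scale0r !add0r [in RHS]addrA -!scalerDl.
  by congr (_ *: _ + _ *: _); ring.
have := Sch_is_derive_dir (shear c x y) v sg.
rewrite (bigD1 k)//= (bigD1 tau)/= ?tauk// big1 ?addr0; last first.
  by move=> i /andP[/negbTE ik /negbTE it]; rewrite !mxE ik it andbF mulr0 addr0 mul0r.
rewrite !mxE !eqxx ktau' tauk andbF /= mulr0 addr0 mulr1 add0r mul1r.
rewrite {1}E => /is_derive_line; congr is_derive.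
by apply/funext => r; rewrite [in RHS]E.
Qed.

(** The derivative in [y] of [g (shear c x y)] is (d_k g + c x_k d_tau g) at the sheared point, and
    its integral over the line is zero. This is how multiplication by x_k is exchanged for a
    derivative. *)
Lemma mulX_partial_radon_pd c g x : Sch g ->
  c * mulX k (partial_radon c (pd tau g)) x = - partial_radon c (pd k g) x.
Proof.
move=> sg; apply/esym/eqP; rewrite -subr_eq0 -opprD oppr_eq0; apply/eqP.
have sk := Sch_pd k sg; have st := Sch_pd tau sg.
have := partial_radon_lcomb c 1 (c * x 0 k) sk st => /(congr1 (@^~ x)).
rewrite {2}/lcomb mul1r /mulX mulrA => <-.
have sl := Sch_lcomb 1 (c * x 0 k) sk st.
have [M1 lM] := sl.2 2%N; have [M2 gM] := sg.2 2%N.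
have decay (h : 'rV[R]_m -> R) M y : M <= Num.max M1 M2 -> seminorm_le 2 M h ->
    `|h (shear c x y)| <= (2 * Num.max M1 M2) * (oneDsqr y)^-1.
  move=> MM hM; have := seminorm_le_decay (shear c x y) k hM; rewrite shear_k => /le_trans; apply.
  by rewrite ler_wpM2r ?oneDsqrV_ge0// ler_wpM2l.
apply: (@Rintegral_FTC_T R (fun y => g (shear c x y)) _ (2 * Num.max M1 M2)).
- by apply: (continuous_Sch_curve sl); exact: continuous_shear.
- by move=> y; have := is_derive_shear c x y sg; rewrite /lcomb mul1r.
- by move=> y; apply: decay lM; rewrite le_max lexx.
- by move=> y; apply: decay gM; rewrite le_max lexx orbT.
Qed.

Lemma is_derive_partial_radon c g x i : Sch g -> i != k ->
  is_derive x (e i) (partial_radon c g) (partial_radon c (pd i g) x).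
Proof.
move=> sg ik; apply: is_derive_line0.
have := @is_derive_Rintegral_curve R m g (pd i g) setT (shear c x) (fun=> 1) i k 0 sg (Sch_pd i sg) measurableT (@continuous_shear c x).
have -> : (fun h : R => \int[mu]_y g (shear c x y + (h * 1) *: e i)) =
  (fun r : R => partial_radon c g (x + r *: e i)).
  by apply/funext => h; apply: eq_Rintegral => y _; rewrite shear_shift// mulr1.
under eq_Rintegral do rewrite mul0r scale0r addr0.
apply.
- by move=> ?; exact: cvg_cst.
- by move=> h y; rewrite mulr1 -shear_shift// shear_k.
- by move=> h y; rewrite mul1r.
Qed.

(** Moving [x] along [e k] brings down the factor [c * y], and [y] is the k-th coordinate of the
    sheared point; hence the multiplication by a coordinate inside the transform. *)
Lemma is_derive_partial_radon_k c g x : Sch g ->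
  is_derive x (e k) (partial_radon c g) (c * partial_radon c (mulX k (pd tau g)) x).
Proof.
move=> sg; apply: is_derive_line0.
have st : Sch (mulX k (pd tau g)) by apply/Sch_mulX/Sch_pd.
have sct : Sch (lcomb c 0 (mulX k (pd tau g)) (mulX k (pd tau g))) by exact: Sch_lcomb.
have := @is_derive_Rintegral_curve R m g _ setT (shear c x) (fun y => c * y) tau k 0 sg sct measurableT (@continuous_shear c x).
have -> : (fun h : R => \int[mu]_y g (shear c x y + (h * (c * y)) *: e tau)) =
  (fun r : R => partial_radon c g (x + r *: e k)).
  by apply/funext => h; apply: eq_Rintegral => y _; rewrite shear_shift_k.
under eq_Rintegral do rewrite mul0r scale0r addr0.
have -> : \int[mu]_y lcomb c 0 (mulX k (pd tau g)) (mulX k (pd tau g)) (shear c x y) =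
    c * partial_radon c (mulX k (pd tau g)) x.
  have := partial_radon_lcomb c c 0 st st => /(congr1 (@^~ x)).
  by rewrite {2}/lcomb mul0r addr0.
apply.
- by move=> ?; apply: cvgMl_tmp; exact: cvg_id.
- by move=> h y; rewrite -shear_shift_k shear_k.
- by move=> h y; rewrite /lcomb /mulX mul0r addr0 -shear_shift_k shear_k mulrA.
Qed.

Lemma partial_radon_mulX_tau c g x : Sch g ->
  partial_radon c (mulX tau g) x =
  x 0 tau * partial_radon c g x + c * (x 0 k * partial_radon c (mulX k g) x).
Proof.
move=> sg; have sk := Sch_mulX k sg.
have [_] := Rintegral_lcomb (x 0 tau) (c * x 0 k) measurableT (integrable_shear c x sg) (integrable_shear c x sk).
rewrite -mulrA => <-; apply: eq_Rintegral => y _.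
by rewrite /mulX shear_tau shear_k mulrDl mulrA.
Qed.

Lemma partial_radon_mulX c g x i : Sch g -> i != k -> i != tau ->
  partial_radon c (mulX i g) x = x 0 i * partial_radon c g x.
Proof.
move=> sg ik it; rewrite /partial_radon -RintegralZl//; last exact: integrable_shear.
by apply: eq_Rintegral => y _; rewrite /mulX shear_neq.
Qed.

Lemma bop_partial_radon c : c != 0 -> bop tau (partial_radon c).
Proof.
move=> c0.
(* With P for the transform and I for [antid tau], the exceptional relations are d_k P = c P x_k
   d_tau, x_k P = - c^-1 P d_k I, and x_tau P = P (x_tau + d_k I x_k). The last follows from
   [partial_radon_mulX_tau] and the second one. Every other derivative or coordinate commutes with
   P. *)
pose D i g := if i == k then lcomb c 0 (mulX k (pd tau g)) (mulX k (pd tau g)) else pd i g.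
pose X i g := if i == k then lcomb (- c^-1) 0 (pd k (antid tau g)) (pd k (antid tau g))
  else if i == tau then lcomb 1 1 (mulX tau g) (pd k (antid tau (mulX k g)))
  else mulX i g.
have bmt : bop tau (fun g => mulX k (pd tau g)) := bop_comp (bop_mulX tau k) (bop_pd tau tau).
have bka : bop tau (fun g => pd k (antid tau g)) := bop_comp (bop_pd tau k) (bop_antid tau).
have XkP g x : RPhi tau g ->
    x 0 k * partial_radon c g x = - c^-1 * partial_radon c (pd k (antid tau g)) x.
  move=> sg; have := mulX_partial_radon_pd c x (Sch_antid sg).
  rewrite (pd_tau_antid tau sg.1) => H.
  rewrite mulNr -mulrN -H mulrA mulVf// mul1r//.
apply: (@bop_intertwiner R m tau (partial_radon c) D X).
- move=> i; rewrite /D; case: eqVneq => _; last exact: bop_pd.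
  exact: (bop_lcomb c 0 bmt bmt).
- move=> i; rewrite /X; case: eqVneq => _; first exact: (bop_lcomb _ 0 bka bka).
  case: eqVneq => _; last exact: bop_mulX.
  apply: (bop_lcomb 1 1 (bop_mulX tau tau)).
  exact: (bop_comp bka (bop_mulX tau k)).
- by move=> a b g g' sg sg'; apply: partial_radon_lcomb; [exact: sg.1|exact: sg'.1].
- exists 2%N, (2 * \int[mu]_x (oneDsqr x)^-1) => g M sg gM x.
  apply: (@normr_Rintegral_curve R m g M setT (shear c x) k) => //; first exact: sg.1.
    exact: continuous_shear.
  exact: shear_k.
- move=> g i x [sg _]; rewrite /D; case: eqVneq => [->|ik].
    rewrite (partial_radon_lcomb c c 0)//; try by apply/Sch_mulX/Sch_pd.
    by rewrite /lcomb mul0r addr0; exact: is_derive_partial_radon_k.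
  exact: is_derive_partial_radon.
- move=> g i sg; apply/funext => x; rewrite /X; case: eqVneq => [->|ik].
    have s1 := (bop_RPhi bka sg).1.
    by rewrite (partial_radon_lcomb c _ 0 s1 s1) /lcomb mul0r addr0 -XkP.
  case: eqVneq => [->|it].
    have sX := RPhi_mulX k sg.
    rewrite (partial_radon_lcomb c 1 1 (Sch_mulX tau sg.1) (bop_RPhi bka sX).1).
    rewrite /lcomb !mul1r (partial_radon_mulX_tau c x sg.1) XkP// /mulX.
    by rewrite mulrA mulrN mulfV// mulN1r subrK.
  by rewrite partial_radon_mulX//; exact: sg.1.
- by move=> g sg; rewrite /D tauk.
Qed.

End partial_radon.

(** * Fubini theorem for real-valued integrals *)

Section real_fubini.
Context d1 d2 (T1 : measurableType d1) (T2 : measurableType d2) (R : realType).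
Variables (m1 : {sigma_finite_measure set T1 -> \bar R})
          (m2 : {sigma_finite_measure set T2 -> \bar R}).

(** An integrable extended-real function is finite almost everywhere, so [fine] may be taken under
    the integral. *)
Lemma Rintegral_fine d (T : measurableType d) (mu : {measure set T -> \bar R})
    (F : T -> \bar R) : mu.-integrable setT F ->
  \int[mu]_x fine (F x) = fine (\int[mu]_x F x).
Proof.
move=> iF; rewrite /Rintegral; congr fine; apply: ae_eq_integral => //.
- apply/measurable_EFinP; apply: (measurableT_comp (fine_measurable measurableT)).
  exact: (measurable_int mu iF).
- exact: (measurable_int mu iF).
have := integrable_ae measurableT iF; apply: filterS => x Fx _.
by rewrite fineK// Fx.
Qed.

Lemma integrable_fine d (T : measurableType d) (mu : {measure set T -> \bar R})
    (F : T -> \bar R) : mu.-integrable setT F ->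
  mu.-integrable setT (EFin \o (fun x => fine (F x))).
Proof.
move=> iF; apply: (le_integrable _ _ _ iF) => //.
  apply/measurable_EFinP; apply: (measurableT_comp (fine_measurable measurableT)).
  exact: (measurable_int mu iF).
by move=> x _ /=; case: (F x) => //= *; rewrite ?normr0 ?leey.
Qed.

Lemma integrable_fubini_G (f : T1 * T2 -> \bar R) :
  (m1 \x m2)%E.-integrable setT f -> m2.-integrable setT (fubini_G m1 f).
Proof.
move=> fi; have mf := measurable_int _ fi.
apply/integrableP; split; first exact: (measurable_fubini_G fi).
have := (integrable21ltyP m1 m2 mf).1 fi; apply: le_lt_trans.
apply: ge0_le_integral => //.
- by apply: measurableT_comp => //; exact: (measurable_fubini_G fi).
- apply: (@measurable_fun_fubini_tonelli_G _ _ _ _ _ m1 (fun z => `|f z|%E)) => //.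
  exact: measurableT_comp.
move=> y _; apply: le_abse_integral => //.
exact: (measurableT_comp mf (pair2_measurable y)).
Qed.

Lemma Rintegral_prod (f : T1 * T2 -> R) :
  (m1 \x m2)%E.-integrable setT (EFin \o f) ->
  \int[m1]_x \int[m2]_y f (x, y) = \int[(m1 \x m2)%E]_z f z.
Proof.
move=> fi; rewrite (Rintegral_fine (integrable_fubini_F fi)).
by rewrite /Rintegral integral12_prod_meas1.
Qed.

Lemma Rintegral_Fubini (f : T1 * T2 -> R) :
  (m1 \x m2)%E.-integrable setT (EFin \o f) ->
  \int[m1]_x \int[m2]_y f (x, y) = \int[m2]_y \int[m1]_x f (x, y).
Proof.
move=> fi; rewrite (Rintegral_fine (integrable_fubini_F fi)).
rewrite (Rintegral_fine (integrable_fubini_G fi)).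
by rewrite integral12_prod_meas1// integral21_prod_meas1.
Qed.

Lemma integrable_prod_dominated (f : T1 * T2 -> R) (g1 : T1 -> R) (g2 : T2 -> R) :
  measurable_fun setT f ->
  m1.-integrable setT (EFin \o g1) -> m2.-integrable setT (EFin \o g2) ->
  (forall x y, `|f (x, y)| <= g1 x * g2 y) ->
  (m1 \x m2)%E.-integrable setT (EFin \o f).
Proof.
move=> mf ig1 ig2 fg; apply/(integrable12ltyP m1 m2); first exact/measurable_EFinP.
have /integrableP[mg1 ng1] := ig1; have /integrableP[mg2 ng2] := ig2.
have mf2 x : measurable_fun setT (fun y => f (x, y)).
  exact: (measurableT_comp mf (pair1_measurable x)).
have [mg1' mg2'] : measurable_fun setT g1 /\ measurable_fun setT g2.
  by split; exact/measurable_EFinP.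
apply: (@le_lt_trans _ _ (\int[m1]_x (`|(g1 x)%:E| * \int[m2]_y `|(g2 y)%:E|))%E).
  apply: ge0_le_integral => //.
  - by move=> x _; exact: integral_ge0.
  - apply: (@measurable_fun_fubini_tonelli_F _ _ _ _ _ m2 (fun z => `|(f z)%:E|%E)) => //.
    by apply: measurableT_comp => //; exact/measurable_EFinP.
  - apply: emeasurable_funM => //; apply: measurableT_comp => //.
  move=> x _; rewrite -ge0_integralZl//; last exact: measurableT_comp.
  apply: ge0_le_integral => //.
  - by apply: measurableT_comp => //; exact/measurable_EFinP.
  - by apply: emeasurable_funM => //; exact: measurableT_comp.
  - by move=> y _; rewrite -abseM lee_fin (le_trans (fg x y))// ler_norm.
rewrite ge0_integralZr//; last 2 first.
- exact: measurableT_comp.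
- exact: integral_ge0.
have h2 : (\int[m2]_y `|(g2 y)%:E|)%E \is a fin_num by rewrite ge0_fin_numE// integral_ge0.
have h1 : (\int[m1]_y `|(g1 y)%:E|)%E \is a fin_num by rewrite ge0_fin_numE// integral_ge0.
by rewrite ltey_eq fin_numM.
Qed.

End real_fubini.

Section product_sigma_finite.
Context d1 d2 (T1 : measurableType d1) (T2 : measurableType d2) (R : realType).
Variables (m1 : {sigma_finite_measure set T1 -> \bar R})
          (m2 : {sigma_finite_measure set T2 -> \bar R}).

Lemma product_measure1_sigma_finite : sigma_finite setT (m1 \x m2)%E.
Proof.
have /sigma_finiteP[F [TF ndF mF]] := sigma_finiteT m1.
have /sigma_finiteP[G [TG ndG mG]] := sigma_finiteT m2.
exists (fun k => F k `*` G k).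
  rewrite -setXTT TF TG; apply/seteqP; split => -[x y] /=.
    move=> [[i _ Fix] [j _ Gjy]]; exists (maxn i j) => //; split.
    - by move: x Fix; exact/subsetPset/ndF/leq_maxl.
    - by move: y Gjy; exact/subsetPset/ndG/leq_maxr.
  by move=> [i _ [/= ? ?]]; split; exists i.
move=> k; have [mFk Fkoo] := mF k; have [mGk Gkoo] := mG k; split.
  exact: measurableX.
by rewrite /= product_measure1E// lte_mul_pinfty// ge0_fin_numE.
Qed.

(* An alias: on [m1 \x m2] itself, the canonical sigma-finite structure is the one of products of
   subprobabilities. *)
Definition sfproduct : set (T1 * T2) -> \bar R := (m1 \x m2)%E.

HB.instance Definition _ := Measure.on sfproduct.

HB.instance Definition _ := Measure_isSigmaFinite.Build _ _ _ sfproduct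
  product_measure1_sigma_finite.

End product_sigma_finite.

Section null_point.
Context {R : realType}.
Local Notation mu := (@lebesgue_measure R).

Lemma measurable_invr : measurable_fun [set: R] (fun x : R => x^-1).
Proof.
have -> : [set: R] = `]-oo, (0 : R)[ `|` [set 0] `|` `]0, +oo[.
  apply/seteqP; split => x //= _; rewrite !in_itv/= andbT.
  by case: (ltgtP x 0) => // h; [left; left|right|left; right].
have c (x : R) : x != 0 -> {for x, continuous (fun x : R => x^-1)}.
  by move=> x0; exact: (cvgV x0 cvg_id).
apply/measurable_funU => //; first exact: measurableU.
split.
  apply/measurable_funU => //; split; last exact: measurable_fun_set1.
  apply: open_continuous_measurable_fun; first exact: interval_open.
  by move=> x /set_mem; rewrite /= in_itv/= => x0; apply: c; rewrite lt_eqF.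
apply: open_continuous_measurable_fun; first exact: interval_open.
by move=> x /set_mem; rewrite /= in_itv/= andbT => x0; apply: c; rewrite gt_eqF.
Qed.

Lemma eq_Rintegral_neq0 (f g : R -> R) :
  measurable_fun setT f -> measurable_fun setT g ->
  (forall x, x != 0 -> f x = g x) -> \int[mu]_x f x = \int[mu]_x g x.
Proof.
move=> mf mg fg; rewrite /Rintegral; congr fine; apply: ae_eq_integral => //.
- exact/measurable_EFinP.
- exact/measurable_EFinP.
exists [set 0]; split => //; first exact: lebesgue_measure_set1.
move=> x /= /not_implyP[_]; apply: contra_notP => /eqP x0.
by rewrite fg.
Qed.

End null_point.

(** * The Hilbert transform in the central variable *)

Section hilbert.
Context {R : realType} {m : nat} (tau k : 'I_m) (ktau : k != tau).
Local Notation mu := (@lebesgue_measure R).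
Implicit Types (g : 'rV[R]_m -> R) (x : 'rV[R]_m) (i j : 'I_m).
Local Notation e i := (delta_mx (0 : 'I_1) (i : 'I_m) : 'rV[R]_m).
Local Notation partial_radon := (partial_radon tau k).
Local Notation shear := (shear tau k).

(** Twice the principal value of the integral of g(x + v e_tau) / v. The symmetric difference
    removes the singularity at v = 0, so the integral converges absolutely for Schwartz [g]. *)
Definition hilbert g : 'rV[R]_m -> R := fun x =>
  \int[mu]_v ((g (x + v *: e tau) - g (x - v *: e tau)) * v^-1).

Let ktau' : (k == tau) = false. Proof. exact/negbTE. Qed.
Let tauk : (tau == k) = false. Proof. by rewrite eq_sym. Qed.

Let pt x (r s : R) : 'rV[R]_m := x + r *: e k + s *: e tau.

Let pt_k x r s : pt x r s 0 k = x 0 k + r.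
Proof. by rewrite !mxE !eqxx ktau' andbF mulr0 addr0 mulr1. Qed.

Let pt_tau x r s : pt x r s 0 tau = x 0 tau + s.
Proof. by rewrite !mxE !eqxx tauk andbF mulr0 addr0 mulr1. Qed.

Let continuous_pt x (p q : R -> R) : continuous p -> continuous q ->
  continuous (fun y => pt x (p y) (q y)).
Proof.
move=> cp cq y; apply: cvgD; first apply: cvgD; first exact: cvg_cst.
  by apply: cvgZr_tmp; exact: cp.
by apply: cvgZr_tmp; exact: cq.
Qed.

(** With r = z - x_k, the composed shears displace [x] by r along [k] and by c y r along [tau]: [y]
    enters only through the product y r, so a derivative along [tau] can be integrated in [y]
    explicitly. *)
Lemma shear_shear c x y z :
  shear c (shear (- c) x y) z = pt x (z - x 0 k) (c * y * (z - x 0 k)).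
Proof.
rewrite -[LHS]/(shear (- c) x y + (z - shear (- c) x y 0 k) *: e k
  + (c * shear (- c) x y 0 k * z) *: e tau) shear_k//.
apply/rowP => i; rewrite !mxE; ring.
Qed.

(** Peetre's inequality; it makes decay estimates insensitive to the base point. *)
Lemma oneDsqr_shift (a s : R) : (oneDsqr (a + s))^-1 <= 2 * oneDsqr a * (oneDsqr s)^-1.
Proof.
have o0 (u : R) : 0 < oneDsqr u by rewrite (lt_le_trans ltr01)// oneDsqr_ge1.
rewrite ler_pdivlMr// mulrC ler_pdivrMr// /oneDsqr.
have := sqr_ge0 (a + (a + s)); have := sqr_ge0 (a * (a + s)); nra.
Qed.

Lemma decay_pt g M x r s : seminorm_le 2 M g ->
  `|g (pt x r s)| <= (4 * oneDsqr (x 0 tau) * M) * (oneDsqr s)^-1.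
Proof.
move=> gM; have := seminorm_le_decay (pt x r s) tau gM; rewrite pt_tau => /le_trans; apply.
have := seminorm_le_ge0 gM => M0.
have := oneDsqr_shift (x 0 tau) s => h.
rewrite (le_trans (ler_wpM2l _ h)) ?mulr_ge0//.
by rewrite le_eqVlt; apply/orP; left; apply/eqP; ring.
Qed.

Lemma decay_pt_k g M x r s : seminorm_le 2 M g ->
  `|g (pt x r s)| <= (4 * oneDsqr (x 0 k) * M) * (oneDsqr r)^-1.
Proof.
move=> gM; have := seminorm_le_decay (pt x r s) k gM; rewrite pt_k => /le_trans; apply.
have := seminorm_le_ge0 gM => M0.
have := oneDsqr_shift (x 0 k) r => h.
rewrite (le_trans (ler_wpM2l _ h)) ?mulr_ge0//.
by rewrite le_eqVlt; apply/orP; left; apply/eqP; ring.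
Qed.

Lemma is_derive_pt g x r (c s : R) : Sch g ->
  is_derive s 1 (fun y => g (pt x r (c * y))) (c * pd tau g (pt x r (c * s))).
Proof.
move=> sg; have := Sch_is_derive_dir (pt x r (c * s)) (c *: e tau) sg.
have E y : pt x r (c * y) = pt x r 0 + y *: (c *: e tau).
  by rewrite /pt scale0r addr0 scalerA [y * c]mulrC.
rewrite (bigD1 tau)//= big1 ?addr0; last first.
  by move=> i /negbTE it; rewrite !mxE it andbF mulr0 mul0r.
rewrite !mxE !eqxx mulr1 {1}E => /is_derive_line; congr is_derive.
by apply/funext => y; rewrite E.
Qed.

Definition quot g x (r v : R) : R := (g (pt x r v) - g (pt x r (- v))) * v^-1.

Lemma measurable_quot g x (a : R) : Sch g ->
  measurable_fun setT (fun v => quot g x (a * v) v).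
Proof.
move=> sg; apply: measurable_funM; last exact: measurable_invr.
apply: measurable_funB; apply: continuous_measurable_fun;
  apply: (continuous_Sch_curve sg); apply: continuous_pt.
- by move=> ?; apply: cvgMl_tmp; exact: cvg_id.
- by move=> ?; exact: cvg_id.
- by move=> ?; apply: cvgMl_tmp; exact: cvg_id.
- by move=> ?; apply: cvgN; exact: cvg_id.
Qed.

(** For |v| <= 1 the mean value theorem cancels the division by [v]; beyond, the decay of [g]
    suffices. The bound is uniform in [r], as needed for the limit r -> 0 under the integral. *)
Lemma quot_bound g x : Sch g -> exists C : R, forall r v,
  `|quot g x r v| <= C * (oneDsqr v)^-1.
Proof.
move=> sg; have [M gM] := sg.2 2%N; have [M' gM'] := (Sch_pd tau sg).2 2%N.
have M0 := seminorm_le_ge0 gM; have M0' := seminorm_le_ge0 gM'.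
pose C1 := 4 * oneDsqr (x 0 tau) * M.
have o0 (u : R) : 0 < oneDsqr u by rewrite (lt_le_trans ltr01)// oneDsqr_ge1.
have C10 : 0 <= C1 by rewrite !mulr_ge0// ltW.
exists (4 * M' + 2 * C1) => r v.
have [v1|v1] := leP (`|v|) 1.
  have dg y : is_derive (y : 'rV[R]_m) (e tau) g (pd tau g y) by exact: Sch_is_derive.
  have [s _ E] := line_mean_value (pt x r (- v)) (2 * v) dg.
  have Ep : pt x r (- v) + (2 * v) *: e tau = pt x r v.
    by rewrite /pt -addrA -scalerDl; congr (_ + _ *: _); ring.
  rewrite /quot -Ep E mulrAC.
  have h1 := seminorm_le_norm (pt x r (- v) + s *: e tau) gM'.
  rewrite normrM; apply: (le_trans (y := 2 * M')).
    apply: ler_pM => //; rewrite -mulrA normrM ger0_norm// ler_piMr//.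
    by have [->|v0] := eqVneq v 0; [rewrite mul0r normr0|rewrite mulfV ?normr1].
  rewrite ler_pdivlMr// /oneDsqr.
  have : v ^+ 2 <= 1 by rewrite -real_normK ?num_real// expr_le1.
  nra.
rewrite /quot normrM normfV ler_pdivrMr ?(lt_trans ltr01)//.
have h1 := decay_pt x r v gM; have h2 := decay_pt x r (- v) gM.
have oN : oneDsqr (- v) = oneDsqr v by rewrite /oneDsqr sqrrN.
rewrite oN in h2.
rewrite (le_trans (ler_normB _ _))// (le_trans (lerD h1 h2))//.
rewrite -/C1 -mulrDl mulrAC ler_wpM2r ?invr_ge0 ?(ltW (o0 _))//.
have := ltW v1; nra.
Qed.

Lemma hilbertE g x : hilbert g x = \int[mu]_v quot g x 0 v.
Proof.
apply: eq_Rintegral => v _; rewrite /quot /pt !scale0r !addr0.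
by rewrite scaleNr.
Qed.

Let window g x (c : R) (n : nat) (r : R) : R :=
  \int[mu]_(y in `[- n%:R, n%:R]) g (pt x r (c * y * r)).

Let continuous_pt_y g x (c r : R) : Sch g -> continuous (fun y => g (pt x r (c * y * r))).
Proof.
move=> sg; apply: (continuous_Sch_curve sg); apply: continuous_pt.
  by move=> ?; exact: cvg_cst.
move=> y; apply: (@cvgMr_tmp _ _ _ _ (fun y => c * y)).
by apply: cvgMl_tmp; exact: cvg_id.
Qed.

(** At r = 0 the integrand is constant in [y], so there is no joint decay and the integral over the
    whole plane need not converge absolutely. Once [y] is confined to a window, the decay in [r] is
    enough. *)
Let window_fubini g x (c : R) (n : nat) : Sch g ->
  mu.-integrable setT (EFin \o window g x c n) /\
  \int[mu]_(y in `[- n%:R, n%:R]) (\int[mu]_r g (pt x r (c * y * r))) =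
  \int[mu]_r window g x c n r.
Proof.
move=> sg; have [M gM] := sg.2 2%N.
pose D : set R := `[- n%:R, n%:R]%classic.
pose f (z : measurableTypeR R * measurableTypeR R) : R :=
  g (pt x z.2 (c * z.1 * z.2)) * \1_D z.1.
have mf : measurable_fun setT f.
  apply: measurable_funM.
    apply: (@measurable_fun_caratheodory R _ (measurableTypeR R) (fun y r => g (pt x r (c * y * r)))).
      by move=> r; exact: continuous_pt_y.
    move=> y; apply: continuous_measurable_fun.
    apply: (continuous_Sch_curve sg); apply: continuous_pt.
      by move=> ?; exact: cvg_id.
    by move=> ?; apply: cvgMl_tmp; exact: cvg_id.
  have m1 : measurable_fun setT (\1_D : measurableTypeR R -> R).
    by apply: measurable_indic; exact: measurable_itv.
  exact: (measurableT_comp m1 measurable_fst).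
have fi : (mu \x mu)%E.-integrable setT (EFin \o f).
  (* The first factor is at least 1 on the window, so it dominates the indicator of [D] and is
     integrable. *)
  apply: (@integrable_prod_dominated _ _ _ _ R mu mu f
    (fun y => oneDsqr n%:R * (oneDsqr y)^-1)
    (fun r => (4 * oneDsqr (x 0 k) * M) * (oneDsqr r)^-1)) => //.
  - exact: integrable_oneDsqrV.
  - exact: integrable_oneDsqrV.
  move=> y r; rewrite /f /= normrM mulrC; apply: ler_pM => //; last exact: decay_pt_k.
  have o0 (u : R) : 0 < oneDsqr u by rewrite (lt_le_trans ltr01)// oneDsqr_ge1.
  rewrite indicE; have [|_] := boolP (y \in D); last first.
    by rewrite normr0 divr_ge0// ltW.
  move=> /set_mem; rewrite /D /= in_itv/= -ler_norml normr1 ler_pdivlMr// mul1r => yn.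
  by rewrite /oneDsqr lerD2l -real_normK ?num_real// lerXn2r// nnegrE.
have E1 y : \int[mu]_r f (y, r) = ((fun y => \int[mu]_r g (pt x r (c * y * r))) \_ D) y.
  rewrite patchE /f /= indicE; case: ifP => _.
    by apply: eq_Rintegral => r _; rewrite mulr1.
  under eq_Rintegral do rewrite mulr0.
  by rewrite Rintegral_cst// mul0r.
have E2 r : \int[mu]_y f (y, r) = window g x c n r.
  rewrite /window [RHS]Rintegral_mkcond; apply: eq_Rintegral => y _.
  by rewrite patchE /f /= indicE; case: ifP => _; rewrite ?mulr1 ?mulr0.
split.
  have := integrable_fine (integrable_fubini_G fi).
  by congr (mu.-integrable _ (EFin \o _)); apply/funext => r; rewrite -E2.
have := Rintegral_Fubini fi.
under eq_Rintegral do rewrite E1.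
under [in RHS]eq_Rintegral do rewrite E2.
by rewrite -Rintegral_mkcond.
Qed.

Let windowE g x (c : R) (n : nat) (r : R) : Sch g -> c * r != 0 ->
  window (pd tau g) x c n r =
  (c * r)^-1 * (g (pt x r (c * r * n%:R)) - g (pt x r (c * r * - n%:R))).
Proof.
move=> sg cr0; rewrite /window mulrBr.
apply: (@Rintegral_FTC2 R (fun y => (c * r)^-1 * g (pt x r (c * r * y)))).
- by rewrite (le_trans (y := 0))// oppr_le0.
- exact/continuous_pt_y/Sch_pd.
move=> y; have := is_deriveZ (c * r)^-1 (is_derive_pt x r (c * r) y sg).
rewrite /GRing.scale/= mulrA mulVf// mul1r.
by rewrite [c * y * r]mulrAC.
Qed.

Let window_scaled g x (c : R) (n : nat) : Sch g -> c != 0 ->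
  \int[mu]_r window (pd tau g) x c n.+1 r =
  `|c|^-1 * \int[mu]_v quot g x ((`|c| * n.+1%:R)^-1 * v) v.
Proof.
move=> sg c0; have [wi _] := window_fubini x c n.+1 (Sch_pd tau sg).
have n0 : n.+1%:R != 0 :> R by rewrite pnatr_eq0.
have a0 : 0 < `|c| by rewrite normr_gt0.
pose al := (`|c| * n.+1%:R)^-1.
have al0 : 0 < al by rewrite invr_gt0 mulr_gt0// ltr0n.
have [Cq qC] := quot_bound x sg.
have iq : mu.-integrable setT (EFin \o (fun v => quot g x (al * v) v)).
  apply: (integrable_le_oneDsqrV (C := Cq)) => //; exact: measurable_quot.
have wi' := integrable_affine 0 al0 wi.
rewrite (Rintegral_affine 0 al0 wi) -!RintegralZl//.
(* The explicit formula for the window excludes r = 0, a null set. *)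
apply: eq_Rintegral_neq0.
- by apply: measurable_funM => //; apply/measurable_EFinP; exact: (measurable_int mu wi').
- by apply: measurable_funM => //; exact: measurable_quot.
move=> v v0; rewrite addr0 windowE//; last by rewrite !mulf_neq0// gt_eqF.
rewrite /quot /al; move: n0; move: (n.+1%:R : R) => N N0.
(* After the rescaling, the ends of the window correspond to central displacements [v] and [- v].
   For negative [c] they are exchanged, and the sign of [c * r] compensates. *)
have [cp|cn|cE] := ltgtP c 0; last by rewrite cE eqxx in c0.
  rewrite ltr0_norm//.
  have -> : c * ((- c * N)^-1 * v) * N = - v by field; rewrite N0 c0.
  have -> : c * ((- c * N)^-1 * v) * - N = v by field; rewrite N0 c0.
  by move: (g _) (g _) => p q; field; rewrite N0 c0 v0.
rewrite gtr0_norm//.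
have -> : c * ((c * N)^-1 * v) * N = v by field; rewrite N0 c0.
have -> : c * ((c * N)^-1 * v) * - N = - v by field; rewrite N0 c0.
by move: (g _) (g _) => p q; field; rewrite N0 c0 v0.
Qed.

(* Exchanging the integrals over a window [-n, n], the inner one is computed by the fundamental theorem
   of calculus; rescaling by n then gives the difference quotient of the Hilbert transform in the limit. *)
Lemma partial_radonN_partial_radon (c : R) g x : c != 0 -> RPhi tau g ->
  partial_radon (- c) (partial_radon c (pd tau g)) x = `|c|^-1 * hilbert g x.
Proof.
move=> c0 sg; have a0 : 0 < `|c| by rewrite normr_gt0.
have sg' := RPhi_pd tau sg.
have sG := bop_RPhi (bop_partial_radon ktau c0) sg'.
have HE y : partial_radon c (pd tau g) (shear (- c) x y) =
    \int[mu]_r pd tau g (pt x r (c * y * r)).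
  rewrite /partial_radon.
  rewrite (Rintegral_affine (x 0 k) ltr01 (integrable_shear ktau c _ sg'.1)) mul1r.
  apply: eq_Rintegral => r _; rewrite shear_shear mul1r addrK.
  by [].
have iH : mu.-integrable setT (EFin \o (fun y => partial_radon c (pd tau g) (shear (- c) x y))).
  exact: integrable_shear sG.1.
have H1 := cvg_Rintegral_itvNnn measurableT iH.
have [Cq qC] := quot_bound x sg.1.
have H2 : \int[mu]_v quot g x ((`|c| * n.+1%:R)^-1 * v) v @[n --> \oo] -->
    \int[mu]_v quot g x 0 v.
  apply: (@cvg_Rintegral_dominated _ _ R mu setT
    (fun n v => quot g x ((`|c| * n.+1%:R)^-1 * v) v) (quot g x 0)
    (fun v => Cq * (oneDsqr v)^-1) measurableT).
  - by move=> n; apply: measurable_quot; exact: sg.1.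
  - move=> v _.
    have cc w : continuous (fun r => g (pt x r w)).
      apply: (continuous_Sch_curve sg.1); apply: continuous_pt => ?; [exact: cvg_id|exact: cvg_cst].
    have cq : continuous (fun r => quot g x r v).
      move=> r; apply: (@cvgMr_tmp _ _ _ _ (fun r => g (pt x r v) - g (pt x r (- v)))).
      by apply: cvgB; exact: cc.
    have cz : (`|c| * n.+1%:R)^-1 * v @[n --> \oo] --> (0 : R).
      rewrite -[X in _ --> X](mul0r v) -[X in X * v](mulr0 (`|c|^-1)).
      apply: cvgMr_tmp; under eq_fun do rewrite invfM.
      by apply: cvgMl_tmp; exact: cvg_harmonic.
    exact: (@cvg_comp _ _ _ _ (fun r => quot g x r v) _ _ _ cz (@cq 0)).
  - exact: integrable_oneDsqrV.
  - by move=> n v _; exact: qC.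
have E n : \int[mu]_(y in setT `&` `[- n.+1%:R, n.+1%:R])
    partial_radon c (pd tau g) (shear (- c) x y) =
    `|c|^-1 * \int[mu]_v quot g x ((`|c| * n.+1%:R)^-1 * v) v.
  rewrite setTI; under eq_Rintegral do rewrite HE.
  by rewrite (window_fubini x c n.+1 sg'.1).2 window_scaled//; exact: sg.1.
rewrite hilbertE.
have H3 : \int[mu]_(y in setT `&` `[- n.+1%:R, n.+1%:R])
    partial_radon c (pd tau g) (shear (- c) x y) @[n --> \oo] -->
    `|c|^-1 * \int[mu]_v quot g x 0 v.
  by under eq_fun do rewrite E; exact: cvgMl_tmp.
(* The windows are indexed from n+1 because the rescaling divides by the width. *)
have H4 := H1; rewrite -cvg_shiftS in H4.
by rewrite -(cvg_lim _ H3)// (cvg_lim _ H4).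
Qed.

End hilbert.

(** * The square of the Hilbert transform *)

(* For even [e], [e (u + v) - e (u - v)] is, up to sign, the integral of [e'] over the [r] such that
   |u|, |v| and r are the sides of a triangle: in the iterated Hilbert transform, this turns the
   double difference quotient into an absolutely convergent integral against [kernel]. *)
Section triangle_kernel.
Context {R : realType}.
Local Notation mu := (@lebesgue_measure R).
Implicit Types (u v r : R).

Definition triangle u v r : bool :=
  [&& `|u| < `|v| + r, `|v| < `|u| + r & r < `|u| + `|v|].

Definition kernel u v r : R := if triangle u v r then (`|u| * `|v|)^-1 else 0.

Lemma kernel_ge0 u v r : 0 <= kernel u v r.
Proof. by rewrite /kernel; case: ifP => // _; rewrite invr_ge0 mulr_ge0. Qed.

Lemma kernelC u v r : kernel u v r = kernel v u r.
Proof. by rewrite /kernel /triangle andbCA [`|u| + `|v|]addrC [`|u| * _]mulrC. Qed.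

Lemma kernel_le0 u v r : r <= 0 -> kernel u v r = 0.
Proof.
move=> r0; rewrite /kernel /triangle.
case: ifP => // /and3P[h1 h2 _]; exfalso; lra.
Qed.

Lemma kernel_scale u v r : 0 < r ->
  kernel (r * u) (r * v) r = r^-1 * (r^-1 * kernel u v 1).
Proof.
move=> r0; rewrite /kernel /triangle !normrM (gtr0_norm r0).
have E1 (p q : R) : (r * p < r * q + r) = (p < q + 1).
  by rewrite -[X in _ < _ + X]mulr1 -mulrDr ltr_pM2l.
have E2 (p q : R) : (r < r * p + r * q) = (1 < p + q).
  by rewrite -[X in X < _]mulr1 -mulrDr ltr_pM2l.
rewrite !E1 E2; case: ifP => _; last by rewrite !mulr0.
by rewrite !invfM; ring.
Qed.

Lemma measurable_kernel d (T : measurableType d) (f g h : T -> R) :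
  measurable_fun setT f -> measurable_fun setT g -> measurable_fun setT h ->
  measurable_fun setT (fun z => kernel (f z) (g z) (h z)).
Proof.
move=> mf mg mh.
have nf : measurable_fun setT (fun z => `|f z|) by exact: measurableT_comp.
have ng : measurable_fun setT (fun z => `|g z|) by exact: measurableT_comp.
apply: measurable_fun_ifT.
- apply: measurable_and; last apply: measurable_and; apply: measurable_fun_ltr => //;
    exact: measurable_funD.
- apply: (measurableT_comp measurable_invr); exact: measurable_funM.
- exact: measurable_cst.
Qed.

Definition kernel_mass r : \bar R := (\int[mu]_u \int[mu]_v (kernel u v r)%:E)%E.

Lemma kernel_mass_le0 r : r <= 0 -> kernel_mass r = 0%E.
Proof.
move=> r0; rewrite /kernel_mass; under eq_integral do under eq_integral do rewrite kernel_le0//.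
by rewrite integral0_eq// => u _; rewrite integral0_eq.
Qed.

(** The kernel is homogeneous of degree -2 in (u, v, r), which the two integrations compensate. *)
Lemma kernel_mass_scale r : 0 < r -> kernel_mass r = kernel_mass 1.
Proof.
move=> r0; have rV0 : 0 <= r^-1 by rewrite invr_ge0 ltW.
rewrite /kernel_mass.
have mk (u s : R) : measurable_fun setT (fun v => (kernel u v s)%:E).
  apply/measurable_EFinP; exact: (measurable_kernel (f := cst u) (g := id) (h := cst s)).
have mk1 s : measurable_fun setT (fun u => \int[mu]_v (kernel u v s)%:E)%E.
  apply: (@measurable_fun_fubini_tonelli_F _ _ _ _ _ mu
    (fun z : measurableTypeR R * measurableTypeR R => (kernel z.1 z.2 s)%:E)).
    apply/measurable_EFinP; exact: (measurable_kernel (f := fst) (g := snd) (h := cst s)).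
  by move=> z; rewrite lee_fin kernel_ge0.
rewrite (ge0_integral_affine 0 r0); last 2 first.
- exact: mk1.
- by move=> u; apply: integral_ge0 => v _; rewrite lee_fin kernel_ge0.
have E u : (\int[mu]_v (kernel (r * u + 0) v r)%:E = r^-1%:E * \int[mu]_v (kernel u v 1)%:E)%E.
  rewrite (ge0_integral_affine 0 r0); last 2 first.
  - exact: mk.
  - by move=> v; rewrite lee_fin kernel_ge0.
  under eq_integral do rewrite !addr0 kernel_scale// EFinM.
  rewrite ge0_integralZl//; last 2 first.
  - apply/measurable_EFinP; apply: measurable_funM => //.
    exact: (measurable_kernel (f := cst u) (g := id) (h := cst 1)).
  - by move=> v _; rewrite lee_fin mulr_ge0// kernel_ge0.
  rewrite muleA -EFinM mulfV ?gt_eqF// mul1e.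
  under eq_integral do rewrite EFinM.
  rewrite ge0_integralZl//; first exact: mk.
  by move=> v _; rewrite lee_fin kernel_ge0.
under eq_integral do rewrite E.
rewrite ge0_integralZl//; last 2 first.
- exact: mk1.
- by move=> u _; apply: integral_ge0 => v _; rewrite lee_fin kernel_ge0.
by rewrite muleA -EFinM mulfV ?gt_eqF// mul1e.
Qed.

(** The part |u| <= |v| of the symmetric kernel. With third side 1, the triangle inequalities there
    confine |v| to an interval with lower end max(|u|, 1 - |u|) >= 1/2 and upper end |u| + 1. *)
Let half_kernel u v : R := if `|u| <= `|v| then kernel u v 1 else 0.

Let half_kernel_ge0 u v : 0 <= half_kernel u v.
Proof. by rewrite /half_kernel; case: ifP => // _; exact: kernel_ge0. Qed.

Let kernel_le_half u v : kernel u v 1 <= half_kernel u v + half_kernel v u.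
Proof.
rewrite /half_kernel [kernel v u 1]kernelC; have k0 := kernel_ge0 u v 1.
by case: (leP (`|u|) (`|v|)) => uv; [rewrite lerDl; case: ifP|rewrite (ltW uv) add0r].
Qed.

Let measurable_half_kernel d (T : measurableType d) (f g : T -> R) :
  measurable_fun setT f -> measurable_fun setT g ->
  measurable_fun setT (fun z => half_kernel (f z) (g z)).
Proof.
move=> mf mg; apply: measurable_fun_ifT => //; last exact: measurable_kernel.
by apply: measurable_fun_ler; exact: measurableT_comp.
Qed.

Let half_kernel_bound u v (a := `|u|) (lo := Num.max a (1 - a)) :
  half_kernel u v <= (a * lo)^-1 * \1_(`[lo, a + 1[%classic : set R) v +
     (a * lo)^-1 * \1_(`](- (a + 1)), - lo]%classic : set R) v.
Proof.
have a0 : 0 <= a by exact: normr_ge0.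
have lo0 : 0 < lo by rewrite /lo lt_max; case: (ltP 0 a) => //= ?; lra.
have al0 : 0 <= (a * lo)^-1 by rewrite invr_ge0 mulr_ge0// ltW.
rewrite /half_kernel; case: ifP => uv; last by rewrite addr_ge0// mulr_ge0.
rewrite /kernel; case: ifPn => [/and3P[h1 h2 h3]|_]; last by rewrite addr_ge0// mulr_ge0.
have lov : lo <= `|v| by rewrite /lo ge_max uv /= -/a; rewrite -/a in h3; lra.
have key : (`|u| * `|v|)^-1 <= (a * lo)^-1.
  have [aE|aN] := eqVneq a 0; first by rewrite -/a aE !mul0r.
  have a0' : 0 < a by rewrite lt_def aN.
  rewrite lef_pV2 ?posrE ?mulr_gt0//; first by rewrite -/a ler_pM2l.
  exact: lt_le_trans lov.
rewrite (le_trans key)//; rewrite -/a in h2.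
have [v0|v0] := leP 0 v.
  rewrite !indicE [in X in X + _]mem_set; last by rewrite /= in_itv/= -[v]ger0_norm// lov.
  by rewrite mulr1 lerDl mulr_ge0.
rewrite !indicE [in X in _ + X]mem_set.
  by rewrite mulr1 lerDr mulr_ge0.
rewrite /= in_itv/=; rewrite ltr0_norm// in h2 lov; apply/andP; split; lra.
Qed.

(** The two intervals for [v] have length min(1, 2a), so for a > 0 the integral is at most 2 min(1,
    2a) / (a lo). Multiplied by 1 + a^2, this is largest at a = 1/2, where it equals 10. *)
Let half_kernel_mass u : (\int[mu]_v (half_kernel u v)%:E <= (10 * (oneDsqr u)^-1)%:E)%E.
Proof.
pose a := `|u|; pose lo := Num.max a (1 - a).
have a0 : 0 <= a by exact: normr_ge0.
have lo0 : 0 < lo by rewrite /lo lt_max; case: (ltP 0 a) => //= ?; lra.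
have al0 : 0 <= (a * lo)^-1 by rewrite invr_ge0 mulr_ge0// ltW.
have lea : lo <= a + 1 by rewrite /lo ge_max; apply/andP; split; lra.
pose I1 : set R := `[lo, a + 1[%classic; pose I2 : set R := `](- (a + 1)), - lo]%classic.
have mI1 : measurable (I1 : set (measurableTypeR R)) by exact: measurable_itv.
have mI2 : measurable (I2 : set (measurableTypeR R)) by exact: measurable_itv.
have l1 : mu I1 = (a + 1 - lo)%:E.
  rewrite lebesgue_measure_itv/= lte_fin; case: ifPn => //; rewrite -leNgt => h.
  have -> : lo = a + 1 by lra.
  by rewrite subrr.
have l2 : mu I2 = (a + 1 - lo)%:E.
  rewrite lebesgue_measure_itv/= lte_fin; case: ifPn => [_|]; first by rewrite -EFinD; congr _%:E; ring.
  rewrite -leNgt => h; have -> : lo = a + 1 by lra.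
  by rewrite subrr.
apply: (le_trans (y := (\int[mu]_v ((a * lo)^-1 * \1_I1 v + (a * lo)^-1 * \1_I2 v)%:E)%E)).
  apply: ge0_le_integral => //.
  - by move=> v _; rewrite lee_fin.
  - apply/measurable_EFinP; exact: (measurable_half_kernel (f := cst u) (g := id)).
  - apply/measurable_EFinP; apply: measurable_funD; apply: measurable_funM => //; exact: measurable_indic.
  - by move=> v _; rewrite lee_fin; exact: half_kernel_bound.
have mi (I : set R) : measurable (I : set (measurableTypeR R)) ->
    (\int[mu]_v ((a * lo)^-1 * \1_I v)%:E = (a * lo)^-1%:E * mu I)%E.
  move=> mI; under eq_integral do rewrite EFinM.
  rewrite ge0_integralZl//; last by apply/measurable_EFinP; exact: measurable_indic.
  by rewrite integral_indic// setIT.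
under eq_integral do rewrite EFinD.
rewrite ge0_integralD//; last 4 first.
- by move=> v _; rewrite lee_fin mulr_ge0.
- by apply/measurable_EFinP; apply: measurable_funM => //; exact: measurable_indic.
- by move=> v _; rewrite lee_fin mulr_ge0.
- by apply/measurable_EFinP; apply: measurable_funM => //; exact: measurable_indic.
rewrite !mi// l1 l2 -!EFinM -EFinD lee_fin.
have -> : oneDsqr u = oneDsqr a by rewrite /oneDsqr /a real_normK ?num_real.
have o0 : 0 < oneDsqr a by rewrite (lt_le_trans ltr01)// oneDsqr_ge1.
have [aE|aN] := eqVneq a 0.
  by rewrite aE !mul0r invr0 !mul0r addr0 divr_ge0// ltW// -aE.
have a0' : 0 < a by rewrite lt_def aN.
rewrite -mulrDl -mulr2n -mulr_natl ler_pdivlMr//.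
rewrite [X in X <= _](_ : _ = 2 * (a + 1 - lo) * oneDsqr a / (a * lo)); last first.
  by field; rewrite (gt_eqF lo0) aN.
rewrite ler_pdivrMr ?mulr_gt0// /oneDsqr /lo.
by case: (leP a (1 - a)) => h; nra.
Qed.

(** The kernel is at most its half with |u| <= |v| plus the mirror image, which has the same double
    integral by Tonelli. *)
Lemma kernel_mass_lty r : (kernel_mass r < +oo)%E.
Proof.
have [r0|r0] := leP r 0; first by rewrite kernel_mass_le0.
rewrite kernel_mass_scale// /kernel_mass.
have mh (T : measurableType _) (f g : T -> R) := @measurable_half_kernel _ T f g.
pose h1 := (fun z : measurableTypeR R * measurableTypeR R => (half_kernel z.1 z.2)%:E).
pose h2 := (fun z : measurableTypeR R * measurableTypeR R => (half_kernel z.2 z.1)%:E).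
have mh1 : measurable_fun setT h1 by apply/measurable_EFinP; exact: measurable_half_kernel.
have mh2 : measurable_fun setT h2 by apply/measurable_EFinP; exact: measurable_half_kernel.
have h10 z : (0 <= h1 z)%E by rewrite lee_fin.
have h20 z : (0 <= h2 z)%E by rewrite lee_fin.
have B : (\int[mu]_u \int[mu]_v (half_kernel u v)%:E < +oo)%E.
  have := integrable_oneDsqrV (10 : R) => /integrableP[_]; apply: le_lt_trans.
  apply: ge0_le_integral => //.
  - by move=> u _; apply: integral_ge0 => v _; rewrite lee_fin.
  - exact: (@measurable_fun_fubini_tonelli_F _ _ _ _ _ mu h1).
  - apply: measurableT_comp => //; exact: (measurable_int mu (integrable_oneDsqrV _)).
  - move=> u _; rewrite (le_trans (half_kernel_mass u))// lee_fin.
    exact: ler_norm.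
have B' : (\int[mu]_u \int[mu]_v (half_kernel v u)%:E < +oo)%E.
  by rewrite (@fubini_tonelli _ _ _ _ R mu mu h2).
apply: (@le_lt_trans _ _ (\int[mu]_u ((\int[mu]_v (half_kernel u v)%:E) + (\int[mu]_v (half_kernel v u)%:E)))%E).
  apply: ge0_le_integral => //.
  - by move=> u _; apply: integral_ge0 => v _; rewrite lee_fin kernel_ge0.
  - apply: (@measurable_fun_fubini_tonelli_F _ _ _ _ _ mu
      (fun z : measurableTypeR R * measurableTypeR R => (kernel z.1 z.2 1)%:E)).
      apply/measurable_EFinP; exact: (measurable_kernel (f := fst) (g := snd) (h := cst 1)).
    by move=> z; rewrite lee_fin kernel_ge0.
  - apply: emeasurable_funD.
      exact: (@measurable_fun_fubini_tonelli_F _ _ _ _ _ mu h1).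
    exact: (@measurable_fun_fubini_tonelli_F _ _ _ _ _ mu h2).
  move=> u _; rewrite -ge0_integralD//; last 4 first.
  - by move=> v _; rewrite lee_fin.
  - by apply/measurable_EFinP; exact: (measurable_half_kernel (f := cst u) (g := id)).
  - by move=> v _; rewrite lee_fin.
  - by apply/measurable_EFinP; exact: (measurable_half_kernel (f := id) (g := cst u)).
  apply: ge0_le_integral => //.
  - by move=> v _; rewrite lee_fin kernel_ge0.
  - by apply/measurable_EFinP; exact: (measurable_kernel (f := cst u) (g := id) (h := cst 1)).
  - apply: emeasurable_funD; apply/measurable_EFinP.
      exact: (measurable_half_kernel (f := cst u) (g := id)).
    exact: (measurable_half_kernel (f := id) (g := cst u)).
  - by move=> v _; rewrite -EFinD lee_fin.
rewrite ge0_integralD//.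
- exact: (lte_add_pinfty B B').
- by move=> u _; apply: integral_ge0 => v _; rewrite lee_fin.
- exact: (@measurable_fun_fubini_tonelli_F _ _ _ _ _ mu h1).
- by move=> u _; apply: integral_ge0 => v _; rewrite lee_fin.
- exact: (@measurable_fun_fubini_tonelli_F _ _ _ _ _ mu h2).
Qed.

(** On the square of side [1, 3/2] all triangle inequalities with third side 1 hold, and 1/(uv) is
    at least 4/9. *)
Lemma kernel_mass_gt0 : (0 < kernel_mass 1)%E.
Proof.
pose I : set R := `[1, 3 / 2]%classic.
have mI : measurable (I : set (measurableTypeR R)) by exact: measurable_itv.
have lI : mu I = (1 / 2)%:E.
  rewrite lebesgue_measure_itv/= lte_fin ifT; last by lra.
  by rewrite -EFinD; congr _%:E; field.
have iI : (\int[mu]_u (\1_I u)%:E = (1 / 2)%:E)%E.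
  by rewrite integral_indic// setIT; exact: lI.
have mI' : measurable_fun [set: measurableTypeR R] (fun u => (\1_I u)%:E : \bar R).
  by apply/measurable_EFinP; exact: measurable_indic.
have I0 (u : measurableTypeR R) : setT u -> (0 <= (\1_I u)%:E :> \bar R)%E by rewrite lee_fin.
apply: (@lt_le_trans _ _ (\int[mu]_u ((\1_I u)%:E * (4 / 9 * (1 / 2))%:E))%E).
  rewrite (ge0_integralZr mu measurableT mI' I0); last by rewrite lee_fin; lra.
  by rewrite iI -EFinM lte_fin; lra.
apply: ge0_le_integral => //.
- by apply: emeasurable_funM => //; apply/measurable_EFinP; exact: measurable_indic.
- apply: (@measurable_fun_fubini_tonelli_F _ _ _ _ _ mu
    (fun z : measurableTypeR R * measurableTypeR R => (kernel z.1 z.2 1)%:E)).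
    apply/measurable_EFinP; exact: (measurable_kernel (f := fst) (g := snd) (h := cst 1)).
  by move=> z; rewrite lee_fin kernel_ge0.
move=> u _; rewrite indicE; have [uI|_] := boolP (u \in I); last first.
  by rewrite mul0e; apply: integral_ge0 => v _; rewrite lee_fin kernel_ge0.
rewrite mul1e EFinM -iI.
rewrite -(ge0_integralZl mu measurableT mI' I0); last by rewrite lee_fin; lra.
apply: ge0_le_integral => //.
- by apply: emeasurable_funM => //; apply/measurable_EFinP; exact: measurable_indic.
- by apply/measurable_EFinP; exact: (measurable_kernel (f := cst u) (g := id) (h := cst 1)).
move=> v _; rewrite -EFinM lee_fin indicE; have [vI|_] := boolP (v \in I); last first.
  by rewrite mulr0 kernel_ge0.
move: uI vI; rewrite !inE /I /= !in_itv/= => /andP[u1 u2] /andP[v1 v2].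
rewrite mulr1 /kernel /triangle (ger0_norm (x := u)) ?(ger0_norm (x := v)); [|lra|lra].
rewrite ifT; last by apply/and3P; split; lra.
have uv0 : 0 < u * v by nra.
rewrite -[4 / 9]invrK lef_pV2 ?posrE// ?invr_gt0 ?divr_gt0//.
have -> : (4 / 9)^-1 = 9 / 4 :> R by field.
nra.
Qed.

End triangle_kernel.

Section double_difference.
Context {R : realType}.
Local Notation mu := (@lebesgue_measure R).
Variables (e e' : R -> R) (C : R).
Hypothesis e_even : forall s, e (- s) = e s.
Hypothesis de : forall s : R, is_derive s 1 e (e' s).
Hypothesis ce' : continuous e'.
Hypothesis eC : forall s, `|e s| <= C * (oneDsqr s)^-1.
Hypothesis e'C : forall s, `|e' s| <= C * (oneDsqr s)^-1.

Let me' : measurable_fun setT e'. Proof. exact: continuous_measurable_fun. Qed.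

Let e_norm s : e `|s| = e s.
Proof. by case: (ger0P s) => // _; rewrite e_even. Qed.

Let ie' (D : set R) : measurable D -> mu.-integrable D (EFin \o e').
Proof.
move=> mD; apply: (integrable_le_oneDsqrV (C := C)) => //.
exact: measurable_funTS.
Qed.

(** For positive sides the triangle condition says that [r] lies strictly between |a - b| and a + b;
    evenness of [e] removes the absolute value from the lower end. *)
Let kernel_FTC_gt0 (a b : R) : 0 < a -> 0 < b ->
  \int[mu]_r (e' r * kernel a b r) = (e (a + b) - e (a - b)) * (a^-1 * b^-1).
Proof.
move=> a0 b0; pose lo := `|a - b|; pose hi := a + b.
have lohi : lo <= hi by rewrite /lo /hi ler_norml; apply/andP; split; lra.
have E r : e' r * kernel a b r = ((fun r => (a^-1 * b^-1) * e' r) \_ `]lo, hi[) r.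
  rewrite patchE /kernel (_ : triangle a b r = (r \in (`]lo, hi[%classic : set R))).
    by case: ifP => _; rewrite ?mulr0// (gtr0_norm a0) (gtr0_norm b0) invfM mulrC.
  rewrite /triangle (gtr0_norm a0) (gtr0_norm b0); apply/idP/idP.
    move=> /and3P[h1 h2 h3]; rewrite inE /= in_itv/= /lo ltr_norml h3 andbT.
    by apply/andP; split; lra.
  rewrite inE /= in_itv/= /lo ltr_norml => /andP[/andP[h1 h2] h3].
  by apply/and3P; split => //; lra.
under eq_Rintegral do rewrite E.
rewrite -Rintegral_mkcond RintegralZl//; last exact: ie'.
rewrite Rintegral_itv_bndo_bndc; last exact: ie'.
rewrite Rintegral_itv_obnd_cbnd; last exact: ie'.
by rewrite (Rintegral_FTC2 lohi ce' de) /lo e_norm mulrC.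
Qed.

Let kernel_norm (u v r : R) : kernel u v r = kernel `|u| `|v| r.
Proof. by rewrite /kernel /triangle !normr_id. Qed.

Let kernel_FTC (u v : R) :
  \int[mu]_r (e' r * kernel u v r) = (e (u + v) - e (u - v)) * (u^-1 * v^-1).
Proof.
(* In the degenerate cases the convention 0^-1 = 0 makes both sides vanish. *)
have [u0|u0] := eqVneq u 0.
  rewrite u0 invr0 mul0r mulr0.
  have k0 r : kernel 0 v r = 0 by rewrite /kernel normr0 mul0r invr0 if_same.
  under eq_Rintegral do rewrite k0 mulr0.
  by rewrite Rintegral_cst// mul0r.
have [v0|v0] := eqVneq v 0.
  rewrite v0 invr0 mulr0 mulr0.
  have k0 r : kernel u 0 r = 0 by rewrite /kernel normr0 mulr0 invr0 if_same.
  under eq_Rintegral do rewrite k0 mulr0.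
  by rewrite Rintegral_cst// mul0r.
under eq_Rintegral do rewrite kernel_norm.
rewrite kernel_FTC_gt0 ?normr_gt0//.
case: (ger0P u) => _; case: (ger0P v) => _ //.
- by rewrite opprK invrN; ring.
- have -> : - u + v = - (u - v) by ring.
  have -> : - u - v = - (u + v) by ring.
  by rewrite !e_even invrN; ring.
- have -> : - u - v = - (u + v) by ring.
  have -> : - u - - v = - (u - v) by ring.
  by rewrite !e_even !invrN mulrNN.
Qed.

(** Once the integrand is written as an integral of [e'] against the kernel, Fubini integrates the
    kernel in (u, v) first. Its mass is constant for r > 0 and zero otherwise, so what remains is
    that constant times the integral of [e'] over the positive half-line, which is [- e 0]. *)
Lemma Rintegral_double_difference :
  \int[mu]_u \int[mu]_v ((e (u + v) - e (u - v)) * (u^-1 * v^-1)) =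
  - (fine (kernel_mass (1 : R)) * e 0).
Proof.
pose T := measurableTypeR R.
pose w (z : (T * T) * T) : R := e' z.2 * kernel z.1.1 z.1.2 z.2.
have mw : measurable_fun setT w.
  apply: measurable_funM; first exact: (measurableT_comp me' measurable_snd).
  apply: (measurable_kernel (f := fun z => z.1.1) (g := fun z => z.1.2) (h := snd)) => //.
  - exact: (measurableT_comp measurable_fst measurable_fst).
  - exact: (measurableT_comp measurable_snd measurable_fst).
have mkz r : measurable_fun setT (fun z : T * T => (kernel z.1 z.2 r)%:E).
  by apply/measurable_EFinP; exact: (measurable_kernel (f := fst) (g := snd) (h := cst r)).
have kz r : (\int[sfproduct mu mu]_z (kernel z.1 z.2 r)%:E = kernel_mass r)%E.
  rewrite (@fubini_tonelli1 _ _ _ _ R mu mu (fun z => (kernel z.1 z.2 r)%:E))//.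
  by move=> z; rewrite lee_fin kernel_ge0.
have km1 : kernel_mass (1 : R) = (fine (kernel_mass (1 : R)))%:E.
  by rewrite fineK// ge0_fin_numE ?kernel_mass_lty// ltW// kernel_mass_gt0.
have c0 : 0 <= fine (kernel_mass (1 : R)) by rewrite fine_ge0// ltW// kernel_mass_gt0.
set c := fine (kernel_mass (1 : R)) in km1 c0 *.
have kmE r : kernel_mass r = (if 0 < r then c else 0)%:E.
  case: ifPn => [r0|]; first by rewrite kernel_mass_scale.
  by rewrite -leNgt => r0; rewrite kernel_mass_le0.
(* Integrated in (u, v) first, the absolute value gives at most [c] times |e'|, which is
   integrable. *)
have iw : (sfproduct mu mu \x mu)%E.-integrable setT (EFin \o w).
  have mw' : measurable_fun setT (EFin \o w) by exact/measurable_EFinP.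
  apply/(integrable21ltyP (sfproduct mu mu) mu mw').
  have /integrableP[_] := ie' measurableT.
  rewrite -(@lte_pmul2l _ (c + 1)%:E) ?lte_fin ?ltr_wpDl// gt0_muley ?lte_fin ?ltr_wpDl//.
  rewrite -ge0_integralZl//; last 2 first.
  - by apply: measurableT_comp => //; exact/measurable_EFinP.
  - by rewrite lee_fin addr_ge0.
  apply: le_lt_trans; apply: ge0_le_integral => //.
  - by move=> r _; exact: integral_ge0.
  - apply: (@measurable_fun_fubini_tonelli_G _ _ _ _ _ (sfproduct mu mu) (fun z => `|(w z)%:E|%E)) => //.
    by apply: measurableT_comp => //; exact/measurable_EFinP.
  - by apply: emeasurable_funM => //; apply: measurableT_comp => //; exact/measurable_EFinP.
  move=> r _ /=.
  under eq_integral do rewrite /w /= normrM (ger0_norm (kernel_ge0 _ _ _)) EFinM.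
  rewrite ge0_integralZl//; last by move=> z _; rewrite lee_fin kernel_ge0.
  rewrite kz kmE muleC -EFinM -[leRHS]EFinM lee_fin ler_wpM2r//.
  by case: ifP => _; lra.
have := Rintegral_Fubini iw.
rewrite /w /=; under eq_Rintegral do rewrite kernel_FTC.
under [in RHS]eq_Rintegral => r _.
  rewrite RintegralZl//; last first.
    apply/integrableP; split; first exact: mkz.
    under eq_integral do rewrite /= ger0_norm ?kernel_ge0//.
    by rewrite kz kmE ltry.
  rewrite [X in _ * X](_ : _ = if 0 < r then c else 0); last by rewrite /Rintegral kz kmE.
  over.
have iD : (mu \x mu)%E.-integrable setT (EFin \o (fun z : T * T =>
    (e (z.1 + z.2) - e (z.1 - z.2)) * (z.1^-1 * z.2^-1))).
  have := integrable_fine (integrable_fubini_F iw).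
  by congr (_.-integrable _ (EFin \o _)); apply/funext => z; rewrite -kernel_FTC.
rewrite -(Rintegral_prod iD) /= => ->.
have E r : e' r * (if 0 < r then c else 0) = ((fun r => c * e' r) \_ `]0, +oo[) r.
  rewrite patchE (_ : (r \in _) = (0 < r)); first by case: ifP => _; rewrite ?mulr0// mulrC.
  by apply/idP/idP; rewrite inE /= in_itv/= andbT.
under eq_Rintegral do rewrite E.
rewrite -Rintegral_mkcond RintegralZl//; last exact: ie'.
rewrite -mulrN; congr (_ * _).
(* The integral over the positive half-line is minus the one over the negative half-line, and the
   latter is [e 0]. *)
have : \int[mu]_r e' r = 0 by apply: (@Rintegral_FTC_T R e e' C).
rewrite -(setUv `]-oo, (0 : R)]%classic) setCitvl Rintegral_setU//; last 2 first.
- by rewrite -setCitvl setUv; exact: ie'.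
- by rewrite -setCitvl; apply/disj_setPS; rewrite setICr.
rewrite (@Rintegral_FTC_Ny R e e' C)// => /eqP.
by rewrite addrC addr_eq0 => /eqP.
Qed.

End double_difference.

(** * Inversion of the one-dimensional transforms *)

Section automorphisms.
Context {R : realType} {m : nat} (tau : 'I_m).
Implicit Types (g : 'rV[R]_m -> R).
Implicit Types (A B : ('rV[R]_m -> R) -> ('rV[R]_m -> R)).

(* The inverse is required on [RPhi] only: the operators are arbitrary elsewhere. *)
Definition baut A := bop tau A /\ exists B, [/\ bop tau B,
  (forall g, RPhi tau g -> A (B g) = g) & (forall g, RPhi tau g -> B (A g) = g)].

Lemma baut_id : baut id.
Proof. by split; [exact: bop_id|exists id; split => //; exact: bop_id]. Qed.

Lemma baut_comp A1 A2 : baut A1 -> baut A2 -> baut (fun g => A1 (A2 g)).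
Proof.
move=> [bA1 [B1 [bB1 A1K B1K]]] [bA2 [B2 [bB2 A2K B2K]]]; split; first exact: bop_comp.
exists (fun g => B2 (B1 g)); split; first exact: (bop_comp bB2 bB1).
- by move=> g sg; rewrite A2K ?A1K//; exact: (bop_RPhi bB1).
- by move=> g sg; rewrite B1K ?B2K//; exact: (bop_RPhi bA2).
Qed.

End automorphisms.

Section partial_radon_inverse.
Context {R : realType} {m : nat} (tau k : 'I_m) (ktau : k != tau).
Local Notation mu := (@lebesgue_measure R).
Implicit Types (g : 'rV[R]_m -> R) (x : 'rV[R]_m).
Local Notation e i := (delta_mx (0 : 'I_1) (i : 'I_m) : 'rV[R]_m).
Local Notation partial_radon := (partial_radon tau k).
Local Notation hilbert := (hilbert tau).

Lemma integrable_hilbert g x : Sch g ->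
  mu.-integrable setT (EFin \o (fun v => (g (x + v *: e tau) - g (x - v *: e tau)) * v^-1)).
Proof.
move=> sg; have [C qC] := quot_bound ktau x sg.
have := integrable_le_oneDsqrV measurableT (measurable_quot tau k x 0 sg) (fun v _ => qC (0 * v) v).
congr (mu.-integrable _ (EFin \o _)); apply/funext => v.
by rewrite /quot mul0r !scale0r !addr0 scaleNr.
Qed.

Let kappa : R := - (2 * fine (kernel_mass (1 : R))).

(** Expanding both symmetric differences leaves four values of [g], which are those of e0 (u + v) -
    e0 (u - v) for the even function [e0]. Since [e0 0] is twice [g x], the double-difference
    formula gives the factor 2 of [kappa]. *)
Lemma hilbert_hilbert g x : Sch g -> hilbert (hilbert g) x = kappa * g x.
Proof.
move=> sg; have sg' := Sch_pd tau sg.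
pose e0 s := g (x + s *: e tau) + g (x - s *: e tau).
pose e1 s := pd tau g (x + s *: e tau) - pd tau g (x - s *: e tau).
have E u : (hilbert g (x + u *: e tau) - hilbert g (x - u *: e tau)) * u^-1 =
    \int[mu]_v ((e0 (u + v) - e0 (u - v)) * (u^-1 * v^-1)).
  have i1 := integrable_hilbert (x + u *: e tau) sg.
  have i2 := integrable_hilbert (x - u *: e tau) sg.
  have [_ h2] := Rintegral_lcomb u^-1 (- u^-1) measurableT i1 i2.
  rewrite mulrC mulrBr -mulNr -[LHS]h2.
  apply: eq_Rintegral => v _; rewrite /e0.
  have -> : x + u *: e tau + v *: e tau = x + (u + v) *: e tau by rewrite scalerDl addrA.
  have -> : x + u *: e tau - v *: e tau = x + (u - v) *: e tau by rewrite scalerBl addrA.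
  have -> : x - u *: e tau + v *: e tau = x - (u - v) *: e tau by rewrite scalerBl opprB addrAC addrA.
  have -> : x - u *: e tau - v *: e tau = x - (u + v) *: e tau by rewrite scalerDl opprD addrA.
  ring.
rewrite {1}/hilbert; under eq_Rintegral do rewrite E.
have [M1 gM] := sg.2 2%N; have [M2 gM'] := sg'.2 2%N.
pose W := 2 * oneDsqr (x 0 tau).
have o0 (u : R) : 0 < oneDsqr u by rewrite (lt_le_trans ltr01)// oneDsqr_ge1.
have decay (f : 'rV[R]_m -> R) M s : seminorm_le 2 M f ->
    `|f (x + s *: e tau)| <= (2 * M * W) * (oneDsqr s)^-1.
  move=> fM; have := seminorm_le_decay (x + s *: e tau) tau fM.
  rewrite !mxE !eqxx mulr1 => /le_trans; apply.
  have h0 : 0 <= 2 * M by rewrite mulr_ge0// (seminorm_le_ge0 fM).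
  by rewrite (le_trans (ler_wpM2l h0 (oneDsqr_shift (x 0 tau) s)))// /W !mulrA.
have decayN (f : 'rV[R]_m -> R) M s : seminorm_le 2 M f ->
    `|f (x - s *: e tau)| <= (2 * M * W) * (oneDsqr s)^-1.
  by move=> fM; rewrite -scaleNr (le_trans (decay f M _ fM))// /oneDsqr sqrrN.
pose C := Num.max (2 * (2 * M1 * W)) (2 * (2 * M2 * W)).
have C1 : 2 * (2 * M1 * W) <= C by rewrite le_max lexx.
have C2 : 2 * (2 * M2 * W) <= C by rewrite le_max lexx orbT.
have cl (s : R) : is_derive s 1 (fun s => g (x + s *: e tau)) (pd tau g (x + s *: e tau)).
  exact: (is_derive_line g x (e tau) s _).1 (Sch_is_derive _ tau sg).
have clN (s : R) : is_derive s 1 (fun s => g (x - s *: e tau)) (- pd tau g (x - s *: e tau)).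
  have E1 : (fun s => g (x - s *: e tau)) = (fun r => g (x + r *: (- e tau))).
    by apply/funext => r; rewrite scalerN.
  rewrite E1 -[x - s *: _]/(x + - (s *: e tau)) -scalerN.
  apply: (is_derive_line g x (- e tau) s _).1.
  have := Sch_is_derive_dir (x + s *: - e tau) (- e tau) sg.
  rewrite (bigD1 tau)//= big1 ?addr0; first by rewrite !mxE !eqxx mulN1r.
  by move=> i /negbTE it; rewrite !mxE it andbF oppr0 mul0r.
rewrite (@Rintegral_double_difference R e0 e1 C).
- by rewrite /e0 scale0r subr0 addr0 /kappa; ring.
- by move=> s; rewrite /e0 scaleNr opprK addrC.
- have cc : continuous (fun s : R => x + s *: e tau).
    by move=> s; apply: cvgD; [exact: cvg_cst|apply: cvgZr_tmp; exact: cvg_id].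
  have ccN : continuous (fun s : R => x - s *: e tau).
    by move=> s; apply: cvgB; [exact: cvg_cst|apply: cvgZr_tmp; exact: cvg_id].
  move=> s; apply: cvgB; first exact: (continuous_Sch_curve sg' cc).
  exact: (continuous_Sch_curve sg' ccN).
- move=> s; rewrite (le_trans (ler_normD _ _))// (le_trans (lerD (decay _ _ _ gM) (decayN _ _ _ gM)))//.
  by rewrite -mulrDl ler_wpM2r ?oneDsqrV_ge0// (le_trans _ C1)//; lra.
- move=> s; rewrite (le_trans (ler_normB _ _))// (le_trans (lerD (decay _ _ _ gM') (decayN _ _ _ gM')))//.
  by rewrite -mulrDl ler_wpM2r ?oneDsqrV_ge0// (le_trans _ C2)//; lra.
Qed.

Variables (c : R) (c0 : c != 0).
Let P := partial_radon c.
Let P' := partial_radon (- c).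
Let V g := P' (P (pd tau g)).

Let bP : bop tau P. Proof. exact: bop_partial_radon. Qed.
Let bP' : bop tau P'. Proof. by apply: bop_partial_radon => //; rewrite oppr_eq0. Qed.
Let bV : bop tau V. Proof. exact: (bop_comp bP' (bop_comp bP (bop_pd tau tau))). Qed.

Let VE g x : RPhi tau g -> V g x = `|c|^-1 * hilbert g x.
Proof. by move=> sg; exact: partial_radonN_partial_radon. Qed.

(** The right-hand side of [VE] depends on [c] only through its absolute value, so exchanging [P]
    and [P'] yields the same operator. *)
Let VE' g : RPhi tau g -> P (P' (pd tau g)) = V g.
Proof.
move=> sg; apply/funext => x; rewrite VE//.
have := @partial_radonN_partial_radon R m tau k ktau (- c) g x.
by rewrite opprK normrN oppr_eq0; apply.
Qed.

Let pdP g : RPhi tau g -> pd tau (P g) = P (pd tau g).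
Proof.
move=> sg; apply/funext => x; apply/pdE/is_derive_partial_radon => //; first exact: sg.1.
by rewrite eq_sym.
Qed.

Let pdP' g : RPhi tau g -> pd tau (P' g) = P' (pd tau g).
Proof.
move=> sg; apply/funext => x; apply/pdE/is_derive_partial_radon => //; first exact: sg.1.
by rewrite eq_sym.
Qed.

Let kap := kappa * (`|c|^-1) ^+ 2.

Let kap0 : kap != 0.
Proof.
have := @kernel_mass_gt0 R; have := kernel_mass_lty (1 : R).
rewrite /kap /kappa; case: (kernel_mass 1) => //= r _; rewrite lte_fin => r0.
by rewrite mulf_eq0 oppr_eq0 mulf_eq0 pnatr_eq0 expf_eq0 /= invr_eq0 normr_eq0 (negbTE c0) gt_eqF.
Qed.

Let VV g : RPhi tau g -> V (V g) = (fun x => kap * g x).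
Proof.
move=> sg; apply/funext => x; have sV := bop_RPhi bV sg.
have a0 : `|c| != 0 by rewrite normr_eq0.
have HE : hilbert g = (fun y => `|c| * V g y).
  by apply/funext => y; rewrite VE// mulrA mulfV// mul1r.
rewrite VE//; have := hilbert_hilbert x sg.1.
have -> : hilbert (hilbert g) x = `|c| * hilbert (V g) x.
  rewrite HE {2}/hilbert -RintegralZl//; last exact: (integrable_hilbert x sV.1).
  by apply: eq_Rintegral => v _; rewrite -mulrBr mulrA.
move=> H; rewrite /kap.
have -> : hilbert (V g) x = `|c|^-1 * (kappa * g x) by rewrite -H mulrA mulVf// mul1r.
by ring.
Qed.

Let scale (a : R) g := lcomb a 0 g g.

(** V factors both as P' P d/dt and as P P' d/dt, and V^2 is the nonzero scalar [kap]. Since d/dt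
    commutes with P and P', this yields a right inverse [B] and a left inverse [L] of P. *)
Lemma baut_partial_radon : baut tau P.
Proof.
split; first exact: bP.
have VV1 g : RPhi tau g -> scale kap^-1 (V (V g)) = g.
  move=> sg; rewrite VV//; apply/funext => x.
  by rewrite /scale /lcomb mul0r addr0 mulrA mulVf// mul1r.
pose B0 g := P' (pd tau (V g)).
have bB0 : bop tau B0 := bop_comp bP' (bop_comp (bop_pd tau tau) bV).
pose B g := scale kap^-1 (B0 g).
have bB : bop tau B := bop_lcomb kap^-1 0 bB0 bB0.
pose L0 g := V (pd tau (P' g)).
have bL0 : bop tau L0 := bop_comp bV (bop_comp (bop_pd tau tau) bP').
pose L g := scale kap^-1 (L0 g).
have PB g : RPhi tau g -> P (B g) = g.
  move=> sg; have s0 := bop_RPhi bB0 sg.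
  rewrite /B /scale (bop_lin bP) // /B0 VE'; first exact: VV1.
  exact: (bop_RPhi bV).
have LP g : RPhi tau g -> L (P g) = g.
  move=> sg; rewrite /L /L0 pdP'; last exact: (bop_RPhi bP).
  by rewrite pdP//; exact: VV1.
exists B; split => // g sg.
have sP := bop_RPhi bP sg.
(* A left inverse forces the right inverse to be two-sided: B P = L P B P = L P = id. *)
by rewrite -(LP (B (P g))) ?PB ?LP//; exact: (bop_RPhi bB).
Qed.

End partial_radon_inverse.

(** * Signed permutations of the coordinates *)

Section signed_permutations.
Context {R : realType} {m : nat} (tau : 'I_m).
Implicit Types (g : 'rV[R]_m -> R) (x : 'rV[R]_m) (i j : 'I_m).
Local Notation e i := (delta_mx (0 : 'I_1) (i : 'I_m) : 'rV[R]_m).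

Definition signed_perm (p : 'I_m -> 'I_m) (s : 'I_m -> R) x : 'rV[R]_m :=
  \row_i (s i * x 0 (p i)).

Lemma bop_signed_perm (p q : 'I_m -> 'I_m) (s : 'I_m -> R) :
  cancel p q -> cancel q p -> (forall i, s i * s i = 1) ->
  p tau = tau -> s tau = 1 -> bop tau (fun g => g \o signed_perm p s).
Proof.
move=> pq qp ss ptau stau.
have qtau : q tau = tau by rewrite -[in LHS]ptau pq.
have shift x h j : signed_perm p s (x + h *: e j) =
    signed_perm p s x + h *: (s (q j) *: e (q j)).
  apply/rowP => i; rewrite !mxE /= mulrDr; congr (_ + _).
  rewrite ?eqxx /= (_ : (p i == j) = (i == q j)); last by apply/eqP/eqP => [<-|->]; rewrite ?pq ?qp.
  by case: eqVneq => [->|_]; rewrite ?mulr1 ?mulr0 // mulrC.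
(* Coordinate [j] of [x] appears in slot [q j] of the image, with sign [s (q j)]. *)
pose D j g := lcomb (s (q j)) 0 (pd (q j) g) (pd (q j) g).
pose X j g := lcomb (s (q j)) 0 (mulX (q j) g) (mulX (q j) g).
apply: (@bop_intertwiner R m tau (fun g => g \o signed_perm p s) D X).
- by move=> j; exact: (bop_lcomb _ 0 (bop_pd tau (q j)) (bop_pd tau (q j))).
- by move=> j; exact: (bop_lcomb _ 0 (bop_mulX tau (q j)) (bop_mulX tau (q j))).
- by [].
- exists 0%N, 1 => g M sg gM x; rewrite mul1r; exact: seminorm_le_norm gM.
- move=> g j x sg; apply: is_derive_line0.
  have -> : (fun r : R => (g \o signed_perm p s) (x + r *: e j)) =
      (fun r : R => g (signed_perm p s x + r *: (s (q j) *: e (q j)))).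
    by apply/funext => r; rewrite /= shift.
  have := Sch_is_derive_dir (signed_perm p s x + 0 *: (s (q j) *: e (q j))) (s (q j) *: e (q j)) sg.1.
  move=> /(is_derive_line g _ _ 0 _).1.
  rewrite (bigD1 (q j))//= big1 ?addr0; last first.
    by move=> i /negbTE ij; rewrite !mxE ij andbF mulr0 mul0r.
  by rewrite !mxE !eqxx mulr1 scale0r addr0 /D /lcomb /= mul0r addr0.
- move=> g j sg; apply/funext => x; rewrite /mulX /X /lcomb /= mul0r addr0 /mulX.
  by rewrite !mxE qp mulrA mulrA ss mul1r.
- move=> g sg; rewrite /D qtau stau; apply/funext => x.
  by rewrite /lcomb mul1r mul0r addr0.
Qed.

Lemma baut_signed_perm (p q : 'I_m -> 'I_m) (s : 'I_m -> R) :
  cancel p q -> cancel q p -> (forall i, s i * s i = 1) ->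
  p tau = tau -> s tau = 1 -> baut tau (fun g => g \o signed_perm p s).
Proof.
move=> pq qp ss ptau stau.
have qtau : q tau = tau by rewrite -[in LHS]ptau pq.
split; first exact: bop_signed_perm pq qp ss ptau stau.
exists (fun g => g \o signed_perm q (s \o q)); split.
- by apply: (bop_signed_perm qp pq) => [i|//|]; rewrite /= ?ss// qtau.
- move=> g _; apply/funext => x /=; congr (g _); apply/rowP => i.
  by rewrite !mxE /= qp mulrA ss mul1r.
- move=> g _; apply/funext => x /=; congr (g _); apply/rowP => i.
  by rewrite !mxE /= pq mulrA ss mul1r.
Qed.

End signed_permutations.

(** * Composition of the shears *)

Section iterated_radon.
Context {R : realType} {m : nat} (tau : 'I_m) (c : R).
Implicit Types (g : 'rV[R]_m -> R) (x : 'rV[R]_m) (i j k : 'I_m).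
Implicit Types (ks : seq 'I_m) (v : seq R).

Fixpoint shears ks v x : 'rV[R]_m :=
  match ks, v with
  | k :: ks', y :: v' => shears ks' v' (shear tau k c x y)
  | _, _ => x
  end.

Lemma shears_notin ks v x j : j \notin ks -> j != tau -> shears ks v x 0 j = x 0 j.
Proof.
elim: ks v x => [|k ks IH] [|y v] x //=; rewrite inE negb_or => /andP[jk jks] jt.
by rewrite IH// shear_neq.
Qed.

Lemma shears_nth ks v x (i : nat) : uniq ks -> tau \notin ks -> size v = size ks ->
  (i < size ks)%N -> shears ks v x 0 (nth tau ks i) = nth 0 v i.
Proof.
elim: ks v x i => [|k ks IH] [|y v] x i //= /andP[kks uks].
rewrite inE negb_or => /andP[tk tks] [sv].
case: i => [|i] /=; last by rewrite ltnS; exact: IH.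
by move=> _; rewrite shears_notin ?shear_k 1?eq_sym.
Qed.

(** Since [ks] has no repetition, a shear along [k] finds the original x_k: the preceding ones
    changed only other coordinates and the central one. The central displacements thus add up to a
    bilinear form. *)
Lemma shears_tau ks v x : uniq ks -> tau \notin ks -> size v = size ks ->
  shears ks v x 0 tau = x 0 tau + c * \sum_(i < size ks) x 0 (nth tau ks i) * nth 0 v i.
Proof.
elim: ks v x => [|k ks IH] [|y v] x //=.
  by rewrite big_ord0 mulr0 addr0.
move=> /andP[kks uks]; rewrite inE negb_or => /andP[tk tks] [sv].
rewrite IH// shear_tau 1?eq_sym// big_ord_recl /= mulrDr addrA mulrA.
congr (_ + c * _); apply: eq_bigr => i _.
have ik : nth tau ks i \in ks by rewrite mem_nth.
rewrite shear_neq//; first by apply: contraNneq kks => <-.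
by apply: contraNneq tks => <-.
Qed.

Lemma continuous_shears ks v (f : R -> 'rV[R]_m) : continuous f ->
  continuous (fun y => shears ks v (f y)).
Proof.
elim: ks v f => [|k ks IH] [|y v] f cf //=; apply: IH.
have cfk : continuous (fun y => f y 0 k).
  move=> z; apply: (cvg_comp f (fun x : 'rV[R]_m => x 0 k) (cf z)).
  exact: coord_continuous.
move=> z; apply: cvgD; first apply: cvgD; first exact: cf.
  by apply: cvgZr_tmp; apply: cvgB; [exact: cvg_cst|exact: cfk].
by apply: cvgZr_tmp; apply: cvgMr_tmp; apply: cvgMl_tmp; exact: cfk.
Qed.

(** The integrable majorant on R^d, a tensor power of 1 / (1 + y^2). *)
Definition weight v : R := \prod_(y <- v) (oneDsqr y)^-1.

(** Multiplying [g] by 1 + z_k^2 preserves the Schwartz class, so the factors are gained one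
    coordinate at a time. *)
Lemma Sch_weight ks g : Sch g ->
  exists M, forall z, `|g z| <= M * \prod_(k <- ks) (oneDsqr (z 0 k))^-1.
Proof.
elim: ks g => [|k ks IH] g sg.
  by have [M gM] := Sch_bounded sg; exists M => z; rewrite big_nil mulr1.
have [M hM] := IH _ (Sch_lcomb 1 1 sg (Sch_mulX k (Sch_mulX k sg))).
exists M => z; have o0 : 0 < oneDsqr (z 0 k) by rewrite (lt_le_trans ltr01)// oneDsqr_ge1.
rewrite big_cons mulrCA mulrC ler_pdivlMr// (le_trans _ (hM z))//.
rewrite /lcomb /mulX !mul1r -[oneDsqr _]gtr0_norm// -normrM.
by rewrite le_eqVlt; apply/orP; left; apply/eqP; congr (`|_|); rewrite /oneDsqr; ring.
Qed.

Lemma shears_weight ks v x : uniq ks -> tau \notin ks -> size v = size ks ->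
  \prod_(k <- ks) (oneDsqr (shears ks v x 0 k))^-1 = weight v.
Proof.
move=> uks tks sv; rewrite /weight (big_nth tau) [RHS](big_nth 0) sv.
by rewrite !big_mkord; apply: eq_bigr => i _; rewrite shears_nth.
Qed.

End iterated_radon.

(** * Iterated integrals *)

Section tuple_integrals.
Context {R : realType}.
Local Notation mu := (@lebesgue_measure R).
Local Notation rT := (measurableTypeR R).

Lemma integrable_tupleS d (f : d.+1.-tuple rT -> R) :
  measurable_fun setT f ->
  (mu \x lebesgue_tuple R d)%E.-integrable setT (EFin \o (f \o @tuple_cons R d)) ->
  (lebesgue_tuple R d.+1).-integrable setT (EFin \o f).
Proof.
move=> mf fi.
have mf' : measurable_fun setT (EFin \o f) by exact/measurable_EFinP.
exact: (@integrable_pushforward _ _ _ _ R _ (measurable_tuple_cons (n := d)) _ setT _ mf' fi measurableT).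
Qed.

Lemma Rintegral_tupleS d (f : d.+1.-tuple rT -> R) :
  measurable_fun setT f ->
  (mu \x lebesgue_tuple R d)%E.-integrable setT (EFin \o (f \o @tuple_cons R d)) ->
  \int[lebesgue_tuple R d.+1]_v f v =
  \int[mu]_y \int[lebesgue_tuple R d]_v f (tuple_cons (y, v)).
Proof.
move=> mf fi.
have mf' : measurable_fun setT (EFin \o f) by exact/measurable_EFinP.
rewrite (Rintegral_prod fi) /Rintegral; congr fine.
exact: (@integral_pushforward _ _ _ _ R _ (measurable_tuple_cons (n := d)) _ setT _ mf' fi measurableT).
Qed.

Lemma measurable_weight d : measurable_fun setT (fun v : d.-tuple rT => weight v).
Proof.
elim: d => [|d IH].
  rewrite (_ : (fun _ => _) = cst 1); first exact: measurable_cst.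
  by apply/funext => v; rewrite tuple0 /weight big_nil.
rewrite (_ : (fun _ => _) = (fun z : rT * d.-tuple rT => (oneDsqr z.1)^-1 * weight z.2) \o @tuple_split R d).
  apply: measurableT_comp; last exact: measurable_tuple_split.
  apply: measurable_funM; last exact: (measurableT_comp IH measurable_snd).
  have c1 : measurable_fun setT (fun y : rT => (oneDsqr y)^-1).
    by apply: continuous_measurable_fun; exact: continuous_oneDsqrV.
  exact: (measurableT_comp c1 measurable_fst).
by apply/funext => v; rewrite [v]tuple_eta /weight big_cons /tuple_split /= theadE.
Qed.

Lemma integrable_weight d :
  (lebesgue_tuple R d).-integrable setT (EFin \o (fun v : d.-tuple rT => weight v)).
Proof.
elim: d => [|d IH].
  apply/integrableP; split; first by apply/measurable_EFinP; exact: (@measurable_weight 0).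
  rewrite /= integral_dirac//; last first.
    apply/measurable_EFinP; apply: measurableT_comp; last exact: (@measurable_weight 0).
    exact: normr_measurable.
  by rewrite diracT mul1e ltry.
apply: integrable_tupleS; first exact: measurable_weight.
have i1 := integrable_oneDsqrV (1 : R).
apply: (@integrable_prod_dominated _ _ _ _ R mu (lebesgue_tuple R d) _ _ _ _ i1 IH).
  apply: measurableT_comp; first exact: measurable_weight.
  exact: measurable_tuple_cons.
move=> y v; rewrite /= /weight big_cons mul1r ger0_norm//.
by rewrite mulr_ge0 ?oneDsqrV_ge0// prodr_ge0// => ? _; exact: oneDsqrV_ge0.
Qed.

End tuple_integrals.

Section iterated_radon_tuple.
Context {R : realType} {m : nat} (tau : 'I_m) (c : R) (c0 : c != 0).
Local Notation mu := (@lebesgue_measure R).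
Local Notation rT := (measurableTypeR R).
Implicit Types (g : 'rV[R]_m -> R) (x : 'rV[R]_m) (i j k : 'I_m).
Implicit Types (ks : seq 'I_m).
Local Notation shears := (shears tau c).

(** By induction on the dimension: the integrand is continuous in the first entry and, by induction,
    measurable in the others, so [measurable_fun_caratheodory] applies. *)
Lemma measurable_shears d ks g x : size ks = d -> continuous g ->
  measurable_fun setT (fun v : d.-tuple rT => g (shears ks v x)).
Proof.
elim: d ks x => [|d IH] [|k ks] x //=.
move=> [sk] cg.
rewrite (_ : (fun _ => _) = (fun z : rT * d.-tuple rT => g (shears ks z.2 (shear tau k c x z.1))) \o @tuple_split R d).
  apply: measurableT_comp; last exact: measurable_tuple_split.
  apply: (@measurable_fun_caratheodory R _ (d.-tuple rT) (fun y t => g (shears ks t (shear tau k c x y)))).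
    move=> t y; apply: (cvg_comp (fun y => shears ks t (shear tau k c x y)) g); last exact: cg.
    by apply: continuous_shears; exact: continuous_shear.
  by move=> y; exact: IH.
by apply/funext => v; rewrite [v]tuple_eta /tuple_split /= theadE.
Qed.

(** Fubini peels off the first entry of the tuple, which is the variable of the outermost transform;
    [weight] supplies the absolute convergence. *)
Lemma Rintegral_shears d ks g x : size ks = d -> uniq ks -> tau \notin ks ->
  RPhi tau g ->
  \int[lebesgue_tuple R d]_v g (shears ks v x) =
  foldr (fun k h => partial_radon tau k c h) g ks x.
Proof.
move=> sk uks tks sg.
elim: d ks x sk uks tks => [|d IH] [|k ks] x //=.
  (* In dimension 0 the measure is the Dirac mass at the empty tuple. *)
  move=> _ _ _; rewrite /Rintegral integral_dirac//.
  by rewrite diracT mul1e.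
move=> [sk] /andP[kks uks]; rewrite inE negb_or => /andP[tk tks].
have cg := Sch_continuous sg.1.
rewrite (@Rintegral_tupleS R d (fun v => g (shears (k :: ks) v x))).
- by apply: eq_Rintegral => y _; rewrite -IH.
- by apply: (@measurable_shears d.+1 (k :: ks)) => //=; rewrite sk.
have [M gM] := Sch_weight (k :: ks) sg.1.
have i1 := integrable_oneDsqrV (M : R).
apply: (@integrable_prod_dominated _ _ _ _ R mu (lebesgue_tuple R d) _ _ _ _ i1 (integrable_weight d)).
  apply: (measurableT_comp (f := fun v : d.+1.-tuple rT => g (shears (k :: ks) v x))).
    by apply: measurable_shears => //=; rewrite sk.
  exact: measurable_tuple_cons.
move=> y v; have := gM (shears (k :: ks) (y :: v) x).
rewrite shears_weight//=; last 3 first.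
- by rewrite kks.
- by rewrite inE negb_or tk.
- by rewrite size_tuple sk.
by rewrite /weight big_cons mulrA.
Qed.

Lemma baut_iterated ks : tau \notin ks ->
  baut tau (fun g => foldr (fun k h => partial_radon tau k c h) g ks).
Proof.
elim: ks => [|k ks IH] /=; first by move=> _; exact: baut_id.
rewrite inE negb_or => /andP[tk tks].
have kt : k != tau by rewrite eq_sym.
exact: (baut_comp (baut_partial_radon kt c0) (IH tks)).
Qed.

End iterated_radon_tuple.

(** * The space Phi and its topology *)

Section complex_schwartz.
Context {R : realType} {m : nat}.
Implicit Types (g : 'rV[R]_m -> R) (f : 'rV[R]_m -> R[i]%C) (x : 'rV[R]_m).
Implicit Types (l s : seq 'I_m) (alpha : {ffun 'I_m -> nat}).
Local Open Scope complex_scope.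

Lemma monomial_count l x :
  monomial l x = \prod_(i < m) x 0 i ^+ ([ffun j => count_mem j l] : {ffun 'I_m -> nat}) i.
Proof.
elim: l => [|j l IH].
  by rewrite /monomial big_nil big1// => i _; rewrite ffunE expr0.
rewrite monomial_cons IH (bigD1 j)//= [in RHS](bigD1 j)//= !ffunE /= eqxx exprD expr1 mulrA.
by congr (_ * _); apply: eq_bigr => i /negbTE ij; rewrite !ffunE /= eq_sym ij.
Qed.

(** Translates the multi-indices of the Schwartz seminorms into lists of coordinates;
    [monomial_count] goes the other way. *)
Definition exponents alpha : seq 'I_m :=
  flatten [seq nseq (alpha i) i | i <- enum 'I_m].

Lemma monomial_exponents alpha x :
  monomial (exponents alpha) x = \prod_(i < m) x 0 i ^+ alpha i.
Proof.
rewrite /monomial big_flatten big_map big_enum; apply: eq_bigr => i _.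
by rewrite big_nseq -Monoid.iteropE.
Qed.

Lemma Re_weighted_partial alpha s f x : complex.Re (weighted_partial alpha s f x) =
  monomial (exponents alpha) x * iter_partial s (@complex.Re R \o f) x.
Proof. by rewrite monomial_exponents /weighted_partial /= mul0r subr0. Qed.

Lemma Im_weighted_partial alpha s f x : complex.Im (weighted_partial alpha s f x) =
  monomial (exponents alpha) x * iter_partial s (@complex.Im R \o f) x.
Proof. by rewrite monomial_exponents /weighted_partial /= mul0r addr0. Qed.

Lemma normr_Re_le (w : R[i]) (c : R) : `|w| <= c%:C -> `|complex.Re w| <= c.
Proof. by move=> wc; rewrite -lecR (le_trans (normc_ge_Re w)). Qed.

Lemma normr_Im_le (w : R[i]) (c : R) : `|w| <= c%:C -> `|complex.Im w| <= c.
Proof.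
move=> wc; rewrite -normrN -ReiNIm normr_Re_le// normrM.
suff -> : `|'i%C : R[i]| = 1 by rewrite mulr1.
by apply/eqP; rewrite eq_complex /= expr0n expr1n add0r sqrtr1 !eqxx.
Qed.

Lemma normc_le_add (w : R[i]) (a b : R) :
  `|complex.Re w| <= a -> `|complex.Im w| <= b -> `|w| <= (a + b)%:C.
Proof.
case: w => u v /= ua vb; rewrite normc_def /= lecR.
rewrite -[leRHS]ger0_norm ?addr_ge0//; [|exact: le_trans ua|exact: le_trans vb].
rewrite -sqrtr_sqr ler_wsqrtr// -(real_normK (num_real u)) -(real_normK (num_real v)).
have := normr_ge0 u; have := normr_ge0 v; nra.
Qed.

Lemma Sch_bounds g : diff_all g ->
  (forall l s, exists M, forall x, `|monomial l x * iter_partial s g x| <= M) -> Sch g.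
Proof.
move=> dg gb; split=> // N.
have [||M _ gM] := @uniform_bound R (N.-bseq 'I_m * N.-bseq 'I_m)%type
    (fun ls M => forall x, `|monomial ls.1 x * iter_partial ls.2 g x| <= M).
- by move=> ls M M' MM h x; rewrite (le_trans (h x)).
- by move=> ls; exact: gb.
by exists M => l s lN sN; exact: (gM (Bseq lN, Bseq sN)).
Qed.

Lemma smooth_diff_all g : smooth g -> diff_all g.
Proof. by move=> sg s x i; exact: (sg s).2. Qed.

Lemma Sch_smooth g : Sch g -> smooth g.
Proof.
move=> sg s; split; last by move=> x i; exact: sg.1.
by elim/last_ind: s g sg => [|s i IH] g sg;
  [exact: Sch_continuous|rewrite -iter_partial_pd; exact/IH/Sch_pd].
Qed.

Lemma schwartz_Sch f :
  schwartz f <-> Sch (@complex.Re R \o f) /\ Sch (@complex.Im R \o f).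
Proof.
split=> [[sr si fb]|[sr si]].
  have fM l s : exists M : R, forall x,
      `|weighted_partial [ffun j => count_mem j l] s f x| <= M%:C by exact: fb.
  split; apply: Sch_bounds; do ?exact: smooth_diff_all; move=> l s.
    have [M lM] := fM l s; exists M => x.
    by rewrite monomial_count -monomial_exponents -Re_weighted_partial; exact/normr_Re_le/lM.
  have [M lM] := fM l s; exists M => x.
  by rewrite monomial_count -monomial_exponents -Im_weighted_partial; exact/normr_Im_le/lM.
split; do ?exact: Sch_smooth; move=> alpha s.
pose N := maxn (size (exponents alpha)) (size s).
have [M1 h1] := sr.2 N; have [M2 h2] := si.2 N; exists (M1 + M2) => x.
apply: normc_le_add; rewrite ?Re_weighted_partial ?Im_weighted_partial.
  by apply: h1; rewrite leq_max leqnn ?orbT.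
by apply: h2; rewrite leq_max leqnn ?orbT.
Qed.

End complex_schwartz.

Section heisenberg_parts.
Context {R : realType} {n : nat}.
Local Notation m := (n + n + 1)%N.
Local Notation hc := (@heisenberg_coord R n).
Implicit Types (g : 'rV[R]_m -> R) (x : 'rV[R]_m) (phi : Phi R n).
Implicit Types (A B : ('rV[R]_m -> R) -> ('rV[R]_m -> R)).
Local Open Scope complex_scope.

Definition last_coord : 'I_m := rshift (n + n) (ord0 : 'I_1).
Local Notation tau := last_coord.

Lemma lshift_last (i : 'I_(n + n)) : lshift 1 i != tau.
Proof. by rewrite -val_eqE /= addn0 ltn_eqF// ltn_ord. Qed.

Lemma heisenberg_coordK x : real_coord (hc x).1 (hc x).2 = x.
Proof.
rewrite /real_coord -[RHS]hsubmxK; congr row_mx; last first.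
  by apply/rowP => i; rewrite !mxE /= !mxE !ord1.
rewrite -[RHS]hsubmxK; congr row_mx; apply/rowP => i; rewrite !mxE /=; congr (x _ _).
Qed.

Lemma heisenberg_coord_setc x (s : R) : hc (setc tau x s) = ((hc x).1, s).
Proof.
rewrite -[LHS]/(complex_coord (lsubmx (setc tau x s)), rsubmx (setc tau x s) 0 0).
congr pair; last by rewrite mxE setc_tau.
apply/rowP => j; rewrite mxE [in RHS]mxE; congr (_ +i* _).
  by rewrite mxE setc_neq ?lshift_last// mxE.
by rewrite mxE setc_neq ?lshift_last// mxE.
Qed.

Definition Re_part phi : 'rV[R]_m -> R := @complex.Re R \o (phi \o hc).
Definition Im_part phi : 'rV[R]_m -> R := @complex.Im R \o (phi \o hc).

Lemma Phi_ext phi psi : Re_part phi = Re_part psi -> Im_part phi = Im_part psi ->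
  phi = psi.
Proof.
move=> re im; apply/val_inj/val_inj/funext => -[z t] /=.
have /= := congr1 (@^~ (real_coord z t)) re.
have /= := congr1 (@^~ (real_coord z t)) im.
rewrite /Re_part /Im_part /= !real_coordK.
by case: (Phi_val phi _) => a b; case: (Phi_val psi _) => a' b' /= -> ->.
Qed.

Lemma schwartz_moments (f : schwartz_heisenberg R n) :
  moments0 tau (@complex.Re R \o (f \o hc)) /\ moments0 tau (@complex.Im R \o (f \o hc)) <->
  f \in @Phi_pred R n.
Proof.
have ReE k x s : complex.Re (f ((hc x).1, s) * (s ^+ k)%:C) =
    (@complex.Re R \o (f \o hc)) (setc tau x s) * s ^+ k.
  by rewrite /= heisenberg_coord_setc; case: (f _) => a b /=; rewrite mulr0 subr0.
have ImE k x s : complex.Im (f ((hc x).1, s) * (s ^+ k)%:C) =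
    (@complex.Im R \o (f \o hc)) (setc tau x s) * s ^+ k.
  by rewrite /= heisenberg_coord_setc; case: (f _) => a b /=; rewrite mulr0 add0r.
split=> [[re im]|/asboolP f0].
  apply/asboolP => k z; rewrite /Cintegral.
  have -> : z = (hc (real_coord z 0)).1 by rewrite real_coordK.
  under eq_Rintegral do rewrite ReE.
  rewrite re.
  by under eq_Rintegral do rewrite ImE; rewrite im.
split=> k x; have [re im] := f0 k (hc x).1.
  by rewrite -re; apply: eq_Rintegral => s _; rewrite ReE.
by rewrite -im; apply: eq_Rintegral => s _; rewrite ImE.
Qed.

Lemma RPhi_parts phi : RPhi tau (Re_part phi) /\ RPhi tau (Im_part phi).
Proof.
have /asboolP/schwartz_Sch[sr si] := schwartz_funP (Phi_val phi).
by have /schwartz_moments[mr mi] := Phi_valP phi.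
Qed.

Section of_parts.
Variables (g h : 'rV[R]_m -> R) (rg : RPhi tau g) (rh : RPhi tau h).

Definition of_parts_fun (p : heisenberg R n) : R[i] :=
  g (real_coord p.1 p.2) +i* h (real_coord p.1 p.2).

Lemma Re_of_parts_fun : @complex.Re R \o (of_parts_fun \o hc) = g.
Proof. by apply/funext => x; rewrite /of_parts_fun /= heisenberg_coordK. Qed.

Lemma Im_of_parts_fun : @complex.Im R \o (of_parts_fun \o hc) = h.
Proof. by apply/funext => x; rewrite /of_parts_fun /= heisenberg_coordK. Qed.

Lemma of_parts_schwartz : of_parts_fun \in @schwartz_pred R n.
Proof.
apply/asboolP/schwartz_Sch; rewrite Re_of_parts_fun Im_of_parts_fun.
by split; [exact: rg.1|exact: rh.1].
Qed.

Lemma of_parts_moments : SchwartzHeisenberg of_parts_schwartz \in @Phi_pred R n.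
Proof.
apply/schwartz_moments; rewrite Re_of_parts_fun Im_of_parts_fun.
by split; [exact: rg.2|exact: rh.2].
Qed.

Definition of_parts : Phi R n := MkPhi of_parts_moments.

Lemma Re_of_parts : Re_part of_parts = g. Proof. exact: Re_of_parts_fun. Qed.
Lemma Im_of_parts : Im_part of_parts = h. Proof. exact: Im_of_parts_fun. Qed.

End of_parts.

Section lift.
Variables (A : ('rV[R]_m -> R) -> ('rV[R]_m -> R)) (bA : bop tau A).

Definition lift phi : Phi R n :=
  of_parts (bop_RPhi bA (RPhi_parts phi).1) (bop_RPhi bA (RPhi_parts phi).2).

Lemma Re_lift phi : Re_part (lift phi) = A (Re_part phi).
Proof. exact: Re_of_parts. Qed.

Lemma Im_lift phi : Im_part (lift phi) = A (Im_part phi).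
Proof. exact: Im_of_parts. Qed.

Lemma Re_part_comb (a : R[i]) phi psi : Re_part (a *: phi + psi) =
  lcomb 1 1 (lcomb (complex.Re a) (- complex.Im a) (Re_part phi) (Im_part phi)) (Re_part psi).
Proof.
rewrite [LHS](Re_comb a (phi \o hc) (psi \o hc)) /lcomb.
by apply/funext => x; rewrite !scale1r !fctE !mul1r -addrA.
Qed.

Lemma Im_part_comb (a : R[i]) phi psi : Im_part (a *: phi + psi) =
  lcomb 1 1 (lcomb (complex.Re a) (complex.Im a) (Im_part phi) (Re_part phi)) (Im_part psi).
Proof.
rewrite [LHS](Im_comb a (phi \o hc) (psi \o hc)) /lcomb.
by apply/funext => x; rewrite !scale1r !fctE !mul1r -addrA.
Qed.

Lemma lift_is_linear : linear lift.
Proof.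
move=> a phi psi; have [r1 i1] := RPhi_parts phi; have [r2 i2] := RPhi_parts psi.
by apply: Phi_ext; rewrite ?Re_lift ?Im_lift ?Re_part_comb ?Im_part_comb;
  rewrite !(bop_lin bA)// ?Re_lift ?Im_lift//; exact: RPhi_lcomb.
Qed.

End lift.

Lemma liftK A B (bA : bop tau A) (bB : bop tau B) :
  (forall g, RPhi tau g -> B (A g) = g) -> cancel (lift bA) (lift bB).
Proof.
move=> AK phi; have [rp ip] := RPhi_parts phi.
by apply: Phi_ext; rewrite ?Re_lift ?Im_lift AK.
Qed.

End heisenberg_parts.

Section schwartz_topology.
Context {R : realType} {n : nat}.
Local Notation m := (n + n + 1)%N.
Local Notation hc := (@heisenberg_coord R n).
Local Notation tau := (@last_coord n).
Local Notation diff g h := (lcomb 1 (-1) g h).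
Implicit Types (g : 'rV[R]_m -> R) (x : 'rV[R]_m) (phi psi : Phi R n).
Implicit Types (alpha : {ffun 'I_m -> nat}) (s : seq 'I_m).
Local Open Scope complex_scope.

Lemma diff_Re_weighted_partial alpha s phi psi x :
  complex.Re (weighted_partial alpha s (phi \o hc) x -
              weighted_partial alpha s (psi \o hc) x) =
  monomial (exponents alpha) x * iter_partial s (diff (Re_part phi) (Re_part psi)) x.
Proof.
have [[[dp _] _] _] := RPhi_parts phi; have [[[dq _] _] _] := RPhi_parts psi.
rewrite iter_partial_lcomb// /lcomb mulrDr mulrCA mul1r mulN1r mulrN.
by rewrite raddfB /= -!Re_weighted_partial.
Qed.

Lemma diff_Im_weighted_partial alpha s phi psi x :
  complex.Im (weighted_partial alpha s (phi \o hc) x -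
              weighted_partial alpha s (psi \o hc) x) =
  monomial (exponents alpha) x * iter_partial s (diff (Im_part phi) (Im_part psi)) x.
Proof.
have [_ [[dp _] _]] := RPhi_parts phi; have [_ [[dq _] _]] := RPhi_parts psi.
rewrite iter_partial_lcomb// /lcomb mulrDr mulrCA mul1r mulN1r mulrN.
by rewrite raddfB /= -!Im_weighted_partial.
Qed.

(** Each weighted derivative is a component of the map defining the Schwartz topology, hence
    continuous for uniform convergence. *)
Lemma near_weighted_partial alpha s phi (e : R) : 0 < e ->
  \forall psi \near phi, forall x,
    `|weighted_partial alpha s (Phi_val psi \o hc) x - weighted_partial alpha s (phi \o hc) x| <= e%:C.
Proof.
move=> e0.
pose V := {uniform 'rV[R]_m -> R[i]^o}.
pose F (psi : Phi R n) : V := schwartz_embedding (Phi_val psi) (alpha, s).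
have cF : continuous F.
  move=> psi.
  apply: (continuous_comp (f := @Phi_val R n) (g := fun f => schwartz_embedding f (alpha, s))).
    exact: initial_continuous.
  apply: (continuous_comp (f := @schwartz_embedding R n) (g := fun f => f (alpha, s))).
    exact: initial_continuous.
  exact: (@proj_continuous _ (fun _ => V) (alpha, s)).
apply: (cF phi [set f | forall x, `|f x - weighted_partial alpha s (phi \o hc) x| <= e%:C]).
apply/uniform_nbhs; exists [set xy : R[i]^o * R[i]^o | ball xy.1 e%:C xy.2]; split.
  rewrite -(@entourage_from_ballE _ R[i]^o).
  by exists e%:C => //=; rewrite ltcR.
by move=> h hP x; have := hP x I; rewrite /ball/= distrC => /ltW.
Qed.

Lemma near_seminorm_le (N : nat) phi (e : R) : 0 < e ->
  \forall psi \near phi, seminorm_le N e (diff (Re_part psi) (Re_part phi)) /\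
                         seminorm_le N e (diff (Im_part psi) (Im_part phi)).
Proof.
move=> e0.
have := @filter_forall _ (N.-bseq 'I_m * N.-bseq 'I_m)%type _ _ (nbhs_filter phi)
   (fun ls => near_weighted_partial [ffun j => count_mem j ls.1] ls.2 phi e0).
apply: filterS => psi H; split=> l s lN sN x.
  rewrite monomial_count -monomial_exponents -diff_Re_weighted_partial.
  exact/normr_Re_le/(H (Bseq lN, Bseq sN)).
rewrite monomial_count -monomial_exponents -diff_Im_weighted_partial.
exact/normr_Im_le/(H (Bseq lN, Bseq sN)).
Qed.

(** The topology is initial along the inclusion and then along [schwartz_embedding], whose target is
    a product; continuity is therefore checked for one weighted derivative at a time. *)
Lemma continuous_Phi (T : topologicalType) (F : T -> Phi R n) :
  (forall a N (e : R), 0 < e -> \forall b \near a,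
     seminorm_le N e (diff (Re_part (F b)) (Re_part (F a))) /\
     seminorm_le N e (diff (Im_part (F b)) (Im_part (F a)))) ->
  continuous F.
Proof.
move=> FN.
apply: continuous_comp_initial; apply: continuous_comp_initial => a.
apply/cvg_sup => -[alpha s].
pose V := {uniform 'rV[R]_m -> R[i]^o}.
apply: (@continuous_comp_initial _ T V (fun f => f (alpha, s))) => {}a.
move=> P /uniform_nbhs[E [/= entE EP]].
have := entE; rewrite -(@entourage_from_ballE _ R[i]^o) => -[d d0 dE].
(* The radius [d] is a positive element of [R[i]], so its imaginary part is zero. *)
pose e := complex.Re d.
have de : d = e%:C.
  have : 0 < d by [].
  by rewrite ltcE => /andP[/eqP d1 _]; apply/eqP; rewrite eq_complex d1 !eqxx.
have e0 : 0 < e by rewrite -ltcR -de.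
pose N := maxn (size (exponents alpha)) (size s).
(* Real and imaginary parts contribute one third each, which leaves the strict inequality of an open
   ball. *)
have e3 : 0 < e / 3 by rewrite divr_gt0.
have := FN a N _ e3; apply: filterS => b [hr hi].
apply: EP => x _; apply: dE; rewrite /ball/= distrC de.
apply: (le_lt_trans (y := (e / 3 + e / 3)%:C)); last by rewrite ltcR; lra.
apply: normc_le_add; rewrite ?diff_Re_weighted_partial ?diff_Im_weighted_partial.
  by apply: hr; rewrite leq_max leqnn ?orbT.
by apply: hi; rewrite leq_max leqnn ?orbT.
Qed.

(** By linearity a difference of values is the operator applied to a difference, so the seminorm
    estimate is continuity at every point. The radius is divided by [K%:R + 1] because [K] may be
    0. *)
Lemma continuous_lift (A : ('rV[R]_m -> R) -> ('rV[R]_m -> R)) (bA : bop tau A) : continuous (lift bA).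
Proof.
apply: continuous_Phi => phi N e e0.
have [K KA] := bop_seminorm bA N.
have K0 : 0 < K%:R + 1 :> R by rewrite ltr_wpDl.
have := near_seminorm_le K phi (divr_gt0 e0 K0); apply: filterS => psi [hr hi].
have le : K%:R * (e / (K%:R + 1)) <= e.
  by rewrite mulrCA ger_pMr// ler_pdivrMr// mul1r lerDl.
have [rp ip] := RPhi_parts phi; have [rq iq] := RPhi_parts psi.
by split; rewrite ?Re_lift ?Im_lift -(bop_lin bA)//; apply: seminorm_leW (leqnn N) le _;
   apply: KA => //; exact: RPhi_lcomb.
Qed.

End schwartz_topology.

(** * Factorization of the Heisenberg Radon transform *)

Section radon_factorization.
Context {R : realType} {n : nat}.
Local Notation m := (n + n + 1)%N.
Local Notation hc := (@heisenberg_coord R n).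
Local Notation tau := (@last_coord n).
Implicit Types (g : 'rV[R]_m -> R) (x : 'rV[R]_m) (phi : Phi R n).
Local Open Scope complex_scope.

Definition space_coords : seq 'I_m := [seq lshift 1 i | i <- enum 'I_(n + n)].

Lemma size_space_coords : size space_coords = (n + n)%N.
Proof. by rewrite size_map size_enum_ord. Qed.

Lemma nth_space_coords (i : 'I_(n + n)) : nth tau space_coords i = lshift 1 i.
Proof. by rewrite (nth_map i) ?size_enum_ord// nth_ord_enum. Qed.

Lemma uniq_space_coords : uniq space_coords.
Proof. by rewrite map_inj_uniq ?enum_uniq//; exact: lshift_inj. Qed.

Lemma last_notin_space_coords : tau \notin space_coords.
Proof. by apply/mapP => -[i _ it]; have := lshift_last i; rewrite -it eqxx. Qed.

(* [signed_perm swap_coords swap_sign] is (x, y, t) |-> (y, -x, t) on R^n * R^n * R. *)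
Definition swap_coords (i : 'I_m) : 'I_m :=
  match fintype.split i with
  | inl j => lshift 1 (match fintype.split j with
                       | inl a => rshift n a | inr a => lshift n a end)
  | inr _ => i
  end.

Definition swap_sign (i : 'I_m) : R :=
  match fintype.split i with
  | inl j => match fintype.split j with inl _ => 1 | inr _ => -1 end
  | inr _ => 1
  end.

Let splitl (p q : nat) (i : 'I_p) : fintype.split (lshift q i) = inl i.
Proof. exact: (unsplitK (inl i)). Qed.
Let splitr (p q : nat) (i : 'I_q) : fintype.split (rshift p i) = inr i.
Proof. exact: (unsplitK (inr i)). Qed.

Lemma swap_coordsK : involutive swap_coords.
Proof.
move=> i; rewrite -[ i ]splitK; case: (fintype.split i) => [j|j] /=.
  rewrite -[j]splitK; case: (fintype.split j) => [a|a] /=;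
    by rewrite /swap_coords ?(splitl, splitr).
by rewrite /swap_coords ?(splitl, splitr).
Qed.

Lemma swap_signM i : swap_sign i * swap_sign i = 1.
Proof.
rewrite /swap_sign; case: (fintype.split i) => [j|_]; last by rewrite mulr1.
by case: (fintype.split j) => _; rewrite ?mulr1// mulrNN mulr1.
Qed.

Local Notation swap := (signed_perm swap_coords swap_sign).

Definition real_radon g : 'rV[R]_m -> R :=
  foldr (fun k h => partial_radon tau k (- 2^-1) h) g space_coords \o swap.

Lemma baut_real_radon : baut tau real_radon.
Proof.
have b1 : baut tau (fun g => g \o swap).
  apply: (baut_signed_perm swap_coordsK swap_coordsK swap_signM).
    by rewrite /swap_coords /last_coord splitr.
  by rewrite /swap_sign /last_coord splitr.
apply: (baut_comp b1); apply: baut_iterated; last exact: last_notin_space_coords.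
by rewrite oppr_eq0 invr_eq0 pnatr_eq0.
Qed.

(** Im(z_j conj zeta_j) = Im z_j Re zeta_j - Re z_j Im zeta_j pairs the coordinates of zeta with
    those of the rotated point (Im z, - Re z). By [shears_tau], the composed shears displace the
    central variable by exactly this pairing times -1/2. *)
Lemma heisenberg_coord_shears (v : (n + n).-tuple R) (z : 'rV[R[i]]_n) (t : R) :
  hc (shears tau (- 2^-1) space_coords v (swap (real_coord z t))) =
  let zeta := complex_coord (\row_i tnth v i : 'rV[R]_(n + n)) in
  (zeta, t - 2^-1 * complex.Im (\sum_(j < n) z 0 j * (zeta 0 j)^*)).
Proof.
set y := swap _; set u := shears _ _ _ _ _.
have sv : size v = size space_coords by rewrite size_tuple size_space_coords.
have uE i : u 0 (lshift 1 i) = tnth v i.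
  rewrite -nth_space_coords shears_nth ?uniq_space_coords ?last_notin_space_coords//.
    by rewrite (tnth_nth 0).
  by rewrite size_space_coords.
rewrite -[LHS]/(complex_coord (lsubmx u), rsubmx u 0 0) /=.
have -> : lsubmx u = \row_i tnth v i by apply/rowP => i; rewrite [LHS]mxE [RHS]mxE -uE.
congr pair; rewrite mxE -/tau shears_tau ?uniq_space_coords ?last_notin_space_coords//.
have yl a : y 0 (lshift 1 (lshift n a)) = complex.Im (z 0 a).
  by rewrite mxE /swap_sign /swap_coords !splitl mul1r row_mxEl row_mxEr mxE.
have yr a : y 0 (lshift 1 (rshift n a)) = - complex.Re (z 0 a).
  by rewrite mxE /swap_sign /swap_coords splitl splitr mulN1r !row_mxEl mxE.
have -> : y 0 tau = t.
  by rewrite mxE /swap_sign /swap_coords splitr mul1r row_mxEr mxE.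
rewrite mulNr; congr (_ - _ * _); rewrite size_space_coords.
rewrite big_split_ord /= -big_split raddf_sum /=; apply: eq_bigr => j _.
rewrite (nth_space_coords (lshift n j)) (nth_space_coords (rshift n j)) yl yr.
rewrite -(tnth_nth 0 v (lshift n j)) -(tnth_nth 0 v (rshift n j)) !mxE.
by case: (z 0 j) => a b /=; ring.
Qed.

(** [Rintegral_shears] turns the iterated transform at the rotated point into one integral over
    R^(2n), whose integrand [heisenberg_coord_shears] identifies, separately for real and imaginary
    parts. *)
Lemma lift_real_radon (bA : bop tau real_radon) phi :
  (lift bA phi : heisenberg R n -> R[i]) = heisenberg_radon phi.
Proof.
have [rp ip] := RPhi_parts phi.
apply/funext => -[z t]; rewrite /heisenberg_radon /Cintegral.
rewrite -[LHS]/(real_radon (Re_part phi) (real_coord z t) +i*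
                real_radon (Im_part phi) (real_coord z t)).
have sv := size_space_coords; have us := uniq_space_coords.
have ls := last_notin_space_coords.
rewrite /real_radon /= -!(Rintegral_shears _ _ sv us ls)//.
congr (_ +i* _); apply: eq_Rintegral => v _.
  by rewrite -[LHS]/(complex.Re (phi (hc _))) heisenberg_coord_shears.
by rewrite -[LHS]/(complex.Im (phi (hc _))) heisenberg_coord_shears.
Qed.

End radon_factorization.

Theorem theorem7p3 (R : realType) (n : nat) (hn : (1 <= n)%N) :
  exists T : {linear Phi R n -> Phi R n},
    (forall phi : Phi R n,
       (T phi : heisenberg R n -> R[i]%C) = heisenberg_radon phi) /\
    is_automorphism T.
Proof.
have [bA [B [bB AK BK]]] := @baut_real_radon R n.
pose L := GRing.isLinear.Build _ _ _ _ (lift bA) (lift_is_linear bA).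
pose T : {linear Phi R n -> Phi R n} := HB.pack (lift bA) L.
exists T; split; first by move=> phi; exact: lift_real_radon.
split; first exact: continuous_lift.
exists (lift bB); first exact: continuous_lift.
by split; exact: liftK.
Qed.
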